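(* Let $m\ge2$. The canonical solution operator to $\overline\partial$ restricted to $A^2(\mathbb C,e^{-|z|^m})$, as an operator into $L^2(\mathbb C,e^{-|z|^m})$, is not a Hilbert–Schmidt operator.
   Context: For $m>0$, $L^2(\mathbb C,e^{-|z|^m})$ is the space of measurable $u$ with $\int_{\mathbb C}|u|^2e^{-|z|^m}d\lambda<\infty$ ($d\lambda$ Lebesgue measure), and $A^2(\mathbb C,e^{-|z|^m})$ its closed subspace of entire functions. The canonical solution operator assigns to $f\in A^2(\mathbb C,e^{-|z|^m})$ the unique $u\in L^2(\mathbb C,e^{-|z|^m})$ with $\overline\partial u=f$ and $u\perp A^2(\mathbb C,e^{-|z|^m})$. *)

(* Defs.v *)
From HB Require Import structures.
From mathcomp Require Import all_boot all_order all_algebra.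
From mathcomp Require Import all_classical all_reals all_analysis.
From mathcomp Require Import complex.
Import Order.TTheory GRing.Theory Num.Theory.
Import numFieldNormedType.Exports.

Set Implicit Arguments.
Unset Strict Implicit.
Unset Printing Implicit Defensive.

Local Open Scope ring_scope.
Local Open Scope classical_set_scope.

(* The complex plane is modelled as R * R (for Lebesgue measure) and as R[i]
   (for holomorphy); [toC] identifies them: (x, y) |-> x + i y. *)
Definition toC {R : realType} (z : R * R) : R[i] := (z.1 +i* z.2)%C.

Definition leb2 (R : realType) := (@lebesgue_measure R \x @lebesgue_measure R)%E.

Definition cabs {R : realType} (z : R * R) : R := Num.sqrt (z.1 ^+ 2 + z.2 ^+ 2).

Definition weight {R : realType} (m : R) (z : R * R) : R := expR (- (cabs z `^ m)).

Definition sqnorm {R : realType} (c : R[i]) : R := (complex.Re c) ^+ 2 + (complex.Im c) ^+ 2.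

Definition cint {R : realType} (f : R * R -> R[i]) : R[i] :=
  ((Rintegral (@leb2 R) setT (fun z => complex.Re (f z)))
     +i* (Rintegral (@leb2 R) setT (fun z => complex.Im (f z))))%C.

Definition L2norm2 {R : realType} (m : R) (u : R * R -> R[i]) : \bar R :=
  (\int[@leb2 R]_z (sqnorm (u z) * weight m z)%:E)%E.

Definition inL2 {R : realType} (m : R) (u : R * R -> R[i]) : Prop :=
  [/\ measurable_fun setT (fun z => complex.Re (u z)),
      measurable_fun setT (fun z => complex.Im (u z)) &
      (L2norm2 m u < +oo)%E].

Definition ip {R : realType} (m : R) (f g : R * R -> R[i]) : R[i] :=
  cint (fun z => f z * conjc (g z) * (weight m z)%:C%C).

Definition entire {R : realType} (h : R[i] -> R[i]) : Prop :=
  forall z : R[i], derivable (h : R[i]^o -> R[i]^o) z 1.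

Definition inA2 {R : realType} (m : R) (h : R[i] -> R[i]) : Prop :=
  entire h /\ inL2 m (h \o toC).

Fixpoint iterD {R : realType} (l : seq (R * R)) (f : R * R -> R) : R * R -> R :=
  match l with
  | [::] => f
  | v :: l' => 'D_v (iterD l' f)
  end.

Definition smooth {R : realType} (f : R * R -> R) : Prop :=
  forall l : seq (R * R),
    continuous (iterD l f) /\ forall x v, derivable (iterD l f) x v.

Definition test_fun {R : realType} (phi : R * R -> R) : Prop :=
  smooth phi /\ exists r : R, forall z : R * R, r < `|z| -> phi z = 0.

Definition dbar_test {R : realType} (phi : R * R -> R) (z : R * R) : R[i] :=
  ((2^-1 * 'D_(1, 0) phi z) +i* (2^-1 * 'D_(0, 1) phi z))%C.

Definition weak_dbar {R : realType} (u f : R * R -> R[i]) : Prop :=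
  forall phi : R * R -> R, test_fun phi ->
    cint (fun z => f z * (phi z)%:C%C) = - cint (fun z => u z * dbar_test phi z).

Definition canonical_solution {R : realType} (m : R) (f : R[i] -> R[i])
    (u : R * R -> R[i]) : Prop :=
  [/\ inL2 m u, weak_dbar u (f \o toC) &
      forall h, inA2 m h -> ip m u (h \o toC) = 0].

Definition A2_onb {R : realType} (m : R) (e : nat -> R[i] -> R[i]) : Prop :=
  [/\ forall k, inA2 m (e k),
      forall j k, ip m (e j \o toC) (e k \o toC) = (j == k)%:R &
      forall h, inA2 m h -> (forall k, ip m (h \o toC) (e k \o toC) = 0) ->
        forall w, h w = 0].

(* Main.v *)
(* If [\sum_k ||u_k||^2 <= X], expand [phi_n = z^n / ||z^n||] in the basis [e_k]
   and put [v_(n,K) = \sum_(k < K) <phi_n, e_k> u_k]. Bessel's inequality, applied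
   at each point [z], gives [\sum_n ||v_(n,K)||^2 <= X], while [v_(n,K)] has weak
   d-bar derivative [g_(n,K) = \sum_(k < K) <phi_n, e_k> e_k], which tends to
   [phi_n]. Pair [g_(n,K)] with [psi = conj z ^ n w chi], where [w = exp (- |z|^m)]
   and [chi] is a radial cutoff: by Cauchy-Schwarz
   [|\int g psi|^2 <= ||v||^2 \int |d-bar psi|^2 / w]. With
   [c_n = \int |z|^(2 n) w], an integration by parts bounds the last integral by
   [C n c_(n-1)], whereas [\int phi_n psi] is at least a multiple of [sqrt c_n].
   Hence [\sum_n c_n / (n c_(n-1)) <= C X]. But [c_n / c_(n-1)] is nondecreasing,
   so this sum dominates the harmonic series.

   The convergence of [g_(n,K)] requires that [A^2] be closed under limits of
   partial sums; this follows from the weak Cauchy-Riemann equations (Goursat) and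
   from the mean value property with respect to a fixed radial kernel. *)
Require Import Defs.
From HB Require Import structures.
From mathcomp Require Import all_boot all_order all_algebra.
From mathcomp Require Import all_classical all_reals all_analysis.
From mathcomp Require Import complex.
From mathcomp Require Import measurable_realfun.
From mathcomp Require Import ring lra zify.
Import Order.TTheory GRing.Theory Num.Theory.
Import numFieldNormedType.Exports.
Local Open Scope ring_scope.

Set Implicit Arguments.
Unset Strict Implicit.
Unset Printing Implicit Defensive.

(** * Calculus and integration on the plane *)

Local Open Scope classical_set_scope.

Section plane_integration.
Context {R : realType}.
Implicit Types (f g : R * R -> R) (h : R -> R).
Local Notation mu := (@leb2 R).

(** [entire] gives a derivative at each point and no continuity of it, and the functions are tested
    by plane integrals only. Hence no contour and no polar coordinates: Goursat's bisection runs on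
    products of B-splines, which are [C^1] and refine themselves, and means over circles become
    integrals against radial kernels [k(|z - w|^2)]. The same device gives the orthogonality of the
    monomials and the integration by parts in the radius. The weight need not be smooth at the
    origin, so test functions are cut off near 0 as well as near infinity, and every bound has to be
    uniform in the cutoff. The integrand [|d-bar psi|^2 / w] contains the square of
    [n - (m / 2) |z|^m], which no multiple of [n] dominates pointwise. A radial function of integral
    zero contains the same square; subtracting it leaves a remainder linear in [n], and this is
    where the factor [n], hence the harmonic series, comes from. The two orthonormal systems have
    different roles: orthonormality of [phi_n] gives Bessel's inequality, completeness of [e_k]
    gives the convergence. *)

Lemma open_measurable_prod (U : set (R * R)) : open U -> measurable U.
Proof.
move=> oU.
pose box (q : rat * rat * nat) : set (R * R) :=
  ball (ratr q.1.1 : R) (q.2.+1%:R^-1) `*` ball (ratr q.1.2 : R) (q.2.+1%:R^-1).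
have -> : U = \bigcup_(q in [set q | box q `<=` U]) box q.
  apply/seteqP; split => [z Uz|z [q qU /qU//]].
  have /nbhs_ballP[e /= e0 eU] : nbhs z U by apply: open_nbhs_nbhs.
  (* The rational center is within [1 / (k + 1)] of [z] and the box has that half-width, so the box
     stays within [2 / (k + 1) < e] of [z]. *)
  pose k := Num.Def.trunc (2 / e).
  have k0 : 0 < k.+1%:R^-1 :> R by rewrite invr_gt0.
  have ke : 2 * k.+1%:R^-1 < e.
    have := truncnS_gt (2 / e); rewrite -/k => ke.
    by rewrite ltr_pdivrMr// mulrC -ltr_pdivrMr.
  have dns (x : R) : exists q : rat, `|ratr q - x| < k.+1%:R^-1.
    have [] := @rat_in_itvoo R (x - k.+1%:R^-1) (x + k.+1%:R^-1).
      by rewrite ltrBlDr -addrA ltrDl addr_gt0.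
    move=> q; rewrite in_itv/= => /andP[q1 q2]; exists q.
    by rewrite ltr_norml ltrBlDl q2 ltrBrDl q1.
  have [a az] := dns z.1. have [b bz] := dns z.2.
  exists (a, b, k) => /=; last by split.
  move=> y [/= ya yb]; apply: eU; split => /=; move: ya yb az bz ke;
    rewrite /ball/=; move: (k.+1%:R^-1) => d ya yb az bz ke.
    by have := ler_distD (ratr a) z.1 y.1; rewrite (distrC z.1 (ratr a)); lra.
  by have := ler_distD (ratr b) z.2 y.2; rewrite (distrC z.2 (ratr b)); lra.
rewrite bigcup_mkcond; apply: countable_bigcupT_measurable => // q.
case: ifPn => // _; apply: measurableX; exact: measurable_ball.
Qed.

Lemma continuous_measurable_prod f : continuous f -> measurable_fun setT f.
Proof.
move=> cf; apply: (measurability _ (RGenOpens.measurableE R)).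
move=> _ [_ [a [b ->] <-]]; rewrite setTI; apply: open_measurable_prod.
by apply: open_comp => // ? _; exact: cf.
Qed.

Lemma leb2_box (a b c d : R) : a <= b -> c <= d ->
  mu (`[a, b] `*` `[c, d]) = ((b - a) * (d - c))%:E.
Proof.
move=> ab cd; rewrite /leb2 product_measure1E//= !lebesgue_measure_itv/= !lte_fin.
rewrite EFinM; congr (_ * _)%E; case: ltP => //.
  by move=> ba; rewrite (_ : a = b) ?subrr//; apply/eqP; rewrite eq_le ab.
by move=> ba; rewrite (_ : c = d) ?subrr//; apply/eqP; rewrite eq_le cd.
Qed.

Lemma norm_pair_le (z : R * R) (r : R) : (`|z| <= r) = (`|z.1| <= r) && (`|z.2| <= r).
Proof. by rewrite prod_normE ge_max. Qed.

Lemma compact_support_bounded f (r : R) : continuous f ->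
  (forall z, r < `|z| -> f z = 0) -> exists M : R, forall z, `|f z| <= M.
Proof.
move=> cf fr.
have cK : compact (`[- r, r] `*` `[- r, r] : set (R * R)).
  by apply: compact_setX; exact: segment_compact.
have /compact_bounded[M [_ /(_ (M + 1))]] :
    compact (f @` (`[- r, r] `*` `[- r, r])).
  by apply: continuous_compact => //; exact: continuous_subspaceT.
rewrite ltrDl ltr01 => /(_ isT) bM; exists (Num.max 0 (M + 1)) => z.
have [zr|/fr ->] := leP `|z| r; last by rewrite normr0 le_max lexx.
rewrite le_max; apply/orP; right; apply: bM; exists z => //.
move: zr; rewrite norm_pair_le => /andP[].
by rewrite !ler_norml; split => /=; rewrite in_itv.
Qed.

Lemma measurable_compact_support_integrable f (r M : R) : measurable_fun setT f ->
  (forall z, r < `|z| -> f z = 0) -> (forall z, `|f z| <= M) ->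
  mu.-integrable setT (EFin \o f).
Proof.
move=> mf fr fM.
pose K : set (R * R) := `[- `|r|, `|r|] `*` `[- `|r|, `|r|].
have mK : measurable K by apply: measurableX; exact: measurable_itv.
have -> : EFin \o f = (EFin \o f) \_ K.
  apply/funext => z; rewrite patchE; case: ifPn => // /negP zK /=.
  rewrite fr// ltNge; apply/negP => zr; apply: zK; rewrite inE.
  have : `|z| <= `|r| by apply: (le_trans zr); exact: ler_norm.
  by rewrite norm_pair_le => /andP[]; rewrite !ler_norml; split => /=; rewrite in_itv.
apply/integrable_restrict => //; rewrite setTI.
apply: measurable_bounded_integrable => //.
- have : (mu K < +oo)%E by rewrite /K leb2_box ?ltry// ge0_cp.
  by [].
- exact: measurable_funS mf.
- exists `|M|; split; first by rewrite num_real.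
  move=> x Mx y /= _; apply: (le_trans (fM y)); apply: ltW.
  by apply: le_lt_trans Mx; exact: ler_norm.
Qed.

Lemma continuous_compact_support_integrable f (r : R) : continuous f ->
  (forall z, r < `|z| -> f z = 0) -> mu.-integrable setT (EFin \o f).
Proof.
move=> cf fr; have [M fM] := compact_support_bounded cf fr.
apply: measurable_compact_support_integrable fr fM.
exact: continuous_measurable_prod.
Qed.

Lemma integral_derivative_compact_support h (h' : R -> R) (r : R) :
  (forall x : R, is_derive x (1 : R) h (h' x)) -> continuous h' ->
  (forall x, r < `|x| -> h x = 0) -> (forall x, r < `|x| -> h' x = 0) ->
  (\int[lebesgue_measure]_x (h' x)%:E = 0)%E.
Proof.
move=> dh ch' h0 h'0.
pose s : R := `|r| + 1.
have s0 : 0 < s by rewrite /s; have := normr_ge0 r; lra.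
have rs : r < s by rewrite /s; have := ler_norm r; lra.
pose K : set R := `[- s, s].
have -> : (\int[lebesgue_measure]_x (h' x)%:E =
    \int[lebesgue_measure]_(x in K) (h' x)%:E)%E.
  rewrite [RHS]integral_mkcond; apply: eq_integral => x _.
  rewrite patchE; case: ifPn => // /negP xs; rewrite h'0//.
  rewrite ltNge; apply/negP => xr; apply: xs; rewrite inE /K/= in_itv/=.
  by rewrite -ler_norml (le_trans xr)// ltW.
rewrite (@continuous_FTC2 _ _ h).
- by rewrite !h0 ?subee// ?normrN gtr0_norm.
- by lra.
- exact: continuous_subspaceT.
- have ch : continuous h.
    move=> x; apply: differentiable_continuous; apply/derivable1_diffP.
    exact: ex_derive.
  split.
  + by move=> x _; exact: ex_derive.
  + apply: cvg_at_right_filter; exact: ch.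
  + apply: cvg_at_left_filter; exact: ch.
- by move=> x _; rewrite derive1E derive_val.
Qed.

(** The partial derivatives are carried as explicit functions, so that product and chain rules
    compute them and integrands can be rewritten pointwise. *)
Definition C1 f gx gy :=
  [/\ forall z, is_derive z ((1, 0) : R * R) f (gx z),
      forall z, is_derive z ((0, 1) : R * R) f (gy z),
      continuous f, continuous gx & continuous gy].

Definition C1c f gx gy :=
  C1 f gx gy /\ exists r, forall z, r < `|z| -> [/\ f z = 0, gx z = 0 & gy z = 0].

Lemma scaleR1 (x : R) : x *: (1 : R) = x.
Proof. exact: mulr1. Qed.

Lemma is_derive_line (f : R * R -> R) (z v : R * R) (d x : R) :
  is_derive (x *: v + z) v f d -> is_derive x (1 : R) (fun t => f (t *: v + z)) d.
Proof.
move=> [].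
have E : (fun h : R => h^-1 *: (f (h *: v + (x *: v + z)) - f (x *: v + z))) =
  (fun h : R => h^-1 *: (f ((h *: (1 : R) + x) *: v + z) - f (x *: v + z))).
  by apply/funext => h; rewrite scaleR1 scalerDl addrA.
rewrite /derivable /derive E => cvf fd.
by apply: DeriveDef.
Qed.

Lemma C1_partial_x f gx gy (x y : R) : C1 f gx gy ->
  is_derive x (1 : R) (fun t => f (t, y)) (gx (x, y)).
Proof.
move=> [dx _ _ _ _]; have := dx (x, y).
have E t : (t, y) = t *: ((1, 0) : R * R) + (0, y).
  by apply: injective_projections; rewrite /= ?scaleR1 ?scaler0 ?addr0 ?add0r.
rewrite [X in is_derive X]E => /is_derive_line.
by under eq_fun do rewrite -E.
Qed.

Lemma C1_partial_y f gx gy (x y : R) : C1 f gx gy ->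
  is_derive y (1 : R) (fun t => f (x, t)) (gy (x, y)).
Proof.
move=> [_ dy _ _ _]; have := dy (x, y).
have E t : (x, t) = t *: ((0, 1) : R * R) + (x, 0).
  by apply: injective_projections; rewrite /= ?scaleR1 ?scaler0 ?addr0 ?add0r.
rewrite [X in is_derive X]E => /is_derive_line.
by under eq_fun do rewrite -E.
Qed.

Lemma continuous_pairl g (y : R) : continuous g -> continuous (fun x : R => g (x, y)).
Proof.
move=> cg x; have P := cvg_pair (@cvg_id _ (nbhs x)) (@cvg_cst _ y _ (nbhs x) _).
exact: (cvg_comp _ _ (P _ _ _ _) (cg (x, y))).
Qed.

Lemma continuous_pairr g (x : R) : continuous g -> continuous (fun y : R => g (x, y)).
Proof.
move=> cg y; have P := cvg_pair (@cvg_cst _ x _ (nbhs y) _) (@cvg_id _ (nbhs y)).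
exact: (cvg_comp _ _ (P _ _ _ _) (cg (x, y))).
Qed.

Lemma C1c_integral_x f gx gy : C1c f gx gy -> Rintegral mu setT gx = 0.
Proof.
move=> [fC [r rf]]; have [_ _ cf cgx _] := fC.
have igx : mu.-integrable setT (EFin \o gx).
  by apply: (@continuous_compact_support_integrable _ r) => // z /rf[].
rewrite /Rintegral -(integral21_prod_meas1 igx) integral0_eq// => y _.
rewrite /fubini_G; apply: (@integral_derivative_compact_support (fun x => f (x, y)) _ r).
- by move=> x; exact: C1_partial_x fC.
- exact: continuous_pairl.
- move=> x xr; have [] // := rf (x, y).
  by rewrite prod_normE lt_max xr.
- move=> x xr; have [] // := rf (x, y).
  by rewrite prod_normE lt_max xr.
Qed.

Lemma C1c_integral_y f gx gy : C1c f gx gy -> Rintegral mu setT gy = 0.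
Proof.
move=> [fC [r rf]]; have [_ _ cf _ cgy] := fC.
have igy : mu.-integrable setT (EFin \o gy).
  by apply: (@continuous_compact_support_integrable _ r) => // z /rf[].
rewrite /Rintegral -(integral12_prod_meas1 igy) integral0_eq// => x _.
rewrite /fubini_F; apply: (@integral_derivative_compact_support (fun y => f (x, y)) _ r).
- by move=> y; exact: C1_partial_y fC.
- exact: continuous_pairr.
- move=> y yr; have [] // := rf (x, y).
  by rewrite prod_normE lt_max yr orbT.
- move=> y yr; have [] // := rf (x, y).
  by rewrite prod_normE lt_max yr orbT.
Qed.

Lemma C1M f fx fy g gx gy : C1 f fx fy -> C1 g gx gy ->
  C1 (fun z => f z * g z) (fun z => fx z * g z + f z * gx z)
     (fun z => fy z * g z + f z * gy z).
Proof.
move=> [dfx dfy cf cfx cfy] [dgx dgy cg cgx cgy]; split.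
- move=> z; apply: is_derive_eq; rewrite /GRing.scale/=; ring.
- move=> z; apply: is_derive_eq; rewrite /GRing.scale/=; ring.
- by move=> z; apply: cvgM; [exact: cf|exact: cg].
- by move=> z; apply: cvgD; apply: cvgM;
    [exact: cfx|exact: cg|exact: cf|exact: cgx].
- by move=> z; apply: cvgD; apply: cvgM;
    [exact: cfy|exact: cg|exact: cf|exact: cgy].
Qed.

Lemma C1cM f fx fy g gx gy : C1 f fx fy -> C1c g gx gy ->
  C1c (fun z => f z * g z) (fun z => fx z * g z + f z * gx z)
     (fun z => fy z * g z + f z * gy z).
Proof.
move=> fC [gC [r gr]]; split; first exact: C1M.
by exists r => z /gr[-> -> ->]; rewrite !mulr0 addr0.
Qed.

Lemma C1D f fx fy g gx gy : C1 f fx fy -> C1 g gx gy ->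
  C1 (fun z => f z + g z) (fun z => fx z + gx z) (fun z => fy z + gy z).
Proof.
move=> [dfx dfy cf cfx cfy] [dgx dgy cg cgx cgy]; split.
- move=> z; exact: is_deriveD.
- move=> z; exact: is_deriveD.
- by move=> z; apply: cvgD; [exact: cf|exact: cg].
- by move=> z; apply: cvgD; [exact: cfx|exact: cgx].
- by move=> z; apply: cvgD; [exact: cfy|exact: cgy].
Qed.

Lemma C1_cst (a : R) : C1 (fun=> a) (fun=> 0) (fun=> 0).
Proof.
by split => z; [exact: is_derive_cst|exact: is_derive_cst|exact: cvg_cst..].
Qed.

Lemma is_derive_fst (z v : R * R) : is_derive z v (fst : R * R -> R) v.1.
Proof.
have E : (fun h : R => h^-1 *: ((h *: v + z).1 - z.1)) @ 0^' --> v.1.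
  apply: cvg_near_cst; near=> h.
  rewrite /= addrK /GRing.scale/= mulKf//; near: h; exact: nbhs_dnbhs_neq.
apply: DeriveDef; first by apply/cvg_ex; exists v.1.
exact: cvg_lim.
Unshelve. all: by end_near. Qed.

Lemma is_derive_snd (z v : R * R) : is_derive z v (snd : R * R -> R) v.2.
Proof.
have E : (fun h : R => h^-1 *: ((h *: v + z).2 - z.2)) @ 0^' --> v.2.
  apply: cvg_near_cst; near=> h.
  rewrite /= addrK /GRing.scale/= mulKf//; near: h; exact: nbhs_dnbhs_neq.
apply: DeriveDef; first by apply/cvg_ex; exists v.2.
exact: cvg_lim.
Unshelve. all: by end_near. Qed.

Lemma C1_fst : C1 fst (fun=> 1) (fun=> 0).
Proof.
split=> z; [exact: is_derive_fst|exact: is_derive_fst|exact: cvg_fst|exact: cvg_cst..].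
Qed.

Lemma C1_snd : C1 snd (fun=> 0) (fun=> 1).
Proof.
split=> z; [exact: is_derive_snd|exact: is_derive_snd|exact: cvg_snd|exact: cvg_cst..].
Qed.

Lemma is_derive_comp_real (h : R -> R) f (z v : R * R) (d e : R) :
  is_derive (f z) (1 : R) h d -> is_derive z v f e ->
  is_derive z v (h \o f) (d * e).
Proof.
move=> dh df.
have L (g : R * R -> R) c : is_derive 0 (1 : R) (fun t => g (t *: v + z)) c ->
    is_derive z v g c.
  move=> []; rewrite /derivable /derive.
  have -> : (fun x : R => x^-1 *: (g ((x *: (1 : R) + 0) *: v + z) - g (0 *: v + z))) =
    (fun x : R => x^-1 *: (g (x *: v + z) - g z)).
    by apply/funext => x; rewrite scaleR1 addr0 scale0r add0r.
  by move=> ? ?; exact: DeriveDef.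
apply: L; have := @is_derive1_comp R h (fun t => f (t *: v + z)) 0 d e; apply.
  by rewrite scale0r add0r.
by apply: is_derive_line; rewrite scale0r add0r.
Qed.

Lemma C1_comp (h h' : R -> R) f fx fy : (forall x : R, is_derive x (1 : R) h (h' x)) ->
  continuous h' -> C1 f fx fy ->
  C1 (fun z => h (f z)) (fun z => h' (f z) * fx z) (fun z => h' (f z) * fy z).
Proof.
move=> dh ch' [dfx dfy cf cfx cfy].
have ch : continuous h.
  by move=> x; apply: differentiable_continuous; apply/derivable1_diffP; exact: ex_derive.
split=> z; [exact: is_derive_comp_real|exact: is_derive_comp_real|..].
- by apply: (cvg_comp f h); [exact: cf|exact: ch].
- apply: cvgM; last exact: cfx.
  by apply: (cvg_comp f h'); [exact: cf|exact: ch'].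
- apply: cvgM; last exact: cfy.
  by apply: (cvg_comp f h'); [exact: cf|exact: ch'].
Qed.

End plane_integration.

(** * Quadratic B-splines *)

Section spline.
Context {R : realType}.
Implicit Types x : R.

(** A quadratic remainder bound treats the knots and the smooth pieces of a spline alike, by
    inequalities on each side. *)
Lemma is_derive_quadratic (f : R -> R) (d C x : R) :
  (forall h : R, `|f (x + h) - f x - d * h| <= C * h ^+ 2) -> is_derive x (1 : R) f d.
Proof.
move=> fC; apply/is_derive1_caratheodory.
exists (fun z => if z == x then d else (f z - f x) / (z - x)); split.
- move=> z; case: eqVneq => [->|zx]; first by rewrite !subrr mulr0.
  by rewrite divfK// subr_eq0.
- apply/cvgrPdist_le => /= e e0; rewrite eqxx; near=> z.
  case: eqVneq => [_|zx]; first by rewrite subrr normr0 ltW.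
  have zx0 : z - x != 0 by rewrite subr_eq0.
  have := fC (z - x); rewrite [x + _]addrC subrK => H.
  have -> : d - (f z - f x) / (z - x) = - ((f z - f x - d * (z - x)) / (z - x)).
    by field.
  rewrite normrN normrM normfV ler_pdivrMr ?normr_gt0//.
  apply: (le_trans H); rewrite -real_normK ?num_real// expr2 mulrA.
  apply: ler_wpM2r => //.
  have C1 : `|C| + 1 > 0 by rewrite ltr_wpDl.
  have : `|z - x| <= e / (`|C| + 1).
    rewrite distrC; near: z; apply: cvgr_dist_le; first exact: cvg_id.
    by rewrite divr_gt0.
  rewrite ler_pdivlMr// => ezx; apply: le_trans ezx; rewrite mulrC.
  by apply: ler_wpM2l => //; rewrite (le_trans (ler_norm C))// lerDl.
- by rewrite eqxx.
Unshelve. all: by end_near. Qed.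

Definition pos x : R := Num.max 0 x.

Lemma pos_id x : 0 <= x -> pos x = x. Proof. by move=> x0; rewrite /pos; case: ltgtP x0. Qed.
Lemma pos_0 x : x <= 0 -> pos x = 0. Proof. by move=> x0; rewrite /pos; case: ltgtP x0. Qed.

Lemma posP x : (0 <= x /\ pos x = x) \/ (x <= 0 /\ pos x = 0).
Proof. by case: (leP 0 x) => [x0|/ltW x0]; [left; rewrite pos_id|right; rewrite pos_0]. Qed.

Lemma continuous_pos : continuous pos.
Proof.
move=> x; apply/cvgrPdist_le => /= e e0; near=> y.
have : `|x - y| <= e by near: y; apply: cvgr_dist_le => //; exact: cvg_id.
rewrite !ler_norml => /andP[].
by case: (posP x) => [] [? ->]; case: (posP y) => [] [? ->] ? ?; apply/andP; split; lra.
Unshelve. all: by end_near. Qed.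

Lemma is_derive_pos2 x : is_derive x (1 : R) (fun x => pos x ^+ 2) (2 * pos x).
Proof.
apply: (@is_derive_quadratic _ _ 1) => h; rewrite mul1r ler_norml.
by case: (posP x) => [] [? ->]; case: (posP (x + h)) => [] [? ->];
  apply/andP; split; nra.
Qed.

Lemma is_derive_comp_shift (f : R -> R) (d c x : R) :
  is_derive (x - c) (1 : R) f d -> is_derive x (1 : R) (fun x => f (x - c)) d.
Proof.
move=> fd; rewrite -[d]mulr1; apply: (@is_derive1_comp R f (fun x => x - c)) => //.
by rewrite -[1 in X in is_derive _ _ _ X]subr0; apply: is_deriveB.
Qed.

(* The quadratic B-spline with knots 0, 1, 2, 3, and its derivative *)
Definition bspline x : R := (pos x ^+ 2 - 3 * pos (x - 1) ^+ 2
  + 3 * pos (x - 2) ^+ 2 - pos (x - 3) ^+ 2) / 2.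
Definition bspline' x : R := pos x - 3 * pos (x - 1) + 3 * pos (x - 2) - pos (x - 3).

Lemma continuous_shift_pos (c : R) : continuous (fun x => pos (x - c)).
Proof.
move=> x; apply: (cvg_comp (fun x => x - c) pos); last exact: continuous_pos.
by apply: cvgB; [exact: cvg_id|exact: cvg_cst].
Qed.

Lemma continuous_bspline' : continuous bspline'.
Proof.
move=> x; apply: cvgB; last exact: continuous_shift_pos.
apply: cvgD; last by apply: cvgMr; exact: continuous_shift_pos.
apply: cvgB; first exact: continuous_pos.
by apply: cvgMr; exact: continuous_shift_pos.
Qed.

Lemma bspline_out x : x <= 0 \/ 3 <= x -> bspline x = 0 /\ bspline' x = 0.
Proof.
rewrite /bspline /bspline' => -[x0|x3].
  by rewrite !pos_0; try lra; rewrite expr0n/=; lra.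
by rewrite !pos_id; try lra; split; field.
Qed.

Lemma bspline_bound x : `|bspline x| <= 36 /\ `|bspline' x| <= 36.
Proof.
(* The constant 36 is crude; only its independence of [x] matters. *)
have [x0|x0] := leP x 0.
  by have [-> ->] := bspline_out (or_introl x0); rewrite normr0.
have [x3|x3] := leP 3 x.
  by have [-> ->] := bspline_out (or_intror x3); rewrite normr0.
rewrite /bspline /bspline' !ler_norml (pos_id (ltW x0)) (@pos_0 (x - 3)); last lra.
by case: (posP (x - 1)) => [] [? ->]; case: (posP (x - 2)) => [] [? ->];
  split; apply/andP; split; nra.
Qed.

Lemma pos2M2 x : pos (2 * x) = 2 * pos x.
Proof.
by case: (posP x) => [] [? ->]; case: (posP (2 * x)) => [] [? ->]; lra.
Qed.

Lemma pos_subB x (a b c : R) : a + b = c -> pos (x - a - b) = pos (x - c).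
Proof. by move=> <-; rewrite opprD addrA. Qed.

Lemma pos_half x (a b : R) : 2 * a = b -> pos (x - a) = pos (2 * x - b) / 2.
Proof. by move=> <-; rewrite -mulrBr pos2M2 mulrC mulKf. Qed.

(** The two-scale relation, with binomial weights 1, 3, 3, 1. Splines of half the size thereby take
    the part of the quarters of a square in a bisection. *)
Lemma bspline_refine x : bspline x = (bspline (2 * x) + 3 * bspline (2 * x - 1)
  + 3 * bspline (2 * x - 2) + bspline (2 * x - 3)) / 4.
Proof.
have h (a b c : nat) : (a + b = c)%N -> pos (2 * x - a%:R - b%:R) = pos (2 * x - c%:R).
  by move=> <-; apply: pos_subB; rewrite natrD.
have g (a b : nat) : (2 * a = b)%N -> pos (x - a%:R) = pos (2 * x - b%:R) / 2.
  by move=> <-; apply: pos_half; rewrite natrM.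
rewrite /bspline pos2M2 (g 1 2)// (g 2 4)// (g 3 6)// (h 1 1 2)// (h 1 2 3)// (h 1 3 4)//.
rewrite (h 2 1 3)// (h 2 2 4)// (h 2 3 5)// (h 3 1 4)// (h 3 2 5)// (h 3 3 6)//.
move: (pos x) (pos (2 * x - 1)) (pos (2 * x - 2)) (pos (2 * x - 3)) (pos (2 * x - 4))
  (pos (2 * x - 5)) (pos (2 * x - 6)) => a b c d e f k; by field.
Qed.

Lemma bspline'_refine x : bspline' x = (bspline' (2 * x) + 3 * bspline' (2 * x - 1)
  + 3 * bspline' (2 * x - 2) + bspline' (2 * x - 3)) / 2.
Proof.
have h (a b c : nat) : (a + b = c)%N -> pos (2 * x - a%:R - b%:R) = pos (2 * x - c%:R).
  by move=> <-; apply: pos_subB; rewrite natrD.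
have g (a b : nat) : (2 * a = b)%N -> pos (x - a%:R) = pos (2 * x - b%:R) / 2.
  by move=> <-; apply: pos_half; rewrite natrM.
rewrite /bspline' pos2M2 (g 1 2)// (g 2 4)// (g 3 6)// (h 1 1 2)// (h 1 2 3)// (h 1 3 4)//.
rewrite (h 2 1 3)// (h 2 2 4)// (h 2 3 5)// (h 3 1 4)// (h 3 2 5)// (h 3 3 6)//.
move: (pos x) (pos (2 * x - 1)) (pos (2 * x - 2)) (pos (2 * x - 3)) (pos (2 * x - 4))
  (pos (2 * x - 5)) (pos (2 * x - 6)) => a b c d e f k; by field.
Qed.

(** A [C^1] step from 0 to 1 on [0, 2]. A B-spline is the difference of two neighbouring steps, so
    sums of its integer translates telescope. *)
Definition sstep x : R := (pos x ^+ 2 - 2 * pos (x - 1) ^+ 2 + pos (x - 2) ^+ 2) / 2.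
Definition sstep' x : R := pos x - 2 * pos (x - 1) + pos (x - 2).

Lemma is_derive_sstep x : is_derive x (1 : R) sstep (sstep' x).
Proof.
have d0 := is_derive_pos2 x.
have d1 := is_derive_comp_shift (is_derive_pos2 (x - 1)).
have d2 := is_derive_comp_shift (is_derive_pos2 (x - 2)).
rewrite (_ : sstep = (2^-1 *: ((fun x => pos x ^+ 2) - 2 *: (fun x => pos (x - 1) ^+ 2)
  + (fun x => pos (x - 2) ^+ 2)))); last first.
  by apply/funext => y; rewrite /sstep /= mulrC.
apply: is_derive_eq; rewrite /sstep' /GRing.scale/=.
by move: (pos x) (pos (x - 1)) (pos (x - 2)) => a b c; field.
Qed.

Lemma continuous_sstep' : continuous sstep'.
Proof.
move=> x; apply: cvgD; last exact: continuous_shift_pos.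
apply: cvgB; first exact: continuous_pos.
by apply: cvgMr; exact: continuous_shift_pos.
Qed.

Lemma bspline_sstep x : bspline x = sstep x - sstep (x - 1).
Proof.
have h (a b c : nat) : (a + b = c)%N -> pos (x - a%:R - b%:R) = pos (x - c%:R).
  by move=> <-; apply: pos_subB; rewrite natrD.
rewrite /bspline /sstep (h 1 1 2)// (h 1 2 3)//.
by move: (pos x) (pos (x - 1)) (pos (x - 2)) (pos (x - 3)) => a b c d; field.
Qed.

Lemma bspline'_sstep' x : bspline' x = sstep' x - sstep' (x - 1).
Proof.
have h (a b c : nat) : (a + b = c)%N -> pos (x - a%:R - b%:R) = pos (x - c%:R).
  by move=> <-; apply: pos_subB; rewrite natrD.
rewrite /bspline' /sstep' (h 1 1 2)// (h 1 2 3)//.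
by move: (pos x) (pos (x - 1)) (pos (x - 2)) (pos (x - 3)) => a b c d; ring.
Qed.

Lemma is_derive_bspline x : is_derive x (1 : R) bspline (bspline' x).
Proof.
rewrite (_ : bspline = sstep - (fun x => sstep (x - 1))); last first.
  by apply/funext => y; exact: bspline_sstep.
rewrite bspline'_sstep'; apply: is_deriveB; first exact: is_derive_sstep.
by apply: is_derive_comp_shift; exact: is_derive_sstep.
Qed.

Lemma sstep_le0 x : x <= 0 -> sstep x = 0 /\ sstep' x = 0.
Proof.
move=> x0; rewrite /sstep /sstep' !pos_0; lra.
Qed.

Lemma sstep_ge2 x : 2 <= x -> sstep x = 1 /\ sstep' x = 0.
Proof.
move=> x0; rewrite /sstep /sstep' !pos_id; lra.
Qed.

End spline.

(** * Integrals of real functions over the plane *)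

Section real_integral_plane.
Context {R : realType}.
Implicit Types f g : R * R -> R.
Local Notation mu := (@leb2 R).
Local Notation ig f := (mu.-integrable setT (EFin \o f)).
Local Notation rint := (Rintegral mu setT).

Lemma ig_eq f g : f =1 g -> ig f -> ig g.
Proof. by move=> /funext ->. Qed.

Lemma igD f g : ig f -> ig g -> ig (fun z => f z + g z).
Proof. by move=> fi gi; exact: (integrableD _ fi gi). Qed.

Lemma igB f g : ig f -> ig g -> ig (fun z => f z - g z).
Proof. by move=> fi gi; exact: (integrableB _ fi gi). Qed.

Lemma igZ (a : R) f : ig f -> ig (fun z => a * f z).
Proof. by move=> fi; exact: (integrableZl _ _ fi). Qed.

Lemma rintD f g : ig f -> ig g -> rint (fun z => f z + g z) = rint f + rint g.
Proof. by move=> fi gi; rewrite RintegralD. Qed.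

Lemma rintB f g : ig f -> ig g -> rint (fun z => f z - g z) = rint f - rint g.
Proof. by move=> fi gi; rewrite RintegralB. Qed.

Lemma rintZ (a : R) f : ig f -> rint (fun z => a * f z) = a * rint f.
Proof. by move=> fi; rewrite RintegralZl. Qed.

Lemma eq_rint f g : f =1 g -> rint f = rint g.
Proof. by move=> /funext ->. Qed.

Lemma rintD_eq f g h (a b : R) : ig f -> ig g -> (forall z, h z = a * f z + b * g z) ->
  rint h = a * rint f + b * rint g.
Proof.
by move=> fi gi /funext ->; rewrite rintD ?rintZ//; exact: igZ.
Qed.

Lemma rint0 : rint (fun=> 0) = 0.
Proof. by rewrite /Rintegral integral0_eq. Qed.

Lemma rint_le f g : ig f -> ig g -> (forall z, f z <= g z) -> rint f <= rint g.
Proof. by move=> fi gi fg; apply: le_Rintegral. Qed.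

Lemma rint_norm_le f g : ig f -> ig g -> (forall z, `|f z| <= g z) -> `|rint f| <= rint g.
Proof.
move=> fi gi fg; apply: le_trans (le_normr_Rintegral _ fi) _ => //.
apply: le_Rintegral => //; exact: (integrable_abse fi).
Qed.

Lemma box_indicator (a b c d : R) (K := (`[a, b] `*` `[c, d])%classic : set (R * R)) :
  a <= b -> c <= d -> ig \1_K /\ rint \1_K = (b - a) * (d - c).
Proof.
move=> ab cd.
have mK : measurable K by apply: measurableX; exact: measurable_itv.
have muK : mu K = ((b - a) * (d - c))%:E by rewrite leb2_box.
have mI : (\int[mu]_x (\1_K x)%:E)%E = ((b - a) * (d - c))%:E.
  by rewrite -muK integral_indic// setIT.
split; last by rewrite /Rintegral mI.
apply/integrableP; split; first by apply/measurable_EFinP.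
rewrite (_ : (fun _ => _) = (fun z => (\1_K z)%:E)) ?mI ?ltry//.
by apply/funext => z /=; rewrite ger0_norm// indicE ler0n.
Qed.

Lemma box_indicE (a b c d : R) (z : R * R) :
  \1_(`[a, b] `*` `[c, d])%classic z = ((a <= z.1 <= b) && (c <= z.2 <= d))%:R :> R.
Proof.
rewrite indicE; congr ((nat_of_bool _)%:R); apply/idP/andP => [|[z1 z2]].
  by rewrite inE => -[]; rewrite /= !in_itv.
by rewrite inE; split; rewrite /= in_itv.
Qed.

Lemma rint_box_le f (a b c d B : R) : a <= b -> c <= d -> 0 <= B -> ig f ->
  (forall z, a <= z.1 <= b -> c <= z.2 <= d -> `|f z| <= B) ->
  (forall z, ~~ (a <= z.1 <= b) || ~~ (c <= z.2 <= d) -> f z = 0) ->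
  `|rint f| <= B * ((b - a) * (d - c)).
Proof.
move=> ab cd B0 fi fB f0; have [iK <-] := box_indicator ab cd.
rewrite -rintZ//; apply: rint_norm_le => //; first exact: igZ.
move=> z; rewrite box_indicE; case: (boolP (_ && _)) => [/andP[z1 z2]|].
  by rewrite mulr1 fB.
by rewrite negb_and mulr0 => /f0 ->; rewrite normr0.
Qed.

Lemma rint_box_ge f (a b c d B : R) : a <= b -> c <= d -> ig f -> (forall z, 0 <= f z) ->
  (forall z, a <= z.1 <= b -> c <= z.2 <= d -> B <= f z) ->
  B * ((b - a) * (d - c)) <= rint f.
Proof.
move=> ab cd fi f0 fB; have [iK <-] := box_indicator ab cd.
rewrite -rintZ//; apply: rint_le => //; first exact: igZ.
move=> z; rewrite box_indicE; case: (boolP (_ && _)) => [/andP[z1 z2]|_].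
  by rewrite mulr1 fB.
by rewrite mulr0.
Qed.

Lemma cont_mul_C1c_integrable (P : R * R -> R) g gx gy : continuous P -> C1c g gx gy ->
  [/\ ig (fun z => P z * g z), ig (fun z => P z * gx z) & ig (fun z => P z * gy z)].
Proof.
move=> cP [[_ _ cg cgx cgy] [r gr]]; split;
  apply: (@continuous_compact_support_integrable _ _ r);
  (try by move=> z; apply: cvgM; [exact: cP|first [exact: cg|exact: cgx|exact: cgy]]);
  by move=> z /gr[g0 gx0 gy0]; rewrite ?g0 ?gx0 ?gy0 mulr0.
Qed.

(** The linear part has trace [a - a = 0]: integration by parts leaves [- a g] from the first
    component and [a g] from the second. *)
Lemma affine_flux_zero (p : R * R) (A C a b c : R) g gx gy : C1c g gx gy ->
  rint (fun z => (A + a * (z.1 - p.1) + b * (z.2 - p.2)) * gx z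
    + (C + c * (z.1 - p.1) - a * (z.2 - p.2)) * gy z) = 0.
Proof.
move=> gC.
have aff (u v w : R) : C1 (fun z : R * R => u + v * (z.1 - p.1) + w * (z.2 - p.2))
    (fun=> v) (fun=> w).
  have D1 := C1M (C1_cst v) (C1D (@C1_fst R) (C1_cst (- p.1))).
  have D2 := C1M (C1_cst w) (C1D (@C1_snd R) (C1_cst (- p.2))).
  have := C1D (C1D (C1_cst u) D1) D2.
  by congr C1; apply/funext => z /=; ring.
have F1 := C1c_integral_x (C1cM (aff A a b) gC).
have F2 := C1c_integral_y (C1cM (aff C c (- a)) gC).
have caff u v w : continuous (fun z : R * R => u + v * (z.1 - p.1) + w * (z.2 - p.2)).
  by have [] := aff u v w.
have [ig0 _ _] := cont_mul_C1c_integrable (@cst_continuous _ _ a) gC.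
have [_ igx _] := cont_mul_C1c_integrable (caff A a b) gC.
have [_ _ igy] := cont_mul_C1c_integrable (caff C c (- a)) gC.
have [ig0' _ _] := cont_mul_C1c_integrable (@cst_continuous _ _ (- a)) gC.
rewrite rintD// in F1; rewrite rintD// in F2.
rewrite (eq_rint (g := fun z => (A + a * (z.1 - p.1) + b * (z.2 - p.2)) * gx z
    + (C + c * (z.1 - p.1) + - a * (z.2 - p.2)) * gy z)); last by move=> z; ring.
rewrite rintD//; have : rint (fun z => - a * g z) = - rint (fun z => a * g z).
  rewrite -[RHS]mulN1r -rintZ//; apply: eq_rint => z; ring.
lra.
Qed.

End real_integral_plane.

(** * Goursat's theorem *)

Section goursat.
Context {R : realType}.
Implicit Types f g : R * R -> R.
Local Notation mu := (@leb2 R).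
Local Notation ig f := (mu.-integrable setT (EFin \o f)).
Local Notation rint := (Rintegral mu setT).

(** In weak form, minus the divergence of [(P, Q)] integrated against the function whose partial
    derivatives are [gx] and [gy]. *)
Definition flux (P Q gx gy : R * R -> R) : R := rint (fun z => P z * gx z + Q z * gy z).

Definition dmul f fx g gx : R * R -> R := fun z => fx z * g z + f z * gx z.

Definition cellx (x0 h : R) (z : R * R) : R := bspline ((z.1 - x0) / h).
Definition cellx' (x0 h : R) (z : R * R) : R := bspline' ((z.1 - x0) / h) / h.
Definition celly (y0 h : R) (z : R * R) : R := bspline ((z.2 - y0) / h).
Definition celly' (y0 h : R) (z : R * R) : R := bspline' ((z.2 - y0) / h) / h.

Lemma C1_eq f fx fy f' fx' fy' : C1 f fx fy -> f =1 f' -> fx =1 fx' -> fy =1 fy' ->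
  C1 f' fx' fy'.
Proof. by move=> fC /funext <- /funext <- /funext <-. Qed.

Lemma C1c_eq f fx fy f' fx' fy' : C1c f fx fy -> f =1 f' -> fx =1 fx' -> fy =1 fy' ->
  C1c f' fx' fy'.
Proof. by move=> fC /funext <- /funext <- /funext <-. Qed.

Lemma C1_compx (b b' : R -> R) (x0 h : R) :
  (forall x : R, is_derive x (1 : R) b (b' x)) -> continuous b' ->
  C1 (fun z : R * R => b ((z.1 - x0) / h)) (fun z => b' ((z.1 - x0) / h) / h) (fun=> 0).
Proof.
move=> db cb'.
have A := C1M (C1_cst h^-1) (C1D (@C1_fst R) (C1_cst (- x0))).
apply: (C1_eq (C1_comp db cb' A)) => z /=; first by rewrite mulrC.
- by rewrite mul0r add0r addr0 mulr1 [h^-1 * _]mulrC.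
- by rewrite addr0 mulr0 mul0r addr0 mulr0.
Qed.

Lemma C1_compy (b b' : R -> R) (y0 h : R) :
  (forall x : R, is_derive x (1 : R) b (b' x)) -> continuous b' ->
  C1 (fun z : R * R => b ((z.2 - y0) / h)) (fun=> 0) (fun z => b' ((z.2 - y0) / h) / h).
Proof.
move=> db cb'.
have A := C1M (C1_cst h^-1) (C1D (@C1_snd R) (C1_cst (- y0))).
apply: (C1_eq (C1_comp db cb' A)) => z /=; first by rewrite mulrC.
- by rewrite addr0 mulr0 mul0r addr0 mulr0.
- by rewrite mul0r add0r addr0 mulr1 [h^-1 * _]mulrC.
Qed.

Lemma C1_cellx (x0 h : R) : C1 (cellx x0 h) (cellx' x0 h) (fun=> 0).
Proof. by apply: C1_compx; [exact: is_derive_bspline|exact: continuous_bspline']. Qed.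

Lemma C1_celly (y0 h : R) : C1 (celly y0 h) (fun=> 0) (celly' y0 h).
Proof. by apply: C1_compy; [exact: is_derive_bspline|exact: continuous_bspline']. Qed.

Context {P Q : R * R -> R} (cP : continuous P) (cQ : continuous Q).

Lemma flux_integrable g gx gy : C1c g gx gy -> ig (fun z => P z * gx z + Q z * gy z).
Proof.
move=> gC; have [_ ix _] := cont_mul_C1c_integrable cP gC.
by have [_ _ iy] := cont_mul_C1c_integrable cQ gC; exact: igD.
Qed.

(** The weights 1/4, 3/4, 3/4, 1/4 add up to 2, so at least one of the four children carries half of
    the flux in absolute value. *)
Lemma flux_refine f fx fy (F Fx Fy : nat -> R * R -> R) g gx gy : C1c g gx gy ->
  (forall i, C1 (F i) (Fx i) (Fy i)) ->
  (forall z, f z = (F 0 z + 3 * F 1 z + 3 * F 2 z + F 3 z) / 4) ->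
  (forall z, fx z = (Fx 0 z + 3 * Fx 1 z + 3 * Fx 2 z + Fx 3 z) / 4) ->
  (forall z, fy z = (Fy 0 z + 3 * Fy 1 z + 3 * Fy 2 z + Fy 3 z) / 4) ->
  exists i, (i <= 3)%N /\
  `|flux P Q (dmul f fx g gx) (dmul f fy g gy)| / 2 <=
  `|flux P Q (dmul (F i) (Fx i) g gx) (dmul (F i) (Fy i) g gy)|.
Proof.
move=> gC FC fE fxE fyE.
pose e i z := P z * dmul (F i) (Fx i) g gx z + Q z * dmul (F i) (Fy i) g gy z.
have ie i : ig (e i) by apply: flux_integrable; exact: (C1cM (FC i) gC).
have E : flux P Q (dmul f fx g gx) (dmul f fy g gy) =
    4^-1 * (rint (e 0) + 3 * rint (e 1) + 3 * rint (e 2) + rint (e 3)).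
  rewrite -!rintZ// -rintD; [|exact: ie|exact: igZ].
  rewrite -rintD; [|by apply: igD; [exact: ie|exact: igZ]|exact: igZ].
  have i012 : ig (fun z => e 0 z + 3 * e 1 z + 3 * e 2 z).
    by apply: igD; [apply: igD; [exact: ie|exact: igZ]|exact: igZ].
  rewrite -rintD// -rintZ; last exact: igD.
  by apply: eq_rint => z; rewrite /e /dmul fE fxE fyE; field.
rewrite E; set s := _ + rint (e 3).
have [h0|h0] := leP (`|4^-1 * s| / 2) `|rint (e 0)|; first by exists 0%N.
have [h1|h1] := leP (`|4^-1 * s| / 2) `|rint (e 1)|; first by exists 1%N.
have [h2|h2] := leP (`|4^-1 * s| / 2) `|rint (e 2)|; first by exists 2%N.
exists 3%N; split => //; rewrite -/(rint (e 3)).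
have : `|s| <= `|rint (e 0)| + 3 * `|rint (e 1)| + 3 * `|rint (e 2)| + `|rint (e 3)|.
  rewrite /s; apply: (le_trans (ler_normD _ _)); rewrite lerD2r.
  apply: (le_trans (ler_normD _ _)); rewrite normrM (@ger0_norm _ 3)// lerD2r.
  by apply: (le_trans (ler_normD _ _)); rewrite normrM (@ger0_norm _ 3).
move: h0 h1 h2; rewrite normrM (@ger0_norm _ 4^-1) ?invr_ge0//.
move: `|rint (e 0)| `|rint (e 1)| `|rint (e 2)| `|s| => a b c t.
rewrite /flux -/(e 3); lra.
Qed.

Lemma cellx_refine (x0 h : R) z : h != 0 ->
  cellx x0 h z = (cellx (x0 + 0%:R * (h / 2)) (h / 2) z + 3 * cellx (x0 + 1%:R * (h / 2)) (h / 2) z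
    + 3 * cellx (x0 + 2%:R * (h / 2)) (h / 2) z + cellx (x0 + 3%:R * (h / 2)) (h / 2) z) / 4 /\
  cellx' x0 h z = (cellx' (x0 + 0%:R * (h / 2)) (h / 2) z + 3 * cellx' (x0 + 1%:R * (h / 2)) (h / 2) z
    + 3 * cellx' (x0 + 2%:R * (h / 2)) (h / 2) z + cellx' (x0 + 3%:R * (h / 2)) (h / 2) z) / 4.
Proof.
move=> h0; have A (i : R) : (z.1 - (x0 + i * (h / 2))) / (h / 2) = 2 * ((z.1 - x0) / h) - i.
  by field.
rewrite /cellx /cellx' !A subr0 bspline_refine bspline'_refine; split => //.
move: (bspline' _) (bspline' _) (bspline' _) (bspline' _) => a b c d; by field.
Qed.

Lemma celly_refine (y0 h : R) z : h != 0 ->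
  celly y0 h z = (celly (y0 + 0%:R * (h / 2)) (h / 2) z + 3 * celly (y0 + 1%:R * (h / 2)) (h / 2) z
    + 3 * celly (y0 + 2%:R * (h / 2)) (h / 2) z + celly (y0 + 3%:R * (h / 2)) (h / 2) z) / 4 /\
  celly' y0 h z = (celly' (y0 + 0%:R * (h / 2)) (h / 2) z + 3 * celly' (y0 + 1%:R * (h / 2)) (h / 2) z
    + 3 * celly' (y0 + 2%:R * (h / 2)) (h / 2) z + celly' (y0 + 3%:R * (h / 2)) (h / 2) z) / 4.
Proof. by move=> h0; exact: (@cellx_refine y0 h (z.2, z.1) h0). Qed.

Context {g gx gy : R * R -> R} (gC : C1c g gx gy).

(** The two functions are the partial derivatives of [cellx * celly * g], which lives on a rectangle
    with sides [3 hx] and [3 hy]. *)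
Definition cell_flux (x0 hx y0 hy : R) : R := flux P Q
  (fun z => cellx' x0 hx z * celly y0 hy z * g z + cellx x0 hx z * celly y0 hy z * gx z)
  (fun z => cellx x0 hx z * celly' y0 hy z * g z + cellx x0 hx z * celly y0 hy z * gy z).

Lemma cell_fluxEx (x0 hx y0 hy : R) : cell_flux x0 hx y0 hy = flux P Q
  (dmul (cellx x0 hx) (cellx' x0 hx) (fun z => celly y0 hy z * g z)
    (fun z => 0 * g z + celly y0 hy z * gx z))
  (dmul (cellx x0 hx) (fun=> 0) (fun z => celly y0 hy z * g z)
    (fun z => celly' y0 hy z * g z + celly y0 hy z * gy z)).
Proof. by apply: eq_rint => z; rewrite /dmul/=; ring. Qed.

Lemma cell_fluxEy (x0 hx y0 hy : R) : cell_flux x0 hx y0 hy = flux P Q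
  (dmul (celly y0 hy) (fun=> 0) (fun z => cellx x0 hx z * g z)
    (fun z => cellx' x0 hx z * g z + cellx x0 hx z * gx z))
  (dmul (celly y0 hy) (celly' y0 hy) (fun z => cellx x0 hx z * g z)
    (fun z => 0 * g z + cellx x0 hx z * gy z)).
Proof. by apply: eq_rint => z; rewrite /dmul/=; ring. Qed.

Lemma cell_flux_refinex (x0 hx y0 hy : R) : hx != 0 -> exists i, (i <= 3)%N /\
  `|cell_flux x0 hx y0 hy| / 2 <= `|cell_flux (x0 + i%:R * (hx / 2)) (hx / 2) y0 hy|.
Proof.
move=> h0; have gC1 := C1cM (C1_celly y0 hy) gC.
pose F i := cellx (x0 + i%:R * (hx / 2)) (hx / 2).
pose Fx i := cellx' (x0 + i%:R * (hx / 2)) (hx / 2).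
have z0 (z : R * R) : 0 = (0 + 3 * 0 + 3 * 0 + 0) / 4 :> R by rewrite !mulr0 !addr0 mul0r.
have [i [i3 ile]] := flux_refine (F := F) (Fx := Fx) (Fy := fun=> fun=> 0) gC1
  (fun i => C1_cellx _ _) (fun z => (cellx_refine x0 z h0).1)
  (fun z => (cellx_refine x0 z h0).2) z0.
by exists i; split => //; rewrite !cell_fluxEx.
Qed.

Lemma cell_flux_refiney (x0 hx y0 hy : R) : hy != 0 -> exists i, (i <= 3)%N /\
  `|cell_flux x0 hx y0 hy| / 2 <= `|cell_flux x0 hx (y0 + i%:R * (hy / 2)) (hy / 2)|.
Proof.
move=> h0; have gC1 := C1cM (C1_cellx x0 hx) gC.
pose F i := celly (y0 + i%:R * (hy / 2)) (hy / 2).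
pose Fy i := celly' (y0 + i%:R * (hy / 2)) (hy / 2).
have z0 (z : R * R) : 0 = (0 + 3 * 0 + 3 * 0 + 0) / 4 :> R by rewrite !mulr0 !addr0 mul0r.
have [i [i3 ile]] := flux_refine (F := F) (Fy := Fy) (Fx := fun=> fun=> 0) gC1
  (fun i => C1_celly _ _) (fun z => (celly_refine y0 z h0).1) z0
  (fun z => (celly_refine y0 z h0).2).
by exists i; split => //; rewrite !cell_fluxEy.
Qed.

Lemma cell_flux_child (s : R * R * R) : 0 < s.2 -> exists t : R * R * R,
  [/\ s.1.1 <= t.1.1 <= s.1.1 + 3 * (s.2 / 2), s.1.2 <= t.1.2 <= s.1.2 + 3 * (s.2 / 2),
     t.2 = s.2 / 2 &
  `|cell_flux s.1.1 s.2 s.1.2 s.2| / 4 <= `|cell_flux t.1.1 t.2 t.1.2 t.2|].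
Proof.
case: s => [[x y] h] /= h0.
have [i [i3 iH]] := cell_flux_refinex x y h (lt0r_neq0 h0).
have [j [j3 jH]] := cell_flux_refiney (x + i%:R * (h / 2)) (h / 2) y (lt0r_neq0 h0).
have b (k : nat) : (k <= 3)%N -> 0 <= k%:R * (h / 2) <= 3 * (h / 2).
  move=> k3; rewrite mulr_ge0//= ?divr_ge0 ?(ltW h0)// ler_wpM2r// ?divr_ge0 ?(ltW h0)//.
  by rewrite ler_nat.
exists (x + i%:R * (h / 2), y + j%:R * (h / 2), h / 2); split => //=.
- by have := b _ i3; lra.
- by have := b _ j3; lra.
- apply: le_trans jH; move: iH.
  by move: `|_| `|_| => u v; lra.
Qed.

Lemma cell_flux_sequence (s0 : R * R * R) : 0 < s0.2 -> exists s : nat -> R * R * R,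
  s 0 = s0 /\ forall n, [/\ (s n).2 = s0.2 / 2 ^+ n,
    (s n).1.1 <= (s n.+1).1.1 /\ (s n.+1).1.1 + 3 * (s n.+1).2 <= (s n).1.1 + 3 * (s n).2,
    (s n).1.2 <= (s n.+1).1.2 /\ (s n.+1).1.2 + 3 * (s n.+1).2 <= (s n).1.2 + 3 * (s n).2 &
    `|cell_flux s0.1.1 s0.2 s0.1.2 s0.2| / 4 ^+ n <=
    `|cell_flux (s n).1.1 (s n).2 (s n).1.2 (s n).2|].
Proof.
move=> h0.
(* Positivity of the side is moved under the existential, so that choice yields a total function; a
   degenerate cell is its own child. *)
have : forall s : R * R * R, exists t : R * R * R, 0 < s.2 ->
  [/\ s.1.1 <= t.1.1 <= s.1.1 + 3 * (s.2 / 2), s.1.2 <= t.1.2 <= s.1.2 + 3 * (s.2 / 2),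
     t.2 = s.2 / 2 &
  `|cell_flux s.1.1 s.2 s.1.2 s.2| / 4 <= `|cell_flux t.1.1 t.2 t.1.2 t.2|].
  move=> s; have [s2|s2] := ltP 0 s.2; last by exists s.
  by have [t] := cell_flux_child s2; exists t.
move=> /choice[c cP'].
pose s n := iter n c s0; exists s; split => //.
have s2 n : 0 < (s n).2.
  by elim: n => //= n IHn; have [_ _ -> _] := cP' _ IHn; rewrite divr_gt0.
move=> n; have [cx cy c2 _] := cP' _ (s2 n); split.
- elim: n {cx cy c2} => [|n IHn]; first by rewrite expr0 divr1.
  have [_ _ /= -> _] := cP' _ (s2 n); rewrite IHn exprS; field.
  by rewrite expf_neq0.
- by rewrite /= c2; move: cx; lra.
- by rewrite /= c2; move: cy; lra.
- elim: n {cx cy c2} => [|n IHn]; first by rewrite expr0 divr1.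
  have [_ _ _ /=] := cP' _ (s2 n); apply: le_trans.
  by rewrite exprSr invfM mulrA ler_wpM2r.
Qed.

Lemma nested_limit (a h : nat -> R) : (forall n, 0 <= h n) ->
  (forall n, a n <= a n.+1 /\ a n.+1 + h n.+1 <= a n + h n) ->
  exists p, forall n, a n <= p <= a n + h n.
Proof.
move=> h0 ah.
have ai : nondecreasing_seq a by apply/nondecreasing_seqP => n; have [] := ah n.
have bi : nonincreasing_seq (fun n => a n + h n).
  by apply/nonincreasing_seqP => n; have [] := ah n.
have ab n k : a n <= a k + h k.
  have [nk|/ltnW kn] := leqP n k.
    by rewrite (le_trans (ai _ _ nk))// lerDl.
  by apply: le_trans (bi _ _ kn); rewrite lerDl.
have ca : cvgn a.
  apply: nondecreasing_is_cvgn => //; exists (a 0%N + h 0%N) => _ [n _ <-]; exact: ab.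
exists (limn a) => n; rewrite nondecreasing_cvgn_le//=.
by apply: limr_le => //; apply: nearW => k.
Qed.

(** Total differentiability of [(P, Q)] at [p] with divergence zero: the same [a] occurs in both
    components with opposite signs. *)
Definition flux_differentiable (p : R * R) := exists a b c : R, forall e : R, 0 < e ->
  exists2 d : R, 0 < d & forall z : R * R, `|z - p| < d ->
    `|P z - (P p + a * (z.1 - p.1) + b * (z.2 - p.2))| <= e * `|z - p| /\
    `|Q z - (Q p + c * (z.1 - p.1) - a * (z.2 - p.2))| <= e * `|z - p|.

Lemma cellx_out (x0 h : R) z : 0 < h -> ~~ (x0 <= z.1 <= x0 + 3 * h) ->
  cellx x0 h z = 0 /\ cellx' x0 h z = 0.
Proof.
move=> h0 zx; rewrite /cellx /cellx'.
suff [-> ->] : bspline ((z.1 - x0) / h) = 0 /\ bspline' ((z.1 - x0) / h) = 0.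
  by rewrite mul0r.
apply: bspline_out; move: zx; rewrite negb_and -!ltNge => /orP[zx|zx]; [left|right].
  by rewrite ler_pdivrMr// mul0r subr_le0 ltW.
by rewrite ler_pdivlMr// lerBrDl ltW.
Qed.

Lemma celly_out (y0 h : R) z : 0 < h -> ~~ (y0 <= z.2 <= y0 + 3 * h) ->
  celly y0 h z = 0 /\ celly' y0 h z = 0.
Proof. exact: (@cellx_out y0 h (z.2, z.1)). Qed.

Lemma cellx_bound (x0 h : R) z : 0 < h <= 1 ->
  `|cellx x0 h z| <= 36 / h /\ `|cellx' x0 h z| <= 36 / h /\ `|cellx x0 h z| <= 36.
Proof.
move=> /andP[h0 h1]; rewrite /cellx /cellx'.
have [b b'] := bspline_bound ((z.1 - x0) / h); split; last split => //.
  by rewrite ler_pdivlMr//; apply: le_trans b; rewrite ler_piMr.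
by rewrite normrM normfV (gtr0_norm h0) ler_pM2r ?invr_gt0.
Qed.

Lemma same_itv_dist (a h x y : R) : a <= x <= a + h -> a <= y <= a + h -> `|y - x| <= h.
Proof. by move=> ? ?; rewrite ler_norml; lra. Qed.

Lemma C1c_bounded f fx fy : C1c f fx fy -> exists2 M : R, 0 <= M &
  (forall z, `|f z| <= M) /\ (forall z, `|fx z| <= M) /\ (forall z, `|fy z| <= M).
Proof.
move=> [[_ _ cf cfx cfy] [r fr]].
have [M0 fM0] : exists M : R, forall z, `|f z| <= M.
  by apply: (@compact_support_bounded _ _ r) => // z /fr[].
have [M1 fM1] : exists M : R, forall z, `|fx z| <= M.
  by apply: (@compact_support_bounded _ _ r) => // z /fr[].
have [M2 fM2] : exists M : R, forall z, `|fy z| <= M.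
  by apply: (@compact_support_bounded _ _ r) => // z /fr[].
exists (`|M0| + `|M1| + `|M2|); first by rewrite !addr_ge0.
split => [z|]; last split => z.
- by rewrite (le_trans (fM0 z))// (le_trans (ler_norm _))// -addrA lerDl addr_ge0.
- by rewrite (le_trans (fM1 z))// (le_trans (ler_norm _))// addrAC lerDr addr_ge0.
- by rewrite (le_trans (fM2 z))// (le_trans (ler_norm _))// lerDr addr_ge0.
Qed.

(** By [affine_flux_zero] the affine part of the field may be subtracted. The rest is at most
    [3 e h] on the cell, the gradient is of order [1 / h] and the area is [9 h^2], whence order
    [e h^2]. *)
Lemma cell_flux_small (p : R * R) : flux_differentiable p -> exists M : R, forall e : R, 0 < e ->
  exists2 d : R, 0 < d & forall x0 y0 h : R, 0 < h <= 1 -> 3 * h < d ->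
    x0 <= p.1 <= x0 + 3 * h -> y0 <= p.2 <= y0 + 3 * h ->
    `|cell_flux x0 h y0 h| <= e * M * h ^+ 2.
Proof.
case=> a [b [c PQ]].
have [B B0 [gM0 [gM1 gM2]]] := C1c_bounded gC.
have [K K0 KE] : exists2 K : R, 0 <= K & K = 36 * 36 by exists (36 * 36); rewrite ?mulr_ge0.
(* The 3 comes from the distance [3 h] to [p], the 4 from two components with gradients of two terms
   each, [K] from two spline factors, [B] from [g] and its partial derivatives, the 9 from the
   area. *)
exists (3 * 4 * K * B * 9) => e e0; have [d d0 dP] := PQ _ e0.
exists d => // x0 y0 h h01 hd px py.
have /andP[h0 h1] := h01.
have KB : 0 <= K * B / h by rewrite divr_ge0 ?mulr_ge0// ltW.
pose Px z := P p + a * (z.1 - p.1) + b * (z.2 - p.2).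
pose Qy z := Q p + c * (z.1 - p.1) - a * (z.2 - p.2).
pose G := fun z => cellx x0 h z * (celly y0 h z * g z).
pose Gx := fun z => cellx' x0 h z * celly y0 h z * g z + cellx x0 h z * celly y0 h z * gx z.
pose Gy := fun z => cellx x0 h z * celly' y0 h z * g z + cellx x0 h z * celly y0 h z * gy z.
have GC : C1c G Gx Gy.
  apply: (C1c_eq (C1cM (C1_cellx x0 h) (C1cM (C1_celly y0 h) gC))) => z //;
  by rewrite /Gx /Gy; ring.
have aff0 := affine_flux_zero p (P p) (Q p) a b c GC.
have caff (u v w : R) : continuous (fun z : R * R => u + v * (z.1 - p.1) + w * (z.2 - p.2)).
  move=> z; apply: cvgD.
    apply: cvgD; first exact: cvg_cst.
    by apply: cvgMr; apply: cvgB; [exact: cvg_fst|exact: cvg_cst].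
  by apply: cvgMr; apply: cvgB; [exact: cvg_snd|exact: cvg_cst].
have cPx0 : continuous Px by exact: caff.
have cQy0 : continuous Qy.
  rewrite (_ : Qy = fun z => Q p + c * (z.1 - p.1) + - a * (z.2 - p.2)); last first.
    by apply/funext => z; rewrite /Qy mulNr.
  exact: caff.
have cPx : continuous (fun z => P z - Px z).
  by move=> z; apply: cvgB; [exact: cP|exact: caff].
have cQy : continuous (fun z => Q z - Qy z).
  by move=> z; apply: cvgB; [exact: cQ|exact: cQy0].
have [_ iPx _] := cont_mul_C1c_integrable cPx GC.
have [_ _ iQy] := cont_mul_C1c_integrable cQy GC.
have iaff : ig (fun z => Px z * Gx z + Qy z * Gy z).
  have [_ i1 _] := cont_mul_C1c_integrable cPx0 GC.
  by have [_ _ i2] := cont_mul_C1c_integrable cQy0 GC; exact: igD.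
have -> : cell_flux x0 h y0 h = rint (fun z => (P z - Px z) * Gx z + (Q z - Qy z) * Gy z).
  rewrite /cell_flux /flux -[LHS]subr0 -aff0 -rintB//; last exact: (flux_integrable GC).
  by apply: eq_rint => z; rewrite /Px /Qy /Gx /Gy; ring.
have bG z : `|Gx z| <= 2 * (K * B / h) /\ `|Gy z| <= 2 * (K * B / h).
  have [cx1 [cx2 cx3]] := cellx_bound x0 z h01.
  have [cy1 [cy2 cy3]] : `|celly y0 h z| <= 36 / h /\ `|celly' y0 h z| <= 36 / h /\
    `|celly y0 h z| <= 36 by exact: (@cellx_bound y0 h (z.2, z.1) h01).
  have H (u v w : R) : `|u| <= 36 / h -> `|v| <= 36 -> `|w| <= B -> `|u * v * w| <= K * B / h.
    move=> uH vH wH; rewrite !normrM (_ : K * B / h = 36 / h * 36 * B); last first.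
      by rewrite KE; field; rewrite gt_eqF.
    by apply: ler_pM => //; exact: ler_pM.
  rewrite mulr_natl mulr2n; split; apply: (le_trans (ler_normD _ _)); apply: lerD.
  - exact: H cx2 cy3 (gM0 z).
  - exact: H cx1 cy3 (gM1 z).
  - by rewrite [cellx _ _ _ * _]mulrC; exact: H cy2 cx3 (gM0 z).
  - exact: H cx1 cy3 (gM2 z).
have -> : e * (3 * 4 * K * B * 9) * h ^+ 2 =
  (4 * (e * (3 * h) * (K * B / h))) * ((x0 + 3 * h - x0) * (y0 + 3 * h - y0)).
  by field; rewrite gt_eqF.
have h3 : 0 <= 3 * h by rewrite mulr_ge0// ltW.
apply: rint_box_le.
- by rewrite lerDl.
- by rewrite lerDl.
- by rewrite mulr_ge0// mulr_ge0// mulr_ge0// ltW.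
- exact: igD.
- move=> z zx zy.
  have zp : `|z - p| <= 3 * h.
    by rewrite norm_pair_le; apply/andP; split; [exact: same_itv_dist px zx|exact: same_itv_dist py zy].
  have [Pz Qz] := dP z (le_lt_trans zp hd).
  have [Gxz Gyz] := bG z.
  apply: (le_trans (ler_normD _ _)); rewrite !normrM.
  have ez : e * `|z - p| <= e * (3 * h) by rewrite ler_wpM2l// ltW.
  have H (u v : R) : `|u| <= e * `|z - p| -> `|v| <= 2 * (K * B / h) ->
      `|u| * `|v| <= 2 * (e * (3 * h) * (K * B / h)).
    move=> uH vH; rewrite mulrCA; apply: ler_pM => //; exact: le_trans uH ez.
  apply: (le_trans (lerD (H _ _ Pz Gxz) (H _ _ Qz Gyz))).
  by move: (e * (3 * h) * _) => u; rewrite -mulrDl -natrD.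
- move=> z; rewrite /Gx /Gy => /orP[/(cellx_out h0)[-> ->]|/(celly_out h0)[-> ->]];
    by rewrite ?mul0r ?mulr0 ?mul0r ?addr0 ?mulr0 ?addr0.
Qed.

(* Goursat's bisection argument, with a refinable partition of unity instead of a
   subdivision into squares: a nonzero flux through one cell would survive, at
   rate 1/4 per step, in a sequence of cells shrinking to a point. *)
Lemma cell_flux_zero (x0 y0 : R) : (forall p, flux_differentiable p) ->
  cell_flux x0 1 y0 1 = 0.
Proof.
move=> PQ; have [s [s0 sP]] := cell_flux_sequence (ltr01 : 0 < (x0, y0, 1 : R).2).
have h0 n : 0 <= 3 * (s n).2.
  by have [-> _ _ _] := sP n; rewrite mulr_ge0// divr_ge0// exprn_ge0.
have [px pxP] : exists p, forall n, (s n).1.1 <= p <= (s n).1.1 + 3 * (s n).2.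
  by apply: nested_limit => // n; have [] := sP n.
have [py pyP] : exists p, forall n, (s n).1.2 <= p <= (s n).1.2 + 3 * (s n).2.
  by apply: nested_limit => // n; have [] := sP n.
have [M MP] := cell_flux_small (PQ (px, py)).
apply/eqP; rewrite -normr_le0; apply/ler_addgt0Pr => e e0; rewrite add0r.
(* Chosen so that [e' * M <= e]; the added 1 covers [M = 0]. *)
pose e' := e / (`|M| + 1).
have M1 : 0 < `|M| + 1 by rewrite ltr_wpDl.
have e'0 : 0 < e' by rewrite divr_gt0.
have [d d0 dP] := MP _ e'0.
have [n nd] : exists n, 3 * (1 / 2 ^+ n) < d.
  exists (Num.Def.trunc (3 / d)).+1; rewrite div1r ltr_pdivrMr ?exprn_gt0// mulrC.
  rewrite -ltr_pdivrMr// (lt_le_trans (truncnS_gt _))// -natrX ler_nat.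
  exact/ltnW/ltn_expl.
have [hn _ _ Hn] := sP n.
have h01 : 0 < (s n).2 <= 1.
  by rewrite hn /= divr_gt0 ?exprn_gt0//= ler_pdivrMr ?exprn_gt0// mul1r exprn_ege1// ler1n.
have := dP _ _ _ h01 _ (pxP n) (pyP n); rewrite {1}hn => /(_ nd).
(* The square of the side [1 / 2 ^ n] cancels the loss [1 / 4 ^ n] of flux, and only [e' * M]
   remains. *)
move/(le_trans Hn) => /=; rewrite hn /= expr_div_n expr1n -exprM mulnC exprM.
rewrite (_ : 2 ^+ 2 = 4); last by ring.
rewrite div1r ler_pM2r ?invr_gt0 ?exprn_gt0// => /le_trans; apply.
rewrite /e' -mulrA; apply: ler_piMr; first exact: ltW.
by rewrite mulrC ler_pdivrMr// mul1r (le_trans (ler_norm M))// lerDl.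
Qed.

End goursat.

(** * Weakly divergence-free vector fields *)

Section divergence.
Context {R : realType}.
Implicit Types f g P Q : R * R -> R.
Local Notation mu := (@leb2 R).
Local Notation ig f := (mu.-integrable setT (EFin \o f)).
Local Notation rint := (Rintegral mu setT).

(** As [f c] is the difference of [F c] and [F (c + 1)], the flux against [F c * g] does not change
    when [c] grows by 1. For very negative [c] it is the flux against [g], for large [c] it is 0. *)
Lemma flux_partition P Q (f fx fy : R -> R * R -> R) g gx gy (F Fx Fy : R -> R * R -> R) (r : R) :
  continuous P -> continuous Q -> C1c g gx gy ->
  (forall c, C1 (f c) (fx c) (fy c)) -> (forall c, C1 (F c) (Fx c) (Fy c)) ->
  (forall c z, [/\ f c z = F c z - F (c + 1) z, fx c z = Fx c z - Fx (c + 1) z &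
    fy c z = Fy c z - Fy (c + 1) z]) ->
  (forall z, r < `|z| -> [/\ g z = 0, gx z = 0 & gy z = 0]) ->
  (forall c z, `|z| <= r -> r <= c -> [/\ F c z = 0, Fx c z = 0 & Fy c z = 0]) ->
  (forall c z, `|z| <= r -> c <= - r - 2 -> [/\ F c z = 1, Fx c z = 0 & Fy c z = 0]) ->
  (forall c, flux P Q (dmul (f c) (fx c) g gx) (dmul (f c) (fy c) g gy) = 0) ->
  flux P Q gx gy = 0.
Proof.
move=> cP cQ gC fC FC fF gr F0 F1 f0.
pose J c := flux P Q (dmul (F c) (Fx c) g gx) (dmul (F c) (Fy c) g gy).
have Jstep c : J c = J (c + 1).
  apply/eqP; rewrite -subr_eq0 -(f0 c); apply/eqP.
  rewrite /J /flux -rintB; first last.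
  - exact: (flux_integrable cP cQ (C1cM (FC (c + 1)) gC)).
  - exact: (flux_integrable cP cQ (C1cM (FC c) gC)).
  apply: eq_rint => z; rewrite /dmul; have [-> -> ->] := fF c z; ring.
have JM c (n : nat) : J c = J (c + n%:R).
  by elim: n => [|n IHn]; rewrite ?addr0// IHn Jstep -addrA natr1.
(* [n + 1] unit steps lead from [- r - 2] to at least [r]. *)
pose n := Num.Def.trunc (2 * `|r| + 2).
have nr : 2 * r + 2 <= n.+1%:R.
  by have := truncnS_gt (2 * `|r| + 2); have := ler_norm r; rewrite -/n; lra.
have := JM (- r - 2) n.+1; rewrite [X in _ = X](_ : _ = 0); last first.
  rewrite -rint0; apply: eq_rint => z; rewrite /dmul.
  have [zr|/gr[-> -> ->]] := leP `|z| r; last by rewrite !(mul0r, mulr0, addr0).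
  have [|-> -> ->] := F0 (- r - 2 + n.+1%:R) z zr; first by lra.
  by rewrite !(mul0r, mulr0, addr0).
move=> <-; apply: eq_rint => z; rewrite /dmul.
have [zr|/gr[-> -> ->]] := leP `|z| r; last by rewrite !(mul0r, mulr0, addr0).
have [|-> -> ->] := F1 (- r - 2) z zr; first by lra.
by rewrite !mul0r !add0r !mul1r.
Qed.

(* A vector field that is merely differentiable at each point and has zero trace
   is weakly divergence free. *)
Theorem pointwise_divergence_free P Q g gx gy : continuous P -> continuous Q ->
  (forall p, @flux_differentiable R P Q p) -> C1c g gx gy ->
  rint (fun z => P z * gx z + Q z * gy z) = 0.
Proof.
move=> cP cQ PQ gC; have [_ [r gr]] := gC; rewrite -/(flux P Q gx gy).
have C1step_x c : C1 (fun z : R * R => sstep (z.1 - c)) (fun z => sstep' (z.1 - c)) (fun=> 0).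
  by apply: (C1_eq (C1_compx c 1 is_derive_sstep continuous_sstep')) => z //; rewrite !divr1.
have C1step_y c : C1 (fun z : R * R => sstep (z.2 - c)) (fun=> 0) (fun z => sstep' (z.2 - c)).
  by apply: (C1_eq (C1_compy c 1 is_derive_sstep continuous_sstep')) => z //; rewrite !divr1.
have bnd (z : R * R) (s : R) : `|z| <= s -> - s <= z.1 <= s /\ - s <= z.2 <= s.
  by rewrite norm_pair_le !ler_norml => /andP[].
apply: (flux_partition (f := fun c => celly c 1) (fx := fun c => fun=> 0)
  (fy := fun c => celly' c 1) (r := r) cP cQ gC (fun c => C1_celly c 1) C1step_y) => //.
- move=> c z; rewrite /celly /celly' !divr1 bspline_sstep bspline'_sstep' opprD addrA subr0.
  by split.
- by move=> c z zr rc; have [|-> ->] := @sstep_le0 R (z.2 - c); [have [] := bnd _ _ zr; lra|].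
- by move=> c z zr rc; have [|-> ->] := @sstep_ge2 R (z.2 - c); [have [] := bnd _ _ zr; lra|].
(* The plane is now cut into strips in [y]; inside one strip the same argument runs along [x] for
   [celly d 1 * g]. *)
move=> d; have gC1 := C1cM (C1_celly d 1) gC.
apply: (flux_partition (f := fun c => cellx c 1) (fx := fun c => cellx' c 1)
  (fy := fun c => fun=> 0) (r := r) cP cQ gC1 (fun c => C1_cellx c 1) C1step_x) => //.
- move=> c z; rewrite /cellx /cellx' !divr1 bspline_sstep bspline'_sstep' opprD addrA subr0.
  by split.
- by move=> z /gr[-> -> ->]; rewrite !(mulr0, addr0).
- by move=> c z zr rc; have [|-> ->] := @sstep_le0 R (z.1 - c); [have [] := bnd _ _ zr; lra|].
- by move=> c z zr rc; have [|-> ->] := @sstep_ge2 R (z.1 - c); [have [] := bnd _ _ zr; lra|].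
move=> c; apply: etrans (cell_flux_zero cP cQ gC c d PQ); by rewrite cell_fluxEx.
Qed.

End divergence.

(** * Complex differentiability and the weak Cauchy-Riemann equations *)

Section complex_differentiability.
Context {R : realType}.
Local Notation Re := complex.Re.
Local Notation Im := complex.Im.
Local Notation "x %:C" := (real_complex R x).

Lemma complex_norm_le (x : R[i]) (e : R) : `|x| <= e%:C -> `|Re x| <= e /\ `|Im x| <= e.
Proof.
rewrite normc_def lecR => xe.
have s0 (a b : R) : `|a| <= Num.sqrt (a ^+ 2 + b ^+ 2).
  by rewrite -sqrtr_sqr ler_sqrt ?addr_ge0 ?sqr_ge0// lerDl sqr_ge0.
split; first exact: le_trans (s0 _ _) xe.
by apply: le_trans (s0 _ (Re x)) _; rewrite addrC.
Qed.

Lemma complex_norm_ge (x : R[i]) (e : R) : `|Re x| <= e -> `|Im x| <= e ->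
  `|x| <= (2 * e)%:C.
Proof.
move=> xe ye; rewrite normc_def lecR.
have e0 : 0 <= e := le_trans (normr_ge0 _) xe.
rewrite -[2 * e]ger0_norm ?mulr_ge0// -sqrtr_sqr ler_sqrt ?sqr_ge0//.
rewrite -(real_normK (num_real (Re x))) -(real_normK (num_real (Im x))).
have := normr_ge0 (Re x); have := normr_ge0 (Im x); nra.
Qed.

Lemma toC_sub (y z : R * R) : toC (y - z) = toC y - toC z.
Proof. by case: y z => [a b] [c d]. Qed.

Lemma toCK (w : R[i]) : toC (Re w, Im w) = w.
Proof. by case: w. Qed.

Lemma complex_norm_toC (z : R * R) : `|toC z| <= (2 * `|z|)%:C.
Proof.
have : `|z| <= `|z| by []. rewrite {1}norm_pair_le => /andP[z1 z2].
exact: complex_norm_ge.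
Qed.

Lemma le_pair_norm (z : R * R) : `|z.1| <= `|z| /\ `|z.2| <= `|z|.
Proof. by apply/andP; rewrite -norm_pair_le. Qed.

Lemma derivable_expansion (h : R[i] -> R[i]) (z : R * R) :
  derivable (h : R[i]^o -> R[i]^o) (toC z) 1 -> exists a b : R, forall e : R, 0 < e ->
  exists2 d : R, 0 < d & forall y : R * R, `|y - z| < d ->
    `|Re (h (toC y)) - (Re (h (toC z)) + (a * (y.1 - z.1) - b * (y.2 - z.2)))| <= e * `|y - z| /\
    `|Im (h (toC y)) - (Im (h (toC z)) + (b * (y.1 - z.1) + a * (y.2 - z.2)))| <= e * `|y - z|.
Proof.
move=> /cvg_ex[[a b] /cvgrPdist_le /= H]; exists a, b => e e0.
(* Passing from the sup norm to the modulus costs the factor 2 of [complex_norm_toC]; [e / 2] here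
   and [Re d / 4] below absorb it. *)
have e'0 : 0 < (e / 2)%:C by rewrite ltcR divr_gt0.
have /nbhs_ballP[d /= d0 dP] := H _ e'0.
have dE : d = (Re d)%:C by rewrite RRe_real// ger0_real// ltW.
have rd0 : 0 < Re d by rewrite -ltcR -dE.
exists (Re d / 4); first by rewrite divr_gt0.
move=> y yz.
suff N : `|h (toC y) - h (toC z) - (a +i* b)%C * toC (y - z)| <= (e * `|y - z|)%:C.
  have [] := complex_norm_le N.
  case: (h (toC y)) => p q; case: (h (toC z)) => p' q'; rewrite /toC /= => H0 H1.
  by split; [move: H0|move: H1]; congr (`|_| <= _); ring.
have [yz0|t0] := eqVneq (toC (y - z)) 0.
  have -> : toC y = toC z by apply/eqP; rewrite -subr_eq0 -toC_sub yz0.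
  by rewrite yz0 mulr0 !subrr normr0 lecR mulr_ge0// ltW.
have tz : (toC (y - z))%:A + toC z = toC y.
  by rewrite /GRing.scale /= mulr1 toC_sub subrK.
have := dP (toC (y - z)) _ t0; rewrite tz => dPt.
have {dPt} : `|(a +i* b)%C - (toC (y - z))^-1 *: (h (toC y) - h (toC z))| <= (e / 2)%:C.
  apply: dPt; rewrite /ball/= sub0r normrN.
  apply: le_lt_trans (complex_norm_toC _) _; rewrite dE ltcR.
  by rewrite -ltr_pdivlMl// mulrC (lt_trans yz)// ltr_pM2l// ltf_pV2 ?posrE// ltr_nat.
rewrite /GRing.scale /= => dPt.
have -> : h (toC y) - h (toC z) - (a +i* b)%C * toC (y - z) =
  - (((a +i* b)%C - (toC (y - z))^-1 * (h (toC y) - h (toC z))) * toC (y - z)).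
  by rewrite mulrBl [(_^-1 * _)]mulrC divfK// opprB.
rewrite normrN normrM; apply: le_trans (ler_pM _ _ dPt (complex_norm_toC _)) _ => //.
by rewrite -rmorphM lecR mulrA divfK.
Qed.

Lemma expansion_derivable (h : R[i] -> R[i]) (z : R * R) (a b : R) :
  (forall e : R, 0 < e -> exists2 d : R, 0 < d & forall y : R * R, `|y - z| < d ->
    `|Re (h (toC y)) - (Re (h (toC z)) + (a * (y.1 - z.1) - b * (y.2 - z.2)))| <= e * `|y - z| /\
    `|Im (h (toC y)) - (Im (h (toC z)) + (b * (y.1 - z.1) + a * (y.2 - z.2)))| <= e * `|y - z|) ->
  derivable (h : R[i]^o -> R[i]^o) (toC z) 1.
Proof.
move=> H; apply/cvg_ex; exists (a +i* b)%C; apply/cvgrPdist_le => /= e e0.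
have eE : e = (Re e)%:C by rewrite RRe_real// ger0_real// ltW.
have re0 : 0 < Re e by rewrite -ltcR -eE.
have [d d0 dP] := H (Re e / 2) (divr_gt0 re0 (ltr0n _ 2)).
apply/nbhs_ballP; exists d%:C => /=; first by rewrite ltcR.
move=> t; rewrite /ball/= sub0r normrN => td t0.
pose y := z + (Re t, Im t).
have yz : y - z = (Re t, Im t) by rewrite /y addrC addKr.
have ty : toC (y - z) = t by rewrite yz toCK.
have nyt : (`|y - z|)%:C <= `|t|.
  rewrite yz normc_def lecR; have [] := @complex_norm_le t (Num.sqrt (Re t ^+ 2 + Im t ^+ 2)).
    by rewrite normc_def.
  by rewrite norm_pair_le => -> ->.
have yzd : `|y - z| < d by rewrite -ltcR; exact: le_lt_trans nyt td.
have [Py Qy] := dP _ yzd.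
have tz : t%:A + toC z = toC y.
  by rewrite /GRing.scale /= mulr1 -ty toC_sub subrK.
rewrite tz /GRing.scale/=.
have N : `|h (toC y) - h (toC z) - (a +i* b)%C * toC (y - z)| <= (2 * (Re e / 2 * `|y - z|))%:C.
  move: Py Qy; case: (h (toC y)) => p q; case: (h (toC z)) => p' q' /= Py Qy.
  apply: complex_norm_ge => /=; [move: Py|move: Qy]; congr (`|_| <= _); ring.
have -> : (a +i* b)%C - t^-1 * (h (toC y) - h (toC z)) =
  - ((h (toC y) - h (toC z) - (a +i* b)%C * toC (y - z)) / t).
  by rewrite ty mulrBl mulfK// opprB [_ / t]mulrC.
rewrite normrN normrM normfV ler_pdivrMr ?normr_gt0//; apply: le_trans N _.
rewrite (_ : 2 * _ = Re e * `|y - z|); last by field.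
by rewrite rmorphM/= -eE ler_wpM2l// ltW.
Qed.

Definition reC (h : R[i] -> R[i]) : R * R -> R := fun z => Re (h (toC z)).
Definition imC (h : R[i] -> R[i]) : R * R -> R := fun z => Im (h (toC z)).

Lemma flux_differentiable_continuous (P Q : R * R -> R) :
  (forall p, flux_differentiable (P := P) (Q := Q) p) -> continuous P.
Proof.
move=> PQ p; apply/cvgrPdist_le => /= e e0.
have [a [b [c /(_ 1 ltr01)[d d0 dP]]]] := PQ p.
pose M := 1 + `|a| + `|b|.
have M0 : 0 < M by rewrite /M; have := normr_ge0 a; have := normr_ge0 b; lra.
near=> y.
have yd : `|y - p| < d by rewrite distrC; near: y; apply: cvgr_dist_lt => //; exact: cvg_id.
have ye : `|y - p| <= e / M.
  rewrite distrC; near: y; apply: cvgr_dist_le; first exact: cvg_id.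
  by rewrite divr_gt0.
have [Py _] := dP _ yd; rewrite mul1r in Py.
have [y1 y2] := le_pair_norm (y - p).
rewrite ler_pdivlMr// in ye; apply: le_trans ye; rewrite distrC.
rewrite (_ : P y - P p = (P y - (P p + a * (y.1 - p.1) + b * (y.2 - p.2)))
  + a * (y.1 - p.1) + b * (y.2 - p.2)); last by ring.
have -> : `|y - p| * M = `|y - p| + `|y - p| * `|a| + `|y - p| * `|b| by rewrite /M; ring.
apply: (le_trans (ler_normD _ _)); apply: lerD.
  apply: (le_trans (ler_normD _ _)); apply: lerD => //.
  by rewrite normrM mulrC ler_wpM2r.
by rewrite normrM mulrC ler_wpM2r.
Unshelve. all: by end_near. Qed.

(** The Cauchy-Riemann equations say that both fields have trace zero. Paired with a gradient they
    give the real and the imaginary part of [h (gx + i gy)]. *)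
Lemma entire_flux_differentiable (h : R[i] -> R[i]) p : entire h ->
  flux_differentiable (P := reC h) (Q := fun z => - imC h z) p /\
  flux_differentiable (P := imC h) (Q := reC h) p.
Proof.
move=> /(_ (toC p))/derivable_expansion[a [b ab]]; split.
  exists a, (- b), (- b) => e /ab[d d0 dP]; exists d => // y /dP[Py Qy]; split.
    by move: Py; congr (`|_| <= _); rewrite /reC; ring.
  rewrite (_ : - imC h y - _ = - (Im (h (toC y)) - (Im (h (toC p)) + (b * (y.1 - p.1)
    + a * (y.2 - p.2))))) ?normrN//; rewrite /imC; ring.
exists b, a, a => e /ab[d d0 dP]; exists d => // y /dP[Py Qy]; split.
  by move: Qy; congr (`|_| <= _); rewrite /imC; ring.
by move: Py; congr (`|_| <= _); rewrite /reC; ring.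
Qed.

Lemma continuous_reC (h : R[i] -> R[i]) : entire h -> continuous (reC h).
Proof.
by move=> hE; apply: flux_differentiable_continuous => p; have [+ _] := entire_flux_differentiable p hE; exact.
Qed.

Lemma continuous_imC (h : R[i] -> R[i]) : entire h -> continuous (imC h).
Proof.
by move=> hE; apply: flux_differentiable_continuous => p; have [_ +] := entire_flux_differentiable p hE; exact.
Qed.

Local Notation rint := (Rintegral (@leb2 R) setT).

(** These are the two parts of [\int h (gx + i gy) = 0], the form in which holomorphy is used from
    here on and in which it survives limits in [L^2]. *)
Theorem entire_weak_dbar (h : R[i] -> R[i]) g gx gy : entire h -> C1c g gx gy ->
  rint (fun z => reC h z * gx z - imC h z * gy z) = 0 /\
  rint (fun z => imC h z * gx z + reC h z * gy z) = 0.
Proof.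
move=> hE gC; have cP := continuous_reC hE; have cQ := continuous_imC hE.
have cNQ : continuous (fun z => - imC h z) by move=> z; apply: cvgN; exact: cQ.
split.
  rewrite -(pointwise_divergence_free cP cNQ (fun p => (entire_flux_differentiable p hE).1) gC).
  by apply: eq_rint => z; rewrite mulNr.
exact: (pointwise_divergence_free cQ cP (fun p => (entire_flux_differentiable p hE).2) gC).
Qed.

End complex_differentiability.

(** * Mean values of entire functions *)

Section radial_kernels.
Context {R : realType}.
Local Notation mu := (@leb2 R).
Local Notation ig f := (mu.-integrable setT (EFin \o f)).
Local Notation rint := (Rintegral mu setT).

(** Squared Euclidean distance, whereas [|z - w|] is the sup norm of [R * R]; being a polynomial, it
    is smooth at [w] too. *)
Definition sqd (w z : R * R) : R := (z.1 - w.1) ^+ 2 + (z.2 - w.2) ^+ 2.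

Lemma sqd_ge w z : `|z - w| ^+ 2 <= sqd w z.
Proof.
rewrite /sqd prod_normE /=; case: (leP `|z.1 - w.1| `|z.2 - w.2|) => _;
by rewrite real_normK ?num_real// ?lerDl ?lerDr sqr_ge0.
Qed.

Lemma sqd_out (T : R) w z : `|w| + `|T| + 1 < `|z| -> T <= sqd w z.
Proof.
move=> zr; apply: le_trans (sqd_ge w z).
have zw : `|T| + 1 <= `|z - w|.
  by have := ler_distD w z 0; rewrite !subr0; lra.
have T0 := normr_ge0 T; have := ler_norm T; nra.
Qed.

Lemma C1_sqd w : C1 (sqd w) (fun z => 2 * (z.1 - w.1)) (fun z => 2 * (z.2 - w.2)).
Proof.
have X := C1D (@C1_fst R) (C1_cst (- w.1)).
have Y := C1D (@C1_snd R) (C1_cst (- w.2)).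
by apply: (C1_eq (C1D (C1M X X) (C1M Y Y))) => z; rewrite /sqd; ring.
Qed.

Lemma C1c_radial (k k' : R -> R) (T : R) w : (forall x : R, is_derive x (1 : R) k (k' x)) ->
  continuous k' -> (forall t, T <= t -> k t = 0 /\ k' t = 0) ->
  C1c (fun z => k (sqd w z)) (fun z => k' (sqd w z) * (2 * (z.1 - w.1)))
    (fun z => k' (sqd w z) * (2 * (z.2 - w.2))).
Proof.
move=> dk ck' kT; split; first exact: C1_comp (C1_sqd w).
by exists (`|w| + `|T| + 1) => z /sqd_out/kT[-> ->]; rewrite !mul0r.
Qed.

Lemma continuous_sqd w : continuous (sqd w).
Proof. by have [] := C1_sqd w. Qed.

Lemma continuous_radial (k : R -> R) w : continuous k -> continuous (fun z => k (sqd w z)).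
Proof.
by move=> ck z; apply: (cvg_comp (sqd w) k); [exact: continuous_sqd|exact: ck].
Qed.

(* [k + t k'] is the d-bar derivative of [conj (z - w) k(|z - w|^2)] at [t = |z - w|^2] *)
Lemma entire_radial_dbar (f : R[i] -> R[i]) (k k' : R -> R) (T : R) w : entire f ->
  (forall x : R, is_derive x (1 : R) k (k' x)) -> continuous k' ->
  (forall t, T <= t -> k t = 0 /\ k' t = 0) ->
  rint (fun z => reC f z * (k (sqd w z) + sqd w z * k' (sqd w z))) = 0 /\
  rint (fun z => imC f z * (k (sqd w z) + sqd w z * k' (sqd w z))) = 0.
Proof.
move=> fE dk ck' kT; have kC := C1c_radial w dk ck' kT.
have XC := C1cM (C1D (@C1_fst R) (C1_cst (- w.1))) kC.
have YC := C1cM (C1D (@C1_snd R) (C1_cst (- w.2))) kC.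
have cp := continuous_reC fE; have cq := continuous_imC fE.
have cNq : continuous (fun z => - imC f z) by move=> z; apply: cvgN; exact: cq.
have [X1 X2] := entire_weak_dbar fE XC.
have [Y1 Y2] := entire_weak_dbar fE YC.
have iX1 := flux_integrable cp cNq XC. have iX2 := flux_integrable cq cp XC.
have iY1 := flux_integrable cp cNq YC. have iY2 := flux_integrable cq cp YC.
have X1' := etrans (eq_rint _) X1; have Y1' := etrans (eq_rint _) Y1.
split.
  rewrite (rintD_eq (a := 2^-1) (b := 2^-1) iX1 iY2) ?Y2 ?X1' ?mulr0 ?addr0// => z; first by ring.
  by rewrite /sqd /=; field.
rewrite (rintD_eq (a := 2^-1) (b := - 2^-1) iX2 iY1) ?X2 ?Y1' ?mulr0 ?addr0// => z; first by ring.
by rewrite /sqd /=; field.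
Qed.

Lemma is_derive1_cont (f : R -> R) (d x : R) : is_derive x (1 : R) f d -> {for x, continuous f}.
Proof.
by move=> fd; apply: differentiable_continuous; apply/derivable1_diffP; exact: ex_derive.
Qed.

Lemma near_eq_is_derive (f g : R -> R) (x d : R) : (\near x, f x = g x) ->
  is_derive x (1 : R) f d -> is_derive x (1 : R) g d.
Proof.
move=> fg [fd fv]; apply: DeriveDef; last by rewrite -fv; apply/esym/near_eq_derive.
exact: near_eq_derivable fg fd.
Qed.

Section annular.
Context {G G' : R -> R} (e : R).
Hypotheses (dG : forall x : R, is_derive x (1 : R) G (G' x)) (cG' : continuous G').
Hypotheses (e0 : 0 < e) (Ge : forall t, t <= e -> G t = 0 /\ G' t = 0).

Let nearE x : x < e -> \near x, G x = 0 /\ G' x = 0.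
Proof.
by move=> xe; near=> y; apply: Ge; apply: ltW; near: y; exact: lt_nbhsl.
Unshelve. all: by end_near. Qed.

Lemma annular_quotient_derive x :
  is_derive x (1 : R) (fun t => G t / t) (G' x / x - G x / x ^+ 2).
Proof.
have [xe|xe] := ltP x e.
  have [-> ->] := Ge (ltW xe); rewrite !mul0r subrr.
  apply: near_eq_is_derive (is_derive_cst (0 : R) x (1 : R)).
  by move: (nearE xe); apply: filterS => y [-> _]; rewrite mul0r.
have x0 : x != 0 by rewrite gt_eqF// (lt_le_trans e0).
have := is_deriveM (dG x) (is_deriveV x0 (is_derive_id x (1 : R))).
rewrite (_ : (G * _) = (fun t => G t / t))//; congr is_derive.
by rewrite /GRing.scale/=; field.
Qed.

Lemma annular_quotient_cont : continuous (fun x => G' x / x - G x / x ^+ 2).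
Proof.
move=> x; have [xe|xe] := ltP x e.
  have [Gx G'x] := Ge (ltW xe).
  rewrite /continuous_at Gx G'x !mul0r subrr; apply: cvg_near_cst.
  by move: (nearE xe); apply: filterS => y [-> ->]; rewrite !mul0r subrr.
have x0 : x != 0 by rewrite gt_eqF// (lt_le_trans e0).
apply: cvgB; apply: cvgM.
- exact: cG'.
- by apply: cvgV => //; exact: cvg_id.
- exact: is_derive1_cont (dG x).
- by apply: cvgV; [rewrite expf_neq0|apply: cvgM; exact: cvg_id].
Qed.

(** For [k = G / t] one has [k + t k' = G'], which reduces the claim to [entire_radial_dbar]; since
    [G] vanishes up to [e], the quotient is [C^1] at 0. This stands in for the equality of the means
    of [f] over all circles about [w]. *)
Lemma entire_annular (f : R[i] -> R[i]) (T : R) w : entire f ->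
  (forall t, T <= t -> G t = 0 /\ G' t = 0) ->
  rint (fun z => reC f z * G' (sqd w z)) = 0 /\ rint (fun z => imC f z * G' (sqd w z)) = 0.
Proof.
move=> fE GT.
have kT t : T <= t -> G t / t = 0 /\ G' t / t - G t / t ^+ 2 = 0.
  by move=> /GT[-> ->]; rewrite !mul0r subrr.
have [A B] := entire_radial_dbar w fE annular_quotient_derive annular_quotient_cont kT.
have E z : G (sqd w z) / sqd w z +
    sqd w z * (G' (sqd w z) / sqd w z - G (sqd w z) / sqd w z ^+ 2) = G' (sqd w z).
  have [se|se] := leP (sqd w z) e.
    by have [-> ->] := Ge se; rewrite !mul0r subrr mulr0 addr0.
  by field; rewrite gt_eqF// (lt_trans e0).
split; [rewrite -A|rewrite -B]; apply: eq_rint => z; by rewrite E.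
Qed.

End annular.

End radial_kernels.

(** * A radial kernel with the mean value property *)

Section reproducing_kernel.
Context {R : realType}.
Local Notation mu := (@leb2 R).
Local Notation ig f := (mu.-integrable setT (EFin \o f)).
Local Notation rint := (Rintegral mu setT).
Local Notation Re := complex.Re.
Local Notation Im := complex.Im.

Lemma is_derive_pos3 (x : R) : is_derive x (1 : R) (fun x => pos x ^+ 3) (3 * pos x ^+ 2).
Proof.
have -> : (fun x : R => pos x ^+ 3) = id * (fun x => pos x ^+ 2).
  by apply/funext => y /=; rewrite /GRing.mul/=; case: (posP y) => -[_ ->] //=;
    rewrite !expr0n/= mulr0.
have := is_deriveM (is_derive_id x (1 : R)) (is_derive_pos2 x).
congr is_derive; rewrite /GRing.scale/=.
by case: (posP x) => -[_ ->]; ring.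
Qed.

Definition cubic (x : R) : R := (pos x ^+ 3 - 2 * pos (x - 1) ^+ 3 + pos (x - 2) ^+ 3) / 6.

Lemma is_derive_cubic x : is_derive x (1 : R) cubic (sstep x).
Proof.
have d0 := is_derive_pos3 x.
have d1 := is_derive_comp_shift (is_derive_pos3 (x - 1)).
have d2 := is_derive_comp_shift (is_derive_pos3 (x - 2)).
have D := is_deriveZ (6^-1 : R) (is_deriveD (is_deriveB d0 (is_deriveZ (2 : R) d1)) d2).
rewrite (_ : cubic = (6^-1 *: ((fun x => pos x ^+ 3) - 2 *: (fun x => pos (x - 1) ^+ 3)
  + (fun x => pos (x - 2) ^+ 3)))); last first.
  by apply/funext => y; rewrite /cubic /= mulrC.
move: D; congr is_derive; rewrite /sstep /GRing.scale/=.
by move: (pos x) (pos (x - 1)) (pos (x - 2)) => a b c; field.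
Qed.

Lemma cubic_le0 x : x <= 0 -> cubic x = 0.
Proof. by move=> x0; rewrite /cubic !pos_0; lra. Qed.

Lemma cubic_ge2 x : 2 <= x -> cubic x = x - 1.
Proof. by move=> x0; rewrite /cubic !pos_id; try lra; field. Qed.

(* A C^2 step from 0 to 1 on [1, 4], with derivative [kern] *)
Definition cstep (x : R) : R := cubic (x - 1) - cubic (x - 2).
Definition kern (x : R) : R := bspline (x - 1).
Definition kern' (x : R) : R := bspline' (x - 1).

Lemma is_derive_cstep x : is_derive x (1 : R) cstep (kern x).
Proof.
rewrite /kern bspline_sstep (_ : x - 1 - 1 = x - 2); last by ring.
apply: is_deriveB; apply: is_derive_comp_shift; exact: is_derive_cubic.
Qed.

Lemma is_derive_kern x : is_derive x (1 : R) kern (kern' x).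
Proof. by apply: is_derive_comp_shift; exact: is_derive_bspline. Qed.

Lemma continuous_kern' : continuous kern'.
Proof.
move=> x; apply: (cvg_comp (fun x => x - 1) bspline'); last exact: continuous_bspline'.
by apply: cvgB; [exact: cvg_id|exact: cvg_cst].
Qed.

Lemma continuous_kern : continuous kern.
Proof. by move=> x; exact: is_derive1_cont (is_derive_kern x). Qed.

Lemma cstep_le1 x : x <= 1 -> cstep x = 0 /\ kern x = 0.
Proof.
move=> x1; rewrite /cstep !cubic_le0; try lra; rewrite subrr; split => //.
by rewrite /kern (bspline_out _).1//; left; lra.
Qed.

Lemma cstep_ge4 x : 4 <= x -> cstep x = 1 /\ kern x = 0.
Proof.
move=> x1; rewrite /cstep !cubic_ge2; try lra; split; first by ring.
by rewrite /kern (bspline_out _).1//; right; lra.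
Qed.

Lemma kern_out x : 4 <= x -> kern x = 0 /\ kern' x = 0.
Proof. by move=> x4; apply: bspline_out; right; lra. Qed.

Lemma bspline_ge0 (x : R) : 0 <= bspline x.
Proof.
have [x0|x0] := leP x 0; first by rewrite (bspline_out (or_introl x0)).1.
have [x3|x3] := leP 3 x; first by rewrite (bspline_out (or_intror x3)).1.
rewrite /bspline (pos_id (ltW x0)) (@pos_0 _ (x - 3)); last lra.
by case: (posP (x - 1)) => [] [? ->]; case: (posP (x - 2)) => [] [? ->]; nra.
Qed.

Lemma kern_mid (x : R) : 2 <= x <= 3 -> 1 / 2 <= kern x.
Proof.
move=> x23; rewrite /kern /bspline (@pos_id _ (x - 1)); last lra.
rewrite (@pos_id _ (x - 1 - 1)); last lra.
by rewrite (@pos_0 _ (x - 1 - 2)) ?(@pos_0 _ (x - 1 - 3)); try lra; nra.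
Qed.

(** For the truncated square the remainder is at most [(b - a)^2]; the weights 1, 3, 3, 1 of the
    spline, divided by 2, add up to 4. *)
Lemma kern_taylor (s t : R) : `|kern t - kern s - kern' s * (t - s)| <= 4 * (t - s) ^+ 2.
Proof.
have P (a b : R) : `|pos b ^+ 2 - pos a ^+ 2 - 2 * pos a * (b - a)| <= (b - a) ^+ 2.
  have S := sqr_ge0 (b - a).
  rewrite ler_norml; case: (posP a) => [] [a0 ->]; case: (posP b) => [] [b0 ->].
  - by apply/andP; split; nra.
  - by have ab := mulr_ge0_le0 a0 b0; apply/andP; split; nra.
  - by have ab := mulr_le0_ge0 a0 b0; apply/andP; split; nra.
  - by apply/andP; split; nra.
have := P (s - 1) (t - 1); have := P (s - 1 - 1) (t - 1 - 1).
have := P (s - 1 - 2) (t - 1 - 2); have := P (s - 1 - 3) (t - 1 - 3).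
rewrite /kern /kern' /bspline /bspline'.
have E c : t - 1 - c - (s - 1 - c) = t - s by ring.
rewrite !E (_ : t - 1 - (s - 1) = t - s); last by ring.
move: (pos _) (pos _) (pos _) (pos _) (pos _) (pos _) (pos _) (pos _) (t - s).
by move=> a b c d e f g h u; rewrite !ler_norml; lra.
Qed.

(** The mass of the kernel, kept as a function of [w]: later it is treated as an entire function by
    which one divides, not as a constant obtained from translation invariance. *)
Definition kappa (w : R * R) : R := rint (fun z => kern (sqd w z)).

Lemma C1c_kern w : C1c (fun z => kern (sqd w z)) (fun z => kern' (sqd w z) * (2 * (z.1 - w.1)))
    (fun z => kern' (sqd w z) * (2 * (z.2 - w.2))).
Proof. exact: C1c_radial is_derive_kern continuous_kern' kern_out. Qed.

Lemma kern_scaled_ig w (e : R) (g : R * R -> R) : 0 < e -> continuous g ->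
  ig (fun z => g z * (kern (sqd w z / e) / e)).
Proof.
move=> e0 cg; apply: (@continuous_compact_support_integrable _ _ (`|w| + `|4 * e| + 1)).
  move=> z; apply: cvgM; first exact: cg.
  apply: cvgMl; apply: (cvg_comp (fun z => sqd w z / e) kern).
    by apply: cvgMl; exact: continuous_sqd.
  exact: continuous_kern.
move=> z /sqd_out ez; rewrite (kern_out _).1 ?mul0r ?mulr0//.
by rewrite ler_pdivlMr.
Qed.

Lemma kern_ig w (g : R * R -> R) : continuous g -> ig (fun z => g z * kern (sqd w z)).
Proof.
move=> cg; have := @kern_scaled_ig w 1 g ltr01 cg.
by apply: ig_eq => z; rewrite !divr1.
Qed.

Lemma continuous_one : continuous (fun _ : R * R => 1 : R).
Proof. by move=> z; exact: cvg_cst. Qed.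

Lemma kern_igT w : ig (fun z => kern (sqd w z)).
Proof.
have := @kern_ig w (fun=> 1) continuous_one.
by apply: ig_eq => z; rewrite mul1r.
Qed.

(** The steps [cstep t] and [cstep (t / e)] are both 0 for [t <= e] and both 1 for [t >= 4]. Their
    difference is thus an admissible [G] in [entire_annular], and its derivative is the difference
    of the two kernels. *)
Lemma kern_scale (f : R[i] -> R[i]) w (e : R) : entire f -> 0 < e <= 1 ->
  rint (fun z => reC f z * kern (sqd w z)) = rint (fun z => reC f z * (kern (sqd w z / e) / e)) /\
  rint (fun z => imC f z * kern (sqd w z)) = rint (fun z => imC f z * (kern (sqd w z / e) / e)).
Proof.
move=> fE /andP[e0 e1].
have dG (x : R) : is_derive x (1 : R) (fun t => cstep t - cstep (t / e)) (kern x - kern (x / e) / e).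
  apply: is_deriveB; first exact: is_derive_cstep.
  apply: (@is_derive1_comp R cstep (fun t => t / e)); first exact: is_derive_cstep.
  have := is_deriveM (is_derive_id x (1 : R)) (is_derive_cst (e^-1 : R) x (1 : R)).
  by congr is_derive; rewrite /GRing.scale/= mulr0 add0r mulr1.
have cG' : continuous (fun x => kern x - kern (x / e) / e).
  move=> x; apply: cvgB; first exact: continuous_kern.
  apply: cvgMl; apply: (cvg_comp (fun x => x / e) kern); last exact: continuous_kern.
  by apply: cvgMl; exact: cvg_id.
have Ge t : t <= e -> cstep t - cstep (t / e) = 0 /\ kern t - kern (t / e) / e = 0.
  move=> te; have [-> ->] := cstep_le1 (le_trans te e1).
  have [|-> ->] := @cstep_le1 (t / e); first by rewrite ler_pdivrMr// mul1r.
  by rewrite mul0r !subrr.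
have GT t : 4 <= t -> cstep t - cstep (t / e) = 0 /\ kern t - kern (t / e) / e = 0.
  move=> t4; have [-> ->] := cstep_ge4 t4.
  have [|-> ->] := @cstep_ge4 (t / e).
    by rewrite ler_pdivlMr// (le_trans _ t4)// ler_piMr.
  by rewrite mul0r !subrr.
have [A B] := entire_annular dG cG' e0 Ge w fE GT.
have cp := continuous_reC fE; have cq := continuous_imC fE.
split; apply/eqP; rewrite -subr_eq0 -rintB; try exact: kern_scaled_ig; try exact: kern_ig.
  by apply/eqP; rewrite -[RHS]A; apply: eq_rint => z; rewrite mulrBr.
by apply/eqP; rewrite -[RHS]B; apply: eq_rint => z; rewrite mulrBr.
Qed.

Lemma entire_cst (c : R[i]) : entire (fun=> c).
Proof. by move=> z; exact: derivable_cst. Qed.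

Lemma kern_ge0 x : 0 <= kern x. Proof. exact: bspline_ge0. Qed.

(** The scaled kernels all have mass [kappa w] and shrink to [w], while the integral against [g]
    does not depend on the scale; continuity of [g] at [w] decides its value. *)
Lemma kern_mean (g : R * R -> R) w : continuous g ->
  (forall e : R, 0 < e <= 1 -> rint (fun z => g z * kern (sqd w z)) =
    rint (fun z => g z * (kern (sqd w z / e) / e))) ->
  rint (fun z => g z * kern (sqd w z)) = kappa w * g w.
Proof.
move=> cg gE.
have kE (e : R) : 0 < e <= 1 -> kappa w = rint (fun z => kern (sqd w z / e) / e).
  move=> e01; have [+ _] := kern_scale w (@entire_cst 1) e01.
  rewrite /kappa (eq_rint (g := fun z => kern (sqd w z))) => [->|z].
    by apply: eq_rint => z; rewrite /reC mul1r.
  by rewrite /reC mul1r.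
have ki (e : R) : 0 < e -> ig (fun z => kern (sqd w z / e) / e).
  move=> e0; have := @kern_scaled_ig w e (fun=> 1) e0 continuous_one.
  by apply: ig_eq => z; rewrite mul1r.
have k0 : 0 <= kappa w by apply: Rintegral_ge0 => z _; exact: kern_ge0.
apply/eqP; rewrite -subr_eq0 -normr_le0; apply/ler_addgt0Pr => d d0; rewrite add0r.
pose d' := d / (kappa w + 1).
have d'0 : 0 < d' by rewrite divr_gt0// ltr_wpDl.
have /cvgrPdist_le/(_ _ d'0)/nbhs_ballP[r /= r0 rP] := cg w.
(* The scaled kernel lives on [sqd w z < 4 e], which puts [z] inside the ball of radius [r]; the
   minimum with 1 is required by the scaling hypothesis. *)
pose e := Num.min 1 (r ^+ 2 / 16).
have e0 : 0 < e by rewrite /e lt_min ltr01 divr_gt0 ?exprn_gt0.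
have e1 : e <= 1 by rewrite /e ge_min lexx.
have e2 : 16 * e <= r ^+ 2.
  by rewrite mulrC -ler_pdivlMr// /e ge_min lexx orbT.
rewrite (gE e) ?e0// (kE e) ?e0// mulrC -rintZ ?ki// -rintB; first last.
- exact: igZ (ki _ e0).
- exact: kern_scaled_ig.
apply: le_trans (_ : rint (fun z => d' * (kern (sqd w z / e) / e)) <= _).
  apply: rint_norm_le.
  - by apply: igB; [exact: kern_scaled_ig|exact: igZ (ki _ e0)].
  - exact: igZ (ki _ e0).
  move=> z; rewrite -mulrBl normrM [X in _ * X]ger0_norm; last first.
    by apply: divr_ge0; [exact: kern_ge0|exact: ltW].
  have [ze|ze] := leP 4 (sqd w z / e); first by rewrite (kern_out ze).1 mul0r !mulr0.
  apply: ler_wpM2r; first by apply: divr_ge0; [exact: kern_ge0|exact: ltW].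
  rewrite distrC; apply: rP.
  rewrite -ball_normE /= distrC.
  rewrite -(@ltr_pXn2r _ 2%N)// ?nnegrE ?(ltW r0)//.
  apply: le_lt_trans (sqd_ge w z) _; apply: lt_le_trans e2.
  by move: ze; rewrite ltr_pdivrMr// => /lt_le_trans; apply; rewrite ler_pM2r// ler_nat.
rewrite rintZ ?ki// -kE ?e0// /d' mulrAC ler_pdivrMr ?ltr_wpDl//.
by rewrite ler_pM2l// lerDl.
Qed.

Lemma entire_mean (f : R[i] -> R[i]) w : entire f ->
  rint (fun z => reC f z * kern (sqd w z)) = kappa w * reC f w /\
  rint (fun z => imC f z * kern (sqd w z)) = kappa w * imC f w.
Proof.
move=> fE; split; apply: kern_mean.
- exact: continuous_reC.
- by move=> e /(kern_scale w fE)[].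
- exact: continuous_imC.
- by move=> e /(kern_scale w fE)[].
Qed.

Lemma kappa_gt0 w : 0 < kappa w.
Proof.
apply: (@lt_le_trans _ _ (1 / 2 * ((w.1 + 6 / 5 - (w.1 + 1)) * (w.2 + 6 / 5 - (w.2 + 1))))).
  by rewrite !mulr_gt0//; lra.
apply: rint_box_ge; [lra|lra|exact: kern_igT|by move=> z; exact: kern_ge0|].
move=> z z1 z2; apply: kern_mid; rewrite /sqd.
have a1 : 1 <= z.1 - w.1 <= 6 / 5 by lra.
have a2 : 1 <= z.2 - w.2 <= 6 / 5 by lra.
by move: (z.1 - w.1) (z.2 - w.2) a1 a2 => a b a1 a2; apply/andP; split; nra.
Qed.

Definition cut (r : R) (z : R * R) : R := (`|z| <= r)%R%:R.

Lemma measurable_cut (r : R) : measurable_fun setT (cut r).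
Proof.
have -> : cut r = \1_(`[- r, r] `*` `[- r, r])%classic.
  apply/funext => z; rewrite box_indicE /cut norm_pair_le !ler_norml.
  by [].
by apply: measurable_indic; apply: measurableX; exact: measurable_itv.
Qed.

Definition loc_int (g : R * R -> R) := measurable_fun setT g /\ forall r, ig (fun z => `|g z| * cut r z).

Lemma loc_int_mul (g q : R * R -> R) (r M : R) : loc_int g -> measurable_fun setT q ->
  (forall z, `|q z| <= M) -> (forall z, r < `|z| -> q z = 0) ->
  ig (fun z => g z * q z) /\ `|rint (fun z => g z * q z)| <= M * rint (fun z => `|g z| * cut r z).
Proof.
move=> [mg lg] mq qM qr.
have B z : `|g z * q z| <= M * (`|g z| * cut r z).
  rewrite normrM /cut; case: (leP `|z| r) => [_|/qr ->]; last by rewrite normr0 !mulr0.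
  by rewrite mulr1 mulrC ler_wpM2r.
have i1 : ig (fun z => g z * q z).
  apply: le_integrable (igZ M (lg r)) => //.
    by apply/measurable_EFinP; exact: measurable_funM.
  by move=> z _ /=; rewrite lee_fin (le_trans (B z))// ler_norm.
by split => //; rewrite -rintZ//; apply: rint_norm_le => //; exact: igZ.
Qed.

Lemma continuous_loc_int (g : R * R -> R) : continuous g -> loc_int g.
Proof.
move=> cg; split; first exact: continuous_measurable_prod.
move=> r; have cK : compact (`[- r, r] `*` `[- r, r] : set (R * R))%classic.
  by apply: compact_setX; exact: segment_compact.
have /compact_bounded[M [_ /(_ (M + 1))]] : compact (g @` (`[- r, r] `*` `[- r, r]))%classic.
  by apply: continuous_compact => //; exact: continuous_subspaceT.
rewrite ltrDl ltr01 => /(_ isT) bM.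
apply: (@measurable_compact_support_integrable _ _ r (Num.max 0 (M + 1))).
- apply: measurable_funM; first by apply: measurableT_comp => //; exact: continuous_measurable_prod.
  exact: measurable_cut.
- by move=> z zr; rewrite /cut leNgt zr mulr0.
- move=> z; rewrite /cut; case: (leP `|z| r) => zr; last by rewrite mulr0 normr0 le_max lexx.
  rewrite mulr1 normr_id le_max; apply/orP; right; apply: bM; exists z => //.
  move: zr; rewrite norm_pair_le => /andP[].
  by rewrite !ler_norml; split => /=; rewrite in_itv.
Qed.

(** First-order Taylor remainder in the center [w]. The linear part is added, as moving the center
    by [d] changes the squared distance by [- 2 (z - w).d] to first order. *)
Definition kern_rem (w d z : R * R) : R := kern (sqd (w + d) z) - kern (sqd w z)
  + (kern' (sqd w z) * (2 * (z.1 - w.1)) * d.1 + kern' (sqd w z) * (2 * (z.2 - w.2)) * d.2).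

Lemma kern_rem_bound w : exists M : R, 0 <= M /\ forall d, `|d| <= 1 ->
  (forall z, `|kern_rem w d z| <= M * `|d| ^+ 2) /\
  (forall z, `|w| + 6 < `|z| -> kern_rem w d z = 0).
Proof.
have O z d : `|d| <= 1 -> `|w| + 6 < `|z| -> kern_rem w d z = 0.
  move=> d1 zr; have s1 : 4 <= sqd (w + d) z.
    apply: sqd_out; rewrite ger0_norm//; have := ler_normD w d; lra.
  have s2 : 4 <= sqd w z by apply: sqd_out; rewrite ger0_norm//; lra.
  by rewrite /kern_rem (kern_out s1).1 (kern_out s2).1 (kern_out s2).2 subrr !mul0r !addr0.
pose S := 2 * `|w| + 6.
have S0 : 0 <= S by rewrite /S; have := normr_ge0 w; lra.
(* 36 bounds [kern'] and 2 compares [d.1^2 + d.2^2] with the squared sup norm; 4 is the constant of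
   [kern_taylor], and [(4 S + 2) |d|] bounds the change of the squared distance where
   [|z - w| <= S]. *)
exists (36 * 2 + 4 * (4 * S + 2) ^+ 2); split.
  by rewrite addr_ge0// mulr_ge0// sqr_ge0.
move=> d d1; split => z; last exact: O.
have [zr|zr] := ltP (`|w| + 6) `|z|.
  by rewrite O// normr0 mulr_ge0 ?exprn_ge0// addr_ge0// mulr_ge0// sqr_ge0.
have [z1 z2] := le_pair_norm (z - w); have [e1 e2] := le_pair_norm d.
have zS : `|z - w| <= S by have := ler_normB z w; rewrite /S; lra.
have z1S : `|z.1 - w.1| <= S := le_trans z1 zS.
have z2S : `|z.2 - w.2| <= S := le_trans z2 zS.
have k36 : `|kern' (sqd w z)| <= 36 := (bspline_bound _).2.
have T := kern_taylor (sqd w z) (sqd (w + d) z).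
have E : sqd (w + d) z - sqd w z = d.1 ^+ 2 + d.2 ^+ 2
    - 2 * ((z.1 - w.1) * d.1 + (z.2 - w.2) * d.2) by rewrite /sqd /=; ring.
have -> : kern_rem w d z = (kern (sqd (w + d) z) - kern (sqd w z)
    - kern' (sqd w z) * (sqd (w + d) z - sqd w z)) + kern' (sqd w z) * (d.1 ^+ 2 + d.2 ^+ 2).
  by rewrite E /kern_rem; ring.
have d2 : 0 <= d.1 ^+ 2 + d.2 ^+ 2 <= 2 * `|d| ^+ 2.
  rewrite addr_ge0 ?sqr_ge0//= mulr_natl mulr2n -(real_normK (num_real d.1))
    -(real_normK (num_real d.2)).
  by apply: lerD; rewrite ler_pXn2r ?nnegrE.
have nE : `|sqd (w + d) z - sqd w z| <= (4 * S + 2) * `|d|.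
  rewrite E; apply: (le_trans (ler_normB _ _)).
  rewrite (_ : (4 * S + 2) * `|d| = 2 * `|d| + 2 * (S * `|d| + S * `|d|)); last by ring.
  apply: lerD.
    rewrite ger0_norm; last by case/andP: d2.
    case/andP: d2 => _ /le_trans; apply; rewrite ler_pM2l// expr2.
    by rewrite ler_piMl.
  rewrite normrM ger0_norm// ler_pM2l//; apply: (le_trans (ler_normD _ _)).
  by rewrite !normrM; apply: lerD; apply: ler_pM.
have -> : (36 * 2 + 4 * (4 * S + 2) ^+ 2) * `|d| ^+ 2 =
    4 * ((4 * S + 2) * `|d|) ^+ 2 + 36 * (2 * `|d| ^+ 2) by ring.
apply: (le_trans (ler_normD _ _)); apply: lerD.
  apply: (le_trans T); rewrite ler_pM2l//.
  rewrite -(real_normK (num_real (sqd (w + d) z - sqd w z))).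
  by rewrite ler_pXn2r ?nnegrE ?mulr_ge0 ?addr_ge0 ?mulr_ge0.
rewrite normrM [X in _ * X]ger0_norm; last by case/andP: d2.
by apply: ler_pM => //; case/andP: d2.
Qed.

Lemma continuous_le_cut (w : R * R) (q : R * R -> R) : continuous q ->
  (forall z, `|w| + 6 < `|z| -> q z = 0) -> forall g, loc_int g -> ig (fun z => g z * q z).
Proof.
move=> cq q0 g lg; have [M qM] := compact_support_bounded cq q0.
exact: (loc_int_mul lg (continuous_measurable_prod cq) qM q0).1.
Qed.

Lemma kern_support w z : `|w| + 6 < `|z| -> kern (sqd w z) = 0 /\ kern' (sqd w z) = 0.
Proof. by move=> zr; apply/kern_out/sqd_out; rewrite ger0_norm//; lra. Qed.

(* The convolution of [h] with the radial kernel is complex differentiable as soon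
   as [h] is orthogonal to the d-bar derivatives of the translated kernels. *)
Lemma kern_transform_derivable (h1 h2 : R * R -> R) : loc_int h1 -> loc_int h2 ->
  (forall w, rint (fun z => h1 z * (kern' (sqd w z) * (2 * (z.1 - w.1)))) =
             rint (fun z => h2 z * (kern' (sqd w z) * (2 * (z.2 - w.2)))) /\
             rint (fun z => h2 z * (kern' (sqd w z) * (2 * (z.1 - w.1)))) =
             - rint (fun z => h1 z * (kern' (sqd w z) * (2 * (z.2 - w.2))))) ->
  entire (fun c : R[i] => (rint (fun z => h1 z * kern (sqd (Re c, Im c) z)) +i*
                  rint (fun z => h2 z * kern (sqd (Re c, Im c) z)))%C).
Proof.
move=> l1 l2 H c; rewrite -(toCK c); move: (Re c, Im c) => {c}w.
have [_ [_ ckx cky]] : True /\ [/\ True, continuous (fun z => kern' (sqd w z) * (2 * (z.1 - w.1)))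
    & continuous (fun z => kern' (sqd w z) * (2 * (z.2 - w.2)))].
  by have [[_ _ _ ? ?] _] := C1c_kern w.
have ck w' : continuous (fun z => kern (sqd w' z)) by have [[_ _ ? _ _] _] := C1c_kern w'.
have [HA HB] := H w.
set A := rint _ in HA; set B := rint _ in HB.
pose A2 := rint (fun z => h1 z * (kern' (sqd w z) * (2 * (z.2 - w.2)))).
have [M [M0 MP]] := kern_rem_bound w.
pose r := `|w| + 6.
pose L := rint (fun z => `|h1 z| * cut r z) + rint (fun z => `|h2 z| * cut r z).
have L1 : 0 <= rint (fun z => `|h1 z| * cut r z).
  by apply: Rintegral_ge0 => z _; rewrite mulr_ge0.
have L2 : 0 <= rint (fun z => `|h2 z| * cut r z).
  by apply: Rintegral_ge0 => z _; rewrite mulr_ge0.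
have T g d : loc_int g -> `|d| <= 1 ->
  `|rint (fun z => g z * kern (sqd (w + d) z)) - rint (fun z => g z * kern (sqd w z)) +
    (rint (fun z => g z * (kern' (sqd w z) * (2 * (z.1 - w.1)))) * d.1 +
     rint (fun z => g z * (kern' (sqd w z) * (2 * (z.2 - w.2)))) * d.2)|
  <= M * `|d| ^+ 2 * rint (fun z => `|g z| * cut r z).
  move=> lg d1; have [Mb Mz] := MP _ d1.
  have i0 : ig (fun z => g z * kern (sqd (w + d) z)).
    apply: (continuous_le_cut (w := w + d)) => // z /kern_support[]//.
  have i1 : ig (fun z => g z * kern (sqd w z)).
    by apply: (continuous_le_cut (w := w)) => // z /kern_support[].
  have i2 : ig (fun z => g z * (kern' (sqd w z) * (2 * (z.1 - w.1)))).
    by apply: (continuous_le_cut (w := w)) => // z /kern_support[_ ->]; rewrite mul0r.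
  have i3 : ig (fun z => g z * (kern' (sqd w z) * (2 * (z.2 - w.2)))).
    by apply: (continuous_le_cut (w := w)) => // z /kern_support[_ ->]; rewrite mul0r.
  have mrem : measurable_fun setT (kern_rem w d).
    apply: measurable_funD.
      by apply: measurable_funB; apply: continuous_measurable_prod; exact: ck.
    by apply: measurable_funD; apply: measurable_funM => //; exact: continuous_measurable_prod.
  have [_] := loc_int_mul lg mrem Mb Mz; congr (`|_| <= _).
  rewrite (eq_rint (g := fun z => (g z * kern (sqd (w + d) z) - g z * kern (sqd w z))
    + (d.1 * (g z * (kern' (sqd w z) * (2 * (z.1 - w.1))))
      + d.2 * (g z * (kern' (sqd w z) * (2 * (z.2 - w.2))))))); last first.
    by move=> z; rewrite /kern_rem; ring.
  rewrite rintD; [|exact: igB|by apply: igD; exact: igZ].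
  rewrite rintB// rintD; [|exact: igZ|exact: igZ].
  by rewrite !rintZ// ![_.1 * _]mulrC ![_.2 * _]mulrC.
(* The signs come from differentiating in the center instead of in [z]. [HA] and [HB] identify the
   two integrals of [h2] with [A] and [- A2], as the Cauchy-Riemann equations demand. *)
apply: (@expansion_derivable _ _ w (- A) A2) => e e0.
pose C := M * L + 1.
have C0 : 0 < C by rewrite ltr_wpDl// mulr_ge0// addr_ge0.
exists (Num.min 1 (e / C)); first by rewrite lt_min ltr01 divr_gt0.
move=> y; rewrite lt_min => /andP[y1 ye].
have eC : M * `|y - w| ^+ 2 * L <= e * `|y - w|.
  rewrite expr2 mulrA mulrAC; apply: ler_wpM2r => //.
  rewrite -mulrAC; move: ye; rewrite ltr_pdivlMr// => /ltW; apply: le_trans.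
  by rewrite mulrC ler_wpM2l// lerDl.
have wy : w + (y - w) = y by rewrite addrC subrK.
have T1 := T _ (y - w) l1 (ltW y1); have T2 := T _ (y - w) l2 (ltW y1).
rewrite wy in T1 T2; rewrite -/A -/A2 in T1; rewrite -/B HB -HA in T2.
rewrite /toC /= -!surjective_pairing; split.
  apply: (@le_trans _ _ (M * `|y - w| ^+ 2 * rint (fun z => `|h1 z| * cut r z))).
    by move: T1; congr (`|_| <= _); rewrite /=; ring.
  by apply: le_trans eC; rewrite ler_wpM2l ?mulr_ge0 ?exprn_ge0// lerDl.
apply: (@le_trans _ _ (M * `|y - w| ^+ 2 * rint (fun z => `|h2 z| * cut r z))).
  by move: T2; rewrite -/A2; congr (`|_| <= _); rewrite /=; ring.
by apply: le_trans eC; rewrite ler_wpM2l ?mulr_ge0 ?exprn_ge0// lerDr.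
Qed.

End reproducing_kernel.

(** * The weighted L2 space *)

Section weighted_L2.
Context {R : realType} (m : R) (hm : 0 <= m).
Local Notation mu := (@leb2 R).
Local Notation ig f := (mu.-integrable setT (EFin \o f)).
Local Notation rint := (Rintegral mu setT).
Local Notation Re := complex.Re.
Local Notation Im := complex.Im.
Local Notation W := (weight m).
Implicit Types (p q : R * R -> R) (f g h u : R * R -> R[i]).

Lemma weight_gt0 z : 0 < W z. Proof. exact: expR_gt0. Qed.

Lemma weight_ge0 z : 0 <= W z. Proof. exact/ltW/weight_gt0. Qed.

Lemma measurable_cabs_powR : measurable_fun setT (fun z : R * R => cabs z `^ m).
Proof.
apply: (@measurableT_comp _ _ _ _ _ _ (fun x : R => x `^ m)); first exact: measurable_powR.
apply: continuous_measurable_prod => z.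
apply: (cvg_comp (fun z => z.1 ^+ 2 + z.2 ^+ 2) Num.sqrt); last exact: sqrt_continuous.
have := @continuous_sqd R (0, 0) z; rewrite /sqd/=.
by under eq_fun do rewrite !subr0.
Qed.

Lemma measurable_weight : measurable_fun setT W.
Proof.
apply: measurableT_comp; first exact: measurable_expR.
apply: measurable_funN; exact: measurable_cabs_powR.
Qed.

Lemma cabs_le (r : R) z : `|z| <= r -> cabs z <= 2 * r.
Proof.
move=> zr; have [z1 z2] := le_pair_norm z; have r0 : 0 <= r := le_trans (normr_ge0 _) zr.
rewrite /cabs -(ger0_norm (mulr_ge0 (ler0n R 2) r0)) -sqrtr_sqr ler_sqrt ?sqr_ge0//.
rewrite -(real_normK (num_real z.1)) -(real_normK (num_real z.2)).
have := normr_ge0 z.1; have := normr_ge0 z.2.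
by have := le_trans z1 zr; have := le_trans z2 zr; nra.
Qed.

Lemma weight_lower (r : R) : exists2 c : R, 0 < c & forall z, `|z| <= r -> c <= W z.
Proof.
exists (expR (- ((2 * `|r|) `^ m))); first exact: expR_gt0.
move=> z zr; rewrite /weight ler_expR lerN2; apply: ge0_ler_powR => //.
- by rewrite nnegrE sqrtr_ge0.
- by rewrite nnegrE mulr_ge0.
- by apply: (le_trans (cabs_le zr)); rewrite ler_pM2l// ler_norm.
Qed.

Definition l2 (p : R * R -> R) := measurable_fun setT p /\ ig (fun z => p z ^+ 2 * W z).

Definition J (p q : R * R -> R) : R := rint (fun z => p z * q z * W z).

Lemma l2_ig p q : l2 p -> l2 q -> ig (fun z => p z * q z * W z).
Proof.
move=> [mp ip] [mq iq].
have i1 : ig (fun z => 2^-1 * (p z ^+ 2 * W z) + 2^-1 * (q z ^+ 2 * W z)).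
  by apply: igD; exact: igZ.
apply: le_integrable i1 => //.
  apply/measurable_EFinP; apply: measurable_funM; last exact: measurable_weight.
  exact: measurable_funM.
move=> z _ /=; rewrite lee_fin -mulrDr -mulrDl mulrA normrM (ger0_norm (weight_ge0 z)).
rewrite [X in _ <= X]ger0_norm; last by rewrite mulr_ge0 ?weight_ge0// mulr_ge0// addr_ge0 ?sqr_ge0.
rewrite ler_pM2r ?weight_gt0// ler_norml.
by have := sqr_ge0 (p z + q z); have := sqr_ge0 (p z - q z); lra.
Qed.

Lemma l2D p q : l2 p -> l2 q -> l2 (fun z => p z + q z).
Proof.
move=> lp lq; have [mp ip] := lp; have [mq iq] := lq; split; first exact: measurable_funD.
apply: (ig_eq (f := fun z => p z ^+ 2 * W z + 2 * (p z * q z * W z) + q z ^+ 2 * W z)).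
  by move=> z; ring.
by apply: igD => //; apply: igD => //; apply: igZ; exact: l2_ig.
Qed.

Lemma l2Z (a : R) p : l2 p -> l2 (fun z => a * p z).
Proof.
move=> [mp ip]; split; first exact: measurable_funM.
by apply: ig_eq (igZ (a ^+ 2) ip) => z; ring.
Qed.

Lemma l20 : l2 (fun=> 0).
Proof.
split=> //; apply: (ig_eq (f := fun=> 0)) => [z|]; first by rewrite expr0n/= mul0r.
exact: integrable0.
Qed.

Lemma JC p q : J p q = J q p.
Proof. by apply: eq_rint => z; rewrite [p z * _]mulrC. Qed.

Lemma JDl p p' q : l2 p -> l2 p' -> l2 q -> J (fun z => p z + p' z) q = J p q + J p' q.
Proof.
move=> lp lp' lq; rewrite -rintD; [|exact: l2_ig|exact: l2_ig].
by apply: eq_rint => z; ring.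
Qed.

Lemma JZl (a : R) p q : l2 p -> l2 q -> J (fun z => a * p z) q = a * J p q.
Proof.
move=> lp lq; rewrite -rintZ; last exact: l2_ig.
by apply: eq_rint => z; ring.
Qed.

Lemma J_ge0 p : 0 <= J p p.
Proof.
apply: Rintegral_ge0 => z _; rewrite mulr_ge0 ?weight_ge0//.
by rewrite -expr2 sqr_ge0.
Qed.

Lemma J_CS p q : l2 p -> l2 q -> J p q ^+ 2 <= J p p * J q q.
Proof.
move=> lp lq.
have H (s : R) : 0 <= J p p - 2 * s * J p q + s ^+ 2 * J q q.
  have := J_ge0 (fun z => p z + - s * q z); have ls := l2Z (- s) lq.
  rewrite JDl//; last exact: l2D.
  rewrite JZl//; last exact: l2D.
  rewrite ![J _ (fun z => _ + _)]JC !JDl// !JZl// [J q p]JC.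
  by congr (0 <= _); ring.
have [q0|q0] := eqVneq (J q q) 0.
  rewrite q0 mulr0; have [->|pq] := eqVneq (J p q) 0; first by rewrite expr0n.
  (* With [J q q = 0] the quadratic polynomial is linear in [s]; at this [s] it would take the value
     -1. *)
  have := H ((J p p + 1) / (2 * J p q)); rewrite q0 mulr0 addr0.
  by rewrite (_ : 2 * _ * _ = J p p + 1); [lra|field].
have qq : 0 < J q q by rewrite lt_def q0 J_ge0.
have := H (J p q / J q q).
rewrite (_ : _ + _ = (J p p * J q q - J p q ^+ 2) / J q q); last by field.
by rewrite pmulr_lge0 ?invr_gt0// subr_ge0.
Qed.

Lemma l2_loc_int p : l2 p -> loc_int p.
Proof.
move=> [mp ip]; split=> // r; have [c c0 cW] := weight_lower r.
have [_ /(_ r)] : loc_int (fun _ : R * R => 1 : R).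
  by apply: continuous_loc_int; exact: continuous_one.
(* On the square of half-width [r], [|p| <= p^2 + 1 <= p^2 W / c + 1]. *)
move=> i1; have i2 := igD (igZ c^-1 ip) i1.
apply: le_integrable i2 => //.
  apply/measurable_EFinP; apply: measurable_funM; last exact: measurable_cut.
  exact: measurableT_comp.
move=> z _ /=; rewrite lee_fin normrM normr_id /cut normr1 mul1r.
rewrite [X in _ <= X]ger0_norm; last first.
  by rewrite addr_ge0// mulr_ge0 ?invr_ge0 ?(ltW c0)// mulr_ge0 ?sqr_ge0 ?weight_ge0.
have [zr|_] := leP `|z| r; last first.
  by rewrite normr0 mulr0 addr0 mulr_ge0 ?invr_ge0 ?(ltW c0)// mulr_ge0 ?sqr_ge0 ?weight_ge0.
rewrite normr1 mulr1.
have : p z ^+ 2 <= c^-1 * (p z ^+ 2 * W z).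
  by rewrite ler_pdivlMl// mulrC ler_wpM2l ?sqr_ge0// cW.
rewrite -(real_normK (num_real (p z))); have := sqr_ge0 (`|p z| - 1).
by rewrite (_ : true%:R = 1 :> R)//; move: (`|p z|) (c^-1 * _) => a b; nra.
Qed.

Lemma compact_support_l2 q (r M : R) : measurable_fun setT q ->
  (forall z, r < `|z| -> q z = 0) -> (forall z, `|q z| <= M) -> l2 (fun z => q z / W z).
Proof.
move=> mq q0 qM; have [c c0 cW] := weight_lower r.
have mW : measurable_fun setT (fun z => (W z)^-1).
  rewrite (_ : (fun _ => _) = fun z => expR (cabs z `^ m)); last first.
    by apply/funext => z; rewrite /weight expRN invrK.
  apply: measurableT_comp; first exact: measurable_expR.
  exact: measurable_cabs_powR.
split; first exact: measurable_funM.
apply: (@measurable_compact_support_integrable _ _ r (M ^+ 2 / c)).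
- apply: measurable_funM; last exact: measurable_weight.
  by apply: measurable_funX; exact: measurable_funM.
- by move=> z /q0 ->; rewrite mul0r expr0n/= mul0r.
- move=> z; have [zr|/q0 ->] := leP `|z| r; last first.
    by rewrite mul0r expr0n/= mul0r normr0 divr_ge0 ?sqr_ge0// ltW.
  rewrite (_ : (q z / W z) ^+ 2 * W z = q z ^+ 2 / W z); last first.
    by field; rewrite gt_eqF// weight_gt0.
  rewrite ger0_norm ?divr_ge0 ?sqr_ge0 ?weight_ge0//.
  apply: ler_pM; rewrite ?sqr_ge0 ?invr_ge0 ?weight_ge0//.
    rewrite -(real_normK (num_real (q z))) ler_pXn2r ?nnegrE//.
    exact: le_trans (normr_ge0 _) (qM z).
  by rewrite lef_pV2 ?posrE ?weight_gt0// cW.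
Qed.

Lemma continuous_compact_support_l2 (f : R * R -> R) (r : R) : continuous f ->
  (forall z, r < `|z| -> f z = 0) -> l2 (fun z => f z / W z).
Proof.
move=> cf f0; have [M fM] := compact_support_bounded cf f0.
exact: (compact_support_l2 (continuous_measurable_prod cf) f0 fM).
Qed.

(** Dividing by the weight turns an unweighted integral against a compactly supported function into
    a weighted product, to which Cauchy-Schwarz applies. *)
Lemma J_div p q : rint (fun z => p z * q z) = J p (fun z => q z / W z).
Proof. by apply: eq_rint => z; field; rewrite gt_eqF// weight_gt0. Qed.

End weighted_L2.

(** * Complex-valued functions, orthonormal systems and Bessel's inequality *)

Section complex_L2.
Context {R : realType} (m : R).
Local Notation mu := (@leb2 R).
Local Notation ig f := (mu.-integrable setT (EFin \o f)).
Local Notation rint := (Rintegral mu setT).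
Local Notation Re := (@complex.Re R).
Local Notation Im := (@complex.Im R).
Local Notation W := (weight m).
Local Notation J := (J m).
Local Notation l2 := (l2 m).
Local Notation inL2 := (inL2 m).
Local Notation ip := (ip m).
Implicit Types (f g h u : R * R -> R[i]) (a b c : R[i]).

Definition re f : R * R -> R := fun z => Re (f z).
Definition im f : R * R -> R := fun z => Im (f z).
Definition norm2 f : R := J (re f) (re f) + J (im f) (im f).

Lemma sqnorm_ge0 a : 0 <= sqnorm a.
Proof. by rewrite addr_ge0 ?sqr_ge0. Qed.

Lemma norm2_ge0 f : 0 <= norm2 f.
Proof. by rewrite addr_ge0 ?J_ge0. Qed.

Lemma inL2_norm2 u : l2 (re u) -> l2 (im u) -> inL2 u /\ L2norm2 m u = (norm2 u)%:E.
Proof.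
move=> [m1 i1] [m2 i2].
have E : L2norm2 m u = (norm2 u)%:E.
  rewrite /L2norm2 (_ : (fun _ => _) = fun z => (re u z ^+ 2 * W z + im u z ^+ 2 * W z)%:E).
    have i3 := igD i1 i2; have := integrable_fin_num _ i3 => /(_ measurableT) /fineK <-.
    congr (_%:E); rewrite -/(Rintegral mu setT (fun z => re u z ^+ 2 * W z + im u z ^+ 2 * W z)).
    by rewrite rintD.
  by apply/funext => z; rewrite /sqnorm mulrDl.
by split => //; split => //; rewrite E ltry.
Qed.

Lemma inL2P u : inL2 u <-> l2 (re u) /\ l2 (im u).
Proof.
split=> [[m1 m2 fin]|[l1 l2']]; last by have [] := inL2_norm2 l1 l2'.
have iW : ig (fun z => sqnorm (u z) * W z).
  apply/integrableP; split.
    apply/measurable_EFinP; apply: measurable_funM; last exact: measurable_weight.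
    by apply: measurable_funD; exact: measurable_funX.
  rewrite (_ : (fun _ => _) = fun z => (sqnorm (u z) * W z)%:E) ?fin//.
  by apply/funext => z /=; rewrite ger0_norm// mulr_ge0 ?sqnorm_ge0 ?weight_ge0.
have H (p : R * R -> R) : measurable_fun setT p -> (forall z, p z ^+ 2 <= sqnorm (u z)) ->
    ig (fun z => p z ^+ 2 * W z).
  move=> mp pu; apply: le_integrable iW => //.
    apply/measurable_EFinP; apply: measurable_funM; last exact: measurable_weight.
    exact: measurable_funX.
  move=> z _ /=; rewrite lee_fin (ger0_norm (mulr_ge0 (sqr_ge0 (p z)) (weight_ge0 m z))).
  rewrite (ger0_norm (mulr_ge0 (sqnorm_ge0 (u z)) (weight_ge0 m z))).
  by rewrite ler_wpM2r ?weight_ge0.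
by split; split => //; apply: H => // z; rewrite ?lerDl ?lerDr sqr_ge0.
Qed.

Lemma L2norm2E u : inL2 u -> L2norm2 m u = (norm2 u)%:E.
Proof. by move=> /inL2P[l1 l2']; have [] := inL2_norm2 l1 l2'. Qed.

Lemma ReD a b : Re (a + b) = Re a + Re b. Proof. by case: a b => [? ?] [? ?]. Qed.
Lemma ImD a b : Im (a + b) = Im a + Im b. Proof. by case: a b => [? ?] [? ?]. Qed.
Lemma ReM a b : Re (a * b) = Re a * Re b - Im a * Im b. Proof. by case: a b => [? ?] [? ?]. Qed.
Lemma ImM a b : Im (a * b) = Re a * Im b + Im a * Re b. Proof. by case: a b => [? ?] [? ?]. Qed.

Lemma ipE f g : inL2 f -> inL2 g ->
  ip f g = ((J (re f) (re g) + J (im f) (im g)) +i* (J (im f) (re g) - J (re f) (im g)))%C.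
Proof.
move=> /inL2P[f1 f2] /inL2P[g1 g2]; rewrite /ip /cint.
congr (_ +i* _)%C.
  rewrite -rintD; [|exact: l2_ig|exact: l2_ig]; apply: eq_rint => z; rewrite /re /im.
  by case: (f z) (g z) => [a b] [c d] /=; ring.
rewrite -rintB; [|exact: l2_ig|exact: l2_ig]; apply: eq_rint => z; rewrite /re /im.
by case: (f z) (g z) => [a b] [c d] /=; ring.
Qed.

Lemma inL2D f g : inL2 f -> inL2 g -> inL2 (fun z => f z + g z).
Proof.
move=> /inL2P[f1 f2] /inL2P[g1 g2]; apply/inL2P; rewrite /re /im.
by under eq_fun do rewrite ReD; under [in X in _ /\ X]eq_fun do rewrite ImD; split; exact: l2D.
Qed.

Lemma inL2Z c f : inL2 f -> inL2 (fun z => c * f z).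
Proof.
move=> /inL2P[f1 f2]; apply/inL2P; rewrite /re /im.
under eq_fun do rewrite ReM -mulNr; under [in X in _ /\ X]eq_fun do rewrite ImM.
by split; apply: l2D; exact: l2Z.
Qed.

Lemma inL20 : inL2 (fun=> 0).
Proof. by apply/inL2P; split; exact: l20. Qed.

Lemma ipDl f g h : inL2 f -> inL2 g -> inL2 h ->
  ip (fun z => f z + g z) h = ip f h + ip g h.
Proof.
move=> lf lg lh; rewrite !ipE//; last exact: inL2D.
move: lf lg lh => /inL2P[f1 f2] /inL2P[g1 g2] /inL2P[h1 h2].
rewrite (_ : re (fun z => f z + g z) = fun z => re f z + re g z); last first.
  by apply/funext => z; exact: ReD.
rewrite (_ : im (fun z => f z + g z) = fun z => im f z + im g z); last first.
  by apply/funext => z; exact: ImD.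
by rewrite !JDl//; apply/eqP; rewrite eq_complex /=; apply/andP; split; apply/eqP; ring.
Qed.

Lemma ipZl c f h : inL2 f -> inL2 h -> ip (fun z => c * f z) h = c * ip f h.
Proof.
move=> lf lh; rewrite !ipE//; last exact: inL2Z.
move: lf lh => /inL2P[f1 f2] /inL2P[h1 h2].
rewrite (_ : re (fun z => c * f z) = fun z => Re c * re f z + - Im c * im f z); last first.
  by apply/funext => z; rewrite /re ReM mulNr.
rewrite (_ : im (fun z => c * f z) = fun z => Re c * im f z + Im c * re f z); last first.
  by apply/funext => z; rewrite /im ImM.
rewrite !JDl ?JZl//; try exact: l2Z.
by case: c => c d; apply/eqP; rewrite eq_complex /=; apply/andP; split; apply/eqP; ring.
Qed.

Lemma ipC f g : inL2 f -> inL2 g -> ip g f = conjc (ip f g).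
Proof.
move=> lf lg; rewrite !ipE//= ![J _ (re f)]JC ![J _ (im f)]JC.
by apply/eqP; rewrite eq_complex /=; apply/andP; split; apply/eqP; ring.
Qed.

Lemma ip_self f : inL2 f -> ip f f = (real_complex R (norm2 f)).
Proof. by move=> lf; rewrite ipE// [J (im f) (re f)]JC subrr. Qed.

Lemma norm2D f g : inL2 f -> inL2 g ->
  norm2 (fun z => f z + g z) = norm2 f + norm2 g + 2 * Re (ip f g).
Proof.
move=> lf lg; have lfg := inL2D lf lg.
have := ip_self lfg; rewrite ipDl// [ip f _]ipC// [ip g _]ipC// !ipDl//.
rewrite [ip g f]ipC// !ip_self// => /(congr1 Re) /=.
by case: (ip f g) => x y /= <-; ring.
Qed.

Lemma norm2Z c f : inL2 f -> norm2 (fun z => c * f z) = sqnorm c * norm2 f.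
Proof.
move=> lf; have lcf := inL2Z c lf.
have := ip_self lcf; rewrite ipZl// [ip f _]ipC// ipZl// ip_self// => /(congr1 Re) /=.
by case: c {lcf} => x y /= <-; rewrite /sqnorm /=; ring.
Qed.

Lemma norm2_add_unit f e c : inL2 f -> inL2 e -> ip e e = 1 ->
  norm2 (fun z => f z + c * e z) = norm2 f + sqnorm c + 2 * Re (ip f e * conjc c).
Proof.
move=> lf le e1; have e1' : norm2 e = 1 by have := ip_self le; rewrite e1 => /(congr1 Re).
rewrite norm2D//; last exact: inL2Z.
rewrite norm2Z// e1' mulr1 [ip f _]ipC//; last exact: inL2Z.
rewrite ipZl// [ip e f]ipC//; congr (_ + _ * _).
by case: c => x y; case: (ip f e) => a b /=; ring.
Qed.

(** Real and imaginary part are each a sum of two real products, bounded through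
    [(x + y)^2 <= 2 (x^2 + y^2)]. The factor 2 does no harm, as the bound serves to show that a
    quantity vanishes. *)
Lemma ip_CS f g : inL2 f -> inL2 g ->
  Re (ip f g) ^+ 2 <= 2 * (norm2 f * norm2 g) /\ Im (ip f g) ^+ 2 <= 2 * (norm2 f * norm2 g).
Proof.
move=> lf lg; rewrite ipE//=.
move: lf lg => /inL2P[f1 f2] /inL2P[g1 g2]; rewrite /norm2.
have A (x y a b c d : R) : 0 <= a -> 0 <= b -> 0 <= c -> 0 <= d ->
    x ^+ 2 <= a * c -> y ^+ 2 <= b * d ->
    (x + y) ^+ 2 <= 2 * ((a + b) * (c + d)).
  move=> a0 b0 c0 d0 xa yb; have := sqr_ge0 (x - y).
  have := mulr_ge0 a0 d0; have := mulr_ge0 b0 c0; nra.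
split; first by apply: A; rewrite ?J_ge0//; exact: J_CS.
rewrite [J (re f) (re f) + _]addrC; apply: A; rewrite ?J_ge0 ?sqrrN//; exact: J_CS.
Qed.

Definition comb (a : nat -> R[i]) (e : nat -> R * R -> R[i]) (K : nat) : R * R -> R[i] :=
  fun z => \sum_(k < K) a k * e k z.

Lemma combS (a : nat -> R[i]) (e : nat -> R * R -> R[i]) K :
  comb a e K.+1 = fun z => comb a e K z + a K * e K z.
Proof. by apply/funext => z; rewrite /comb big_ord_recr. Qed.

Lemma comb0 (a : nat -> R[i]) (e : nat -> R * R -> R[i]) : comb a e 0 = fun=> 0.
Proof. by apply/funext => z; rewrite /comb big_ord0. Qed.

Lemma inL2_comb (a : nat -> R[i]) (e : nat -> R * R -> R[i]) K :
  (forall k, inL2 (e k)) -> inL2 (comb a e K).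
Proof.
move=> le; elim: K => [|K IHK]; first by rewrite comb0; exact: inL20.
by rewrite combS; apply: inL2D => //; exact: inL2Z.
Qed.

Lemma ip_comb (a : nat -> R[i]) (e : nat -> R * R -> R[i]) K g : (forall k, inL2 (e k)) ->
  inL2 g -> ip (comb a e K) g = \sum_(k < K) a k * ip (e k) g.
Proof.
move=> le lg; elim: K => [|K IHK].
  rewrite comb0 big_ord0 ipE//; last exact: inL20.
  have J0 q : l2 q -> J (fun=> 0) q = 0.
    by move=> lq; rewrite -[RHS]rint0; apply: eq_rint => z; rewrite !mul0r.
  by move/inL2P: lg => -[g1 g2]; rewrite !J0// addr0 subrr.
rewrite combS big_ord_recr /= ipDl//; [|exact: inL2_comb|exact: inL2Z].
by rewrite IHK ipZl.
Qed.

Section orthonormal.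
Context {e : nat -> R * R -> R[i]}.
Hypotheses (le : forall k, inL2 (e k)) (oe : forall j k, ip (e j) (e k) = (j == k)%:R).

Lemma ip_comb_orth (a : nat -> R[i]) K j : ip (comb a e K) (e j) = if (j < K)%N then a j else 0.
Proof.
rewrite ip_comb//; case: ifPn => [jK|jK].
  rewrite (bigD1 (Ordinal jK))//= oe eqxx mulr1 big1 ?addr0// => k kj.
  by rewrite oe (_ : (k == j :> nat) = false) ?mulr0//; apply/negbTE; apply: contra kj => /eqP kj; exact/eqP/val_inj.
rewrite big1// => k _; rewrite oe (_ : (k == j :> nat) = false) ?mulr0//.
by apply/negbTE; apply: contra jK => /eqP <-.
Qed.

Lemma norm2_comb (a : nat -> R[i]) K : norm2 (comb a e K) = \sum_(k < K) sqnorm (a k).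
Proof.
elim: K => [|K IHK].
  rewrite comb0 big_ord0 /norm2 /J; rewrite !(eq_rint (g := fun=> 0)) ?rint0 ?addr0// => z;
  by rewrite !mul0r.
rewrite combS norm2_add_unit//; [|exact: inL2_comb|by rewrite oe eqxx].
by rewrite ip_comb_orth ltnn mul0r /= mulr0 addr0 IHK big_ord_recr.
Qed.

Lemma bessel_eq g K : inL2 g ->
  norm2 (fun z => g z - comb (fun k => ip g (e k)) e K z) =
  norm2 g - \sum_(k < K) sqnorm (ip g (e k)).
Proof.
move=> lg; set a := fun k => ip g (e k).
have lc K' : inL2 (fun z => g z - comb a e K' z).
  have := inL2D lg (inL2Z (-1) (inL2_comb a K' le)).
  by under eq_fun do rewrite mulN1r.
elim: K => [|K IHK].
  by rewrite big_ord0 subr0 comb0; congr norm2; apply/funext => z; rewrite subr0.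
have -> : (fun z => g z - comb a e K.+1 z) = (fun z => (g z - comb a e K z) + (- a K) * e K z).
  by apply/funext => z; rewrite combS mulNr opprD addrA.
rewrite norm2_add_unit//; last by rewrite oe eqxx.
have -> : ip (fun z => g z - comb a e K z) (e K) = a K.
  under eq_fun do rewrite -mulN1r.
  rewrite ipDl//; last by apply: inL2Z; exact: inL2_comb.
  rewrite ipZl//; last exact: inL2_comb.
  by rewrite ip_comb_orth ltnn mulr0 addr0.
have X c (s n : R) : n - s + sqnorm (- c) + 2 * Re (c * conjc (- c)) = n - (s + sqnorm c).
  by case: c => x y; rewrite /sqnorm /=; ring.
by rewrite IHK X big_ord_recr.
Qed.

Lemma bessel_le g K : inL2 g -> \sum_(k < K) sqnorm (ip g (e k)) <= norm2 g.
Proof. by move=> lg; rewrite -subr_ge0 -bessel_eq// norm2_ge0. Qed.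

End orthonormal.

End complex_L2.

(** * Parseval's identity *)

Section entire_algebra.
Context {R : realType}.
Implicit Types f g : R[i] -> R[i].

Lemma entireD f g : entire f -> entire g -> entire (fun z => f z + g z).
Proof. by move=> fE gE z; exact: (derivableD (fE z) (gE z)). Qed.

Lemma entireM f g : entire f -> entire g -> entire (fun z => f z * g z).
Proof. by move=> fE gE z; exact: (@derivableM R[i] R[i]^o f g z 1 (fE z) (gE z)). Qed.

Lemma entireV f : entire f -> (forall z, f z != 0) -> entire (fun z => (f z)^-1).
Proof. by move=> fE f0 z; exact: (@derivableV R[i] R[i]^o f z 1 (f0 z) (fE z)). Qed.

Lemma entire_id : entire (id : R[i] -> R[i]).
Proof. by move=> z; exact: derivable_id. Qed.

Lemma entireX n : entire (fun z : R[i] => z ^+ n).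
Proof.
elim: n => [|n IHn]; first exact: entire_cst.
by under eq_fun do rewrite exprS; exact: entireM entire_id IHn.
Qed.

Lemma entire_sum (F : nat -> R[i] -> R[i]) K : (forall k, entire (F k)) ->
  entire (fun z => \sum_(k < K) F k z).
Proof.
move=> FE; elim: K => [|K IHK].
  by under eq_fun do rewrite big_ord0; exact: entire_cst.
rewrite (_ : (fun z => \sum_(k < K.+1) F k z) = (fun z => \sum_(k < K) F k z + F K z)).
  exact: (entireD IHK (FE K)).
by apply/funext => z; rewrite big_ord_recr.
Qed.

End entire_algebra.

Lemma seq_limit_unique {R : realType} (u : nat -> R) (x y : R) :
  (u @ \oo --> x -> u @ \oo --> y -> x = y)%classic.
Proof. by move=> /(cvg_lim (@Rhausdorff R)) <- /(cvg_lim (@Rhausdorff R)) <-. Qed.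

Lemma sqr_dominated_cvg {R : realType} (u t : nat -> R) (l c : R) :
  (t @ \oo --> (0 : R))%classic -> (forall K, (l - u K) ^+ 2 <= c * t K) ->
  (u @ \oo --> l)%classic.
Proof.
move=> t0 uc; have ct : ((fun K => c * t K) @ \oo --> (0 : R))%classic.
  by rewrite -[0](mulr0 c); exact: cvgMr.
apply/cvgrPdist_lt => d d0; near=> K.
rewrite -(@ltr_pXn2r _ 2%N)// ?nnegrE ?(ltW d0)// real_normK ?num_real//.
apply: le_lt_trans (uc K) _; near: K.
exact: (cvgr_lt _ ct _ (exprn_gt0 2 d0)).
Unshelve. all: end_near. Qed.

Section parseval.
Context {R : realType} (m : R) (hm : 0 <= m).
Local Notation mu := (@leb2 R).
Local Notation ig f := (mu.-integrable setT (EFin \o f)).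
Local Notation rint := (Rintegral mu setT).
Local Notation Re := (@complex.Re R).
Local Notation Im := (@complex.Im R).
Local Notation W := (weight m).
Local Notation J := (J m).
Local Notation l2 := (l2 m).
Local Notation inL2 := (inL2 m).
Local Notation ip := (ip m).
Local Notation norm2 := (norm2 m).

(** Representing functions: on entire functions, [kq w] gives the value at [w] times [kappa w]. The
    other two give the partial derivatives of the kernel, on which the weak Cauchy-Riemann equations
    are tested. *)
Definition kq (w z : R * R) : R := kern (sqd w z) / W z.
Definition kqx (w z : R * R) : R := kern' (sqd w z) * (2 * (z.1 - w.1)) / W z.
Definition kqy (w z : R * R) : R := kern' (sqd w z) * (2 * (z.2 - w.2)) / W z.

Lemma l2_kq w : [/\ l2 (kq w), l2 (kqx w) & l2 (kqy w)].
Proof.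
have [[_ _ c0 cx cy] _] := C1c_kern w.
by split; apply: (continuous_compact_support_l2 hm (r := `|w| + 6)) => // z /kern_support[k0 k0']; rewrite ?k0 ?k0' ?mul0r.
Qed.

Lemma l2_ig_div (p q : R * R -> R) : l2 p -> l2 (fun z => q z / W z) -> ig (fun z => p z * q z).
Proof.
move=> lp lq; apply: ig_eq (l2_ig lp lq) => z.
by field; rewrite gt_eqF// weight_gt0.
Qed.

Context {e : nat -> R[i] -> R[i]}.
Hypotheses (eA : forall k, inA2 m (e k)).
Hypothesis oe : forall j k, ip (e j \o toC) (e k \o toC) = (j == k)%:R.
Let E k := e k \o toC.
Let lE k : inL2 (E k). Proof. by have [] := eA k. Qed.

Context (a : nat -> R[i]).
Let g K := comb a E K.
Let s K : R := \sum_(k < K) sqnorm (a k).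

Lemma entire_comb K : exists2 f, entire f & g K = f \o toC.
Proof.
exists (fun z => \sum_(k < K) a k * e k z) => //.
apply: (@entire_sum _ (fun k z => a k * e k z)) => k; apply: entireM; first exact: entire_cst.
by have [] := eA k.
Qed.

Lemma ReB (x y : R[i]) : Re (x - y) = Re x - Re y.
Proof. by case: x y => [? ?] [? ?]. Qed.

Lemma ImB (x y : R[i]) : Im (x - y) = Im x - Im y.
Proof. by case: x y => [? ?] [? ?]. Qed.

Let lg K : inL2 (g K). Proof. exact: inL2_comb. Qed.

Lemma inL2B (f h : R * R -> R[i]) : inL2 f -> inL2 h -> inL2 (fun z => f z - h z).
Proof. by move=> lf lh; under eq_fun do rewrite -mulN1r; exact: inL2D lf (inL2Z _ lh). Qed.

Lemma norm2_comb_sub K n : norm2 (fun z => g (K + n)%N z - g K z) = s (K + n)%N - s K.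
Proof.
elim: n => [|n IHn].
  rewrite addn0 subrr; under eq_fun do rewrite subrr.
  by rewrite /norm2 /J !(eq_rint (g := fun=> 0)) ?rint0 ?addr0// => z; rewrite !mul0r.
have -> : (fun z => g (K + n.+1)%N z - g K z) =
    (fun z => (g (K + n)%N z - g K z) + a (K + n)%N * E (K + n)%N z).
  by apply/funext => z; rewrite /g addnS combS addrAC.
rewrite norm2_add_unit//; [|exact: inL2B|by rewrite oe eqxx].
rewrite (_ : ip _ _ = 0); last first.
  under eq_fun do rewrite -mulN1r; rewrite ipDl//; last exact: inL2Z.
  by rewrite ipZl// !ip_comb_orth// ltnn ltnNge leq_addr/= mulr0 addr0.
by rewrite mul0r /= mulr0 addr0 IHn /s addnS big_ord_recr /= addrAC.
Qed.

Context (s_bounded : exists M : R, forall K, s K <= M).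

Let s_incr : {homo s : n p / (n <= p)%N >-> n <= p}.
Proof.
by apply/nondecreasing_seqP => n; rewrite /s big_ord_recr /= lerDl sqnorm_ge0.
Qed.

Let s_cvg : cvgn s.
Proof.
apply: nondecreasing_is_cvgn => //; have [M sM] := s_bounded.
by exists M => _ [n _ <-].
Qed.

Definition tail K : R := limn s - s K.

Lemma tail_cvg : (tail @ \oo --> (0 : R))%classic.
Proof. by rewrite -(subrr (limn s)); apply: cvgB => //; exact: cvg_cst. Qed.

Lemma tail_bound K n : norm2 (fun z => g (K + n)%N z - g K z) <= tail K.
Proof. by rewrite norm2_comb_sub lerB// nondecreasing_cvgn_le. Qed.

Lemma tail_small (c d : R) : 0 < d -> exists K, forall L, (K <= L)%N -> c * tail L < d.
Proof.
move=> d0; have : (fun K => c * tail K) @ \oo --> (0 : R).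
  by rewrite -[0](mulr0 c); apply: cvgMr; exact: tail_cvg.
move/cvgrPdist_lt => /(_ d d0)[K _ KP]; exists K => L /KP; rewrite sub0r normrN.
by apply: le_lt_trans; exact: ler_norm.
Qed.

Lemma tail_cauchy (u : nat -> R) (c : R) :
  (forall K n, (u (K + n)%N - u K) ^+ 2 <= c * tail K) -> cvgn u.
Proof.
move=> uc; apply/cauchy_cvgP; apply: cauchy_exP => d /= d0.
have [K KP] := tail_small c (exprn_gt0 2 d0); exists (u K), K => // L /= KL.
rewrite -ball_normE /= distrC -(@ltr_pXn2r _ 2%N)// ?nnegrE ?(ltW d0)//.
rewrite real_normK ?num_real// -(subnKC KL); apply: le_lt_trans (uc _ _) (KP _ _) => //.
Qed.

Lemma comb_value w K : kappa w * Re (g K w) = J (re (g K)) (kq w) /\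
  kappa w * Im (g K w) = J (im (g K)) (kq w).
Proof.
have [f fE ->] := entire_comb K; have [A B] := entire_mean w fE.
by split; [rewrite -[LHS]A|rewrite -[LHS]B]; rewrite -J_div.
Qed.

Lemma J_sub_bound (f h : R * R -> R[i]) q : inL2 f -> inL2 h -> l2 q ->
  (J (re f) q - J (re h) q) ^+ 2 <= norm2 (fun z => f z - h z) * J q q /\
  (J (im f) q - J (im h) q) ^+ 2 <= norm2 (fun z => f z - h z) * J q q.
Proof.
move=> lf lh lq; have /inL2P[d1 d2] := inL2B lf lh.
move: lf lh => /inL2P[f1 f2] /inL2P[h1 h2].
have reE : re (fun z => f z - h z) = fun z => re f z + -1 * re h z.
  by apply/funext => z; rewrite /re mulN1r; case: (f z) (h z) => [? ?] [? ?].
have imE : im (fun z => f z - h z) = fun z => im f z + -1 * im h z.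
  by apply/funext => z; rewrite /im mulN1r; case: (f z) (h z) => [? ?] [? ?].
split.
  have -> : J (re f) q - J (re h) q = J (re (fun z => f z - h z)) q.
    by rewrite reE JDl ?JZl ?mulN1r//; exact: l2Z.
  apply: (le_trans (J_CS d1 lq)); rewrite ler_wpM2r ?J_ge0// lerDl J_ge0//.
have -> : J (im f) q - J (im h) q = J (im (fun z => f z - h z)) q.
  by rewrite imE JDl ?JZl ?mulN1r//; exact: l2Z.
by apply: (le_trans (J_CS d2 lq)); rewrite ler_wpM2r ?J_ge0// lerDr J_ge0.
Qed.

(** By the mean value property the value at [w] is bounded by the norm, so partial sums that are
    Cauchy in norm are Cauchy at every point. *)
Lemma comb_cvg w : cvgn (fun K => Re (g K w)) /\ cvgn (fun K => Im (g K w)).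
Proof.
have [lq _ _] := l2_kq w; have k0 := kappa_gt0 w.
have H (u v : nat -> R) : (forall K, kappa w * u K = v K) ->
   (forall K n, (v (K + n)%N - v K) ^+ 2 <= tail K * J (kq w) (kq w)) -> cvgn u.
  move=> uv vc; apply: (@tail_cauchy _ (J (kq w) (kq w) / kappa w ^+ 2)) => K n.
  rewrite mulrAC ler_pdivlMr ?exprn_gt0// mulrC -exprMn mulrBr !uv [_ * tail _]mulrC.
  exact: vc.
split; [apply: (H (fun K => Re (g K w)) (fun K => J (re (g K)) (kq w)))
       |apply: (H (fun K => Im (g K w)) (fun K => J (im (g K)) (kq w)))].
- by move=> K; have [] := comb_value w K.
- move=> K n; have [+ _] := J_sub_bound (lg (K + n)) (lg K) lq.
  by move/le_trans; apply; rewrite ler_wpM2r ?J_ge0// tail_bound.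
- by move=> K; have [] := comb_value w K.
- move=> K n; have [_ +] := J_sub_bound (lg (K + n)) (lg K) lq.
  by move/le_trans; apply; rewrite ler_wpM2r ?J_ge0// tail_bound.
Qed.

Definition limC (w : R * R) : R[i] :=
  (limn (fun K => Re (g K w)) +i* limn (fun K => Im (g K w)))%C.

Lemma measurable_limC : measurable_fun setT (re limC) /\ measurable_fun setT (im limC).
Proof.
split; [apply: (measurable_fun_cvg (h := fun K => re (g K)))
       |apply: (measurable_fun_cvg (h := fun K => im (g K)))].
- by move=> K; have /inL2P[[]] := lg K.
- by move=> w _; have [] := comb_cvg w.
- by move=> K; have /inL2P[_ []] := lg K.
- by move=> w _; have [] := comb_cvg w.
Qed.

Lemma limC_cvg K z : (fun n => sqnorm (g (K + n)%N z - g K z) * W z) @ \oo --> sqnorm (limC z - g K z) * W z.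
Proof.
have H (v : nat -> R) : cvgn v -> (fun n => (v (K + n)%N - v K) ^+ 2) @ \oo --> (limn v - v K) ^+ 2.
  move=> cv; rewrite expr2; under eq_fun do rewrite expr2.
  have c1 : (fun n => v (K + n)%N - v K) @ \oo --> limn v - v K.
    apply: cvgB; last exact: cvg_cst.
    rewrite (_ : (fun n => v (K + n)%N) = (fun n => v (n + K)%N)); last first.
      by apply/funext => n; rewrite addnC.
    by rewrite cvg_shiftn.
  exact: cvgM.
have [c1 c2] := comb_cvg z.
rewrite (_ : (fun n => _) = fun n => ((Re (g (K + n)%N z) - Re (g K z)) ^+ 2 +
   (Im (g (K + n)%N z) - Im (g K z)) ^+ 2) * W z).
  rewrite /sqnorm ReB ImB; apply: cvgM; last exact: cvg_cst.
  by apply: cvgD; [exact: H c1|exact: H c2].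
by apply/funext => n; rewrite /sqnorm ReB ImB.
Qed.

(** The limit is defined pointwise, so that norm convergence follows from Fatou's lemma: the
    distance of two partial sums is at most a tail of the coefficient series, and this bound passes
    to the limit. *)
Lemma limC_fatou K : (L2norm2 m (fun z => (limC z - g K z)%R) <= (tail K)%:E)%E.
Proof.
pose F n z := (sqnorm (g (K + n)%N z - g K z) * W z)%:E.
have mF n : measurable_fun setT (F n).
  apply/measurable_EFinP; apply: measurable_funM; last exact: measurable_weight.
  by have [m1 m2 _] := inL2B (lg (K + n)) (lg K); apply: measurable_funD; exact: measurable_funX.
have F0 n z : setT z -> (0 <= F n z)%E.
  by move=> _; rewrite lee_fin mulr_ge0 ?sqnorm_ge0 ?weight_ge0.
have := fatou mu measurableT mF F0.
rewrite (_ : integral _ _ _ = L2norm2 m (fun z => (limC z - g K z)%R)).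
  move/le_trans; apply.
  have cF : (fun n => \int[mu]_z F n z)%E @ \oo --> (tail K)%:E.
    rewrite (_ : (fun n => _) = fun n => (s (n + K)%N - s K)%:E).
      apply: cvg_EFin; first exact: nearW.
      by apply: cvgB; [rewrite cvg_shiftn|exact: cvg_cst].
    apply/funext => n; rewrite -/(L2norm2 m (fun z => (g (K + n)%N z - g K z)%R)) L2norm2E.
      by rewrite norm2_comb_sub addnC.
    exact: inL2B.
  by rewrite (cvg_limn_einf_sup cF).1.
apply: eq_integral => z _; apply: (@cvg_limn_einf_sup _ _ _ _).1.
by apply: cvg_EFin; [exact: nearW|exact: limC_cvg].
Qed.

Lemma inL2_limC K : inL2 limC /\ norm2 (fun z => limC z - g K z) <= tail K.
Proof.
have [m1 m2] := measurable_limC.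
have lB : inL2 (fun z => limC z - g K z).
  split; [| |exact: le_lt_trans (limC_fatou K) (ltry _)].
  - by under eq_fun do rewrite ReB; apply: measurable_funB => //; have [] := lg K.
  - by under eq_fun do rewrite ImB; apply: measurable_funB => //; have [] := lg K.
split; last by rewrite -lee_fin -L2norm2E// limC_fatou.
by have := inL2D lB (lg K); under eq_fun do rewrite subrK.
Qed.

Lemma J_limC q : l2 q -> (fun K => J (re (g K)) q) @ \oo --> J (re limC) q /\
  (fun K => J (im (g K)) q) @ \oo --> J (im limC) q.
Proof.
move=> lq.
have B K : norm2 (fun z => limC z - g K z) * J q q <= J q q * tail K.
  by rewrite mulrC ler_wpM2l ?J_ge0//; have [] := inL2_limC K.
by split; apply: sqr_dominated_cvg tail_cvg _ => K; apply: le_trans (B K); have [l _] := inL2_limC K;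
  have [] := J_sub_bound l (lg K) lq.
Qed.

Lemma limC_value w : kappa w * Re (limC w) = J (re limC) (kq w) /\
  kappa w * Im (limC w) = J (im limC) (kq w).
Proof.
have [lq _ _] := l2_kq w; have [j1 j2] := J_limC lq; have [c1 c2] := comb_cvg w.
split.
  apply: seq_limit_unique j1; under eq_fun do rewrite -(comb_value w _).1.
  exact: cvgMr.
apply: seq_limit_unique j2; under eq_fun do rewrite -(comb_value w _).2.
exact: cvgMr.
Qed.

(** Both sides are continuous in the norm, so the equations pass from the partial sums to the limit.
    Only the gradients of the kernels are tested, which is all that [kern_transform_derivable]
    asks. *)
Lemma limC_dbar w : J (re limC) (kqx w) = J (im limC) (kqy w) /\
  J (im limC) (kqx w) = - J (re limC) (kqy w).
Proof.
have [_ lx ly] := l2_kq w; have [x1 x2] := J_limC lx; have [y1 y2] := J_limC ly.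
have K12 K : J (re (g K)) (kqx w) = J (im (g K)) (kqy w) /\
    J (im (g K)) (kqx w) = - J (re (g K)) (kqy w).
  have [f fE gE] := entire_comb K; have [A B] := entire_weak_dbar fE (C1c_kern w).
  have /inL2P[lr li] := lg K.
  have i1 := l2_ig_div lr lx; have i2 := l2_ig_div li ly.
  have i3 := l2_ig_div li lx; have i4 := l2_ig_div lr ly.
  rewrite -!J_div; split.
    by apply/eqP; rewrite -subr_eq0 -rintB//; apply/eqP; rewrite gE; exact: A.
  by apply/eqP; rewrite -addr_eq0 -rintD//; apply/eqP; rewrite gE; exact: B.
split.
  by apply: seq_limit_unique x1 _; under eq_fun do rewrite (K12 _).1.
by apply: seq_limit_unique x2 _; under eq_fun do rewrite (K12 _).2; exact: cvgN.
Qed.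

(* The limit inherits the mean value property, hence the regularity of [kern]. *)
Lemma limC_entire : exists2 h, entire h & limC = h \o toC.
Proof.
have [/inL2P[l1 l2'] _] := inL2_limC 0.
have TE : entire (fun c : R[i] =>
   ((rint (fun z => re limC z * kern (sqd (Re c, Im c) z))) +i*
     (rint (fun z => im limC z * kern (sqd (Re c, Im c) z))))%C).
  apply: kern_transform_derivable => [| |w]; [exact: (l2_loc_int hm)|exact: (l2_loc_int hm)|].
  by rewrite !(J_div m); exact: limC_dbar.
(* The case [h1 = 1], [h2 = 0] shows that [kappa] is itself entire. It is positive, so [limC] is the
   quotient of two entire functions with a denominator that never vanishes. *)
have kE : entire (fun c : R[i] =>
   ((rint (fun z => 1 * kern (sqd (Re c, Im c) z))) +i*
     (rint (fun z => 0 * kern (sqd (Re c, Im c) z))))%C).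
  apply: kern_transform_derivable => [| |w].
  - apply: continuous_loc_int; exact: continuous_one.
  - by apply: continuous_loc_int => z; exact: cvg_cst.
  - have Z (q : R * R -> R) : rint (fun z => 0 * q z) = 0.
      by rewrite -[RHS]rint0; apply: eq_rint => z; rewrite mul0r.
    have I (q : R * R -> R) : rint (fun z => 1 * q z) = rint q.
      by apply: eq_rint => z; rewrite mul1r.
    rewrite !Z !I; split; first exact: (C1c_integral_x (C1c_kern w)).
    by apply/esym/eqP; rewrite oppr_eq0; apply/eqP; exact: (C1c_integral_y (C1c_kern w)).
have kappaE (c : R[i]) : ((rint (fun z => 1 * kern (sqd (Re c, Im c) z))) +i*
     (rint (fun z => 0 * kern (sqd (Re c, Im c) z))))%C = ((kappa (Re c, Im c)) +i* 0)%C.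
  congr (_ +i* _)%C; first by apply: eq_rint => z; rewrite mul1r.
  by rewrite -[RHS]rint0; apply: eq_rint => z; rewrite mul0r.
have k0 (c : R[i]) : ((rint (fun z => 1 * kern (sqd (Re c, Im c) z))) +i*
     (rint (fun z => 0 * kern (sqd (Re c, Im c) z))))%C != 0.
  by rewrite kappaE eq_complex /= negb_and gt_eqF ?kappa_gt0.
have X (l : R[i]) (k p q : R) : k * Re l = p -> k * Im l = q -> l * (k +i* 0)%C = (p +i* q)%C.
  by move=> <- <-; case: l => u v; apply/eqP; rewrite eq_complex /=; apply/andP; split; apply/eqP; ring.
have := entireM TE (entireV kE k0) => hE.
eexists; first exact: hE.
apply/funext => -[x y]; apply: (canRL (mulfK (k0 (toC (x, y))))).
rewrite kappaE; have [v1 v2] := limC_value (x, y).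
apply: X; rewrite (J_div m); [exact: v1|exact: v2].
Qed.

Lemma ip_limC k : ip limC (E k) = a k.
Proof.
have [ll _] := inL2_limC 0.
pose D K := (fun z => limC z - g K z).
have lD K : inL2 (D K) by exact: inL2B.
have e1 : norm2 (E k) = 1.
  by have := ip_self (lE k); rewrite oe eqxx => /(congr1 Re).
have DE K : (k < K)%N -> ip (D K) (E k) = ip limC (E k) - a k.
  move=> kK; rewrite /D; under eq_fun do rewrite -mulN1r.
  by rewrite ipDl//; [rewrite ipZl// ip_comb_orth// kK mulN1r|exact: inL2Z].
have H (x : R) : (forall K, (k < K)%N -> x ^+ 2 <= 2 * tail K) -> x = 0.
  move=> xt; apply/eqP; rewrite -sqrf_eq0; apply/negPn/negP => x0.
  have x2 : 0 < x ^+ 2 by rewrite lt_def x0 sqr_ge0.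
  have [K KP] := tail_small 2 x2.
  have := KP (maxn K k.+1) (leq_maxl _ _); have := xt (maxn K k.+1) (leq_maxr _ _).
  by move=> A B; have := le_lt_trans A B; rewrite ltxx.
have B K : 2 * (norm2 (D K) * norm2 (E k)) <= 2 * tail K.
  by rewrite e1 mulr1 ler_pM2l//; have [] := inL2_limC K.
have r0 : Re (ip limC (E k) - a k) = 0.
  by apply: H => K /DE <-; apply: le_trans (B K); have [] := ip_CS (lD K) (lE k).
have i0 : Im (ip limC (E k) - a k) = 0.
  by apply: H => K /DE <-; apply: le_trans (B K); have [] := ip_CS (lD K) (lE k).
apply/eqP; rewrite -subr_eq0; move: r0 i0; case: (_ - _) => u v /= -> ->.
by rewrite eqxx.
Qed.

End parseval.

(** The sum of the expansion is an entire function in [A^2] with the same coefficients as [h], so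
    completeness makes it equal to [h]; the error is then bounded by the tail of the coefficient
    series. *)
Lemma parseval {R : realType} (m : R) (hm : 0 <= m) (e : nat -> R[i] -> R[i]) (h : R[i] -> R[i]) :
  A2_onb m e -> inA2 m h ->
  (fun K => norm2 m (fun z => h (toC z) -
     comb (fun k => ip m (h \o toC) (e k \o toC)) (fun k => e k \o toC) K z)) @ \oo --> (0 : R).
Proof.
move=> [eA oe cpl] [hE lh].
have le k : inL2 m (e k \o toC) by have [] := eA k.
pose a := fun k => ip m (h \o toC) (e k \o toC).
have bd : exists M : R, forall K, \sum_(k < K) sqnorm (a k) <= M.
  by exists (norm2 m (h \o toC)) => K; exact: (bessel_le le oe).
have [f fE lf] := limC_entire hm eA oe bd.
have [ll _] := inL2_limC hm eA oe bd 0.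
have hf : forall w, h w - f w = 0.
  apply: cpl.
    split.
      have cE : entire (fun=> -1 : R[i]) by exact: entire_cst.
      have := entireD hE (entireM cE fE).
      by under eq_fun do rewrite mulN1r.
    by have := inL2B lh ll; rewrite lf.
  move=> k; have := ip_limC hm eA oe bd k; rewrite lf => akE.
  rewrite (_ : (fun w => h w - f w) \o toC = fun z => (h \o toC) z + -1 * (f \o toC) z).
    rewrite ipDl//; [|rewrite -lf; exact: inL2Z].
    by rewrite ipZl -?lf// lf akE mulN1r subrr.
  by apply/funext => z; rewrite mulN1r.
have hl : h \o toC = @limC R e a.
  by rewrite lf; apply/funext => z; apply/eqP; rewrite -subr_eq0 /= hf.
apply: (squeeze_cvgr (f := fun=> 0) (h := @tail R a)).
- near=> K; rewrite norm2_ge0/=; have [_] := inL2_limC hm eA oe bd K.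
  by rewrite -hl.
- exact: cvg_cst.
- exact: tail_cvg.
Unshelve. all: end_near. Qed.

(** * Smooth test functions *)

Section flat_functions.
Context {R : realType}.

(** All derivatives of [exp (- 1 / x)] are combinations of these functions; the index [k] closes the
    family under differentiation. *)
Definition flat (k : nat) (x : R) : R := if 0 < x then x^-1 ^+ k * expR (- x^-1) else 0.

Lemma flat_ge0 k x : 0 <= flat k x.
Proof.
by rewrite /flat; case: ifPn => // x0; rewrite mulr_ge0 ?expR_ge0// exprn_ge0// invr_ge0 ltW.
Qed.

Lemma flat_le0 k x : x <= 0 -> flat k x = 0.
Proof. by rewrite /flat ltNge => ->. Qed.

Lemma flat_le k x : flat k x <= k`!%:R.
Proof.
rewrite /flat; case: ifPn => // x0; have y0 : 0 <= x^-1 by rewrite invr_ge0 ltW.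
rewrite expRN ler_pdivrMr ?expR_gt0//.
case: k => [|k]; first by rewrite expr0 fact0 mul1r; have := expR_ge1Dx (x^-1); lra.
have := expR_ge1Dxn k y0; have f0 : (0 : R) < (k.+1)`!%:R by rewrite ltr0n fact_gt0.
move=> H; rewrite mulrC -ler_pdivrMr//; apply: le_trans H; lra.
Qed.

Lemma flat_shift k x : flat k x = x * flat k.+1 x.
Proof.
rewrite /flat; case: ifPn => x0; last by rewrite mulr0.
by rewrite exprS; field; rewrite gt_eqF.
Qed.

Lemma quadratic_is_derive0 (f : R -> R) (C : R) : (forall h, `|f h| <= C * h ^+ 2) ->
  is_derive (0 : R) (1 : R) f 0.
Proof.
move=> fC; have f0 : f 0 = 0.
  by apply/normr0_eq0/eqP; rewrite eq_le normr_ge0 andbT; have := fC 0; rewrite expr0n/= mulr0.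
have cf : (h^-1 *: (f (h *: 1 + 0) - f 0) @[h --> (0 : R)^'] --> (0 : R))%classic.
  apply/cvgrPdist_le => e e0; near=> h.
  rewrite sub0r normrN f0 subr0 addr0 scaleR1 normrM normfV.
  have h0 : 0 < `|h| by rewrite normr_gt0; near: h; exact: nbhs_dnbhs_neq.
  rewrite ler_pdivrMl// (le_trans (fC h))// -(real_normK (num_real h)) expr2 mulrA [leRHS]mulrC.
  rewrite ler_pM2r//; have hs : `|h| <= e / (`|C| + 1).
    near: h; apply: dnbhs0_le; rewrite divr_gt0//; have := normr_ge0 C; lra.
  have C0 := normr_ge0 C; apply: (le_trans (y := (`|C| + 1) * `|h|)).
    by rewrite ler_wpM2r ?ltW//; have := ler_norm C; lra.
  by rewrite mulrC -ler_pdivlMr//; lra.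
by apply: DeriveDef; [apply/cvg_ex; exists 0|exact: cvg_lim cf].
Unshelve. all: end_near. Qed.

Lemma is_derive_flat k (x : R) : is_derive x (1 : R) (flat k) (- k%:R * flat k.+1 x + flat k.+2 x).
Proof.
have [x0|x0|->] := ltgtP x 0.
- rewrite !flat_le0 ?ltW// mulr0 addr0.
  apply: near_eq_is_derive (is_derive_cst (0 : R) x (1 : R)).
  by near=> y; rewrite flat_le0//; apply/ltW; near: y; exact: lt_nbhsl.
- apply: (near_eq_is_derive (f := fun y => y^-1 ^+ k * expR (- y^-1))).
    near=> y; rewrite /flat ifT//; near: y; exact: lt_nbhsr.
  have xn0 : x != 0 by rewrite gt_eqF.
  have dV := is_deriveV xn0 (is_derive_id x (1 : R)).
  have dE := @is_derive1_comp _ expR (fun y => - y^-1) x _ _ (is_derive_expR (- x^-1)) (is_deriveN dV).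
  have dX i : is_derive x (1 : R) (fun y => y^-1 ^+ i) (- i%:R * x^-1 ^+ i.+1).
    elim: i => [|i IHi]; first by rewrite oppr0 mul0r; exact: is_derive_cst.
    rewrite (_ : (fun y => y^-1 ^+ i.+1) = (fun y => y^-1 * y^-1 ^+ i)); last first.
      by apply/funext => y; rewrite exprS.
    have := is_deriveM dV IHi; congr is_derive.
    by rewrite /GRing.scale/= !exprS -natr1; move: (x^-1 ^+ i) => a; field.
  have := is_deriveM (dX k) dE; congr is_derive.
  rewrite /flat x0 /GRing.scale/= !exprS.
  by move: (expR _) (x^-1 ^+ k) => a b; field.
- rewrite !flat_le0// mulr0 addr0.
  (* At 0, [flat k h = h^2 * flat k.+2 h], and the last factor is at most [(k + 2)!]. *)
  apply: (quadratic_is_derive0 (C := (k.+2)`!%:R)) => h.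
  rewrite ger0_norm ?flat_ge0// flat_shift flat_shift mulrA -expr2 mulrC.
  by rewrite ler_wpM2r ?sqr_ge0// flat_le.
Unshelve. all: end_near. Qed.

(** A syntactic class closed under differentiation, so that derivatives of every order come from one
    induction. Only values on [x > 0] count, which is the purpose of [hs_eq]. *)
Inductive halfline_smooth : (R -> R) -> Prop :=
| hs_cst a : halfline_smooth (fun=> a)
| hs_inv : halfline_smooth (fun x => x^-1)
| hs_ln : halfline_smooth (@ln R)
| hs_flat k a b : halfline_smooth (fun x => flat k (a * x + b))
| hs_exp f : halfline_smooth f -> halfline_smooth (fun x => expR (f x))
| hs_add f g : halfline_smooth f -> halfline_smooth g -> halfline_smooth (fun x => f x + g x)
| hs_mul f g : halfline_smooth f -> halfline_smooth g -> halfline_smooth (fun x => f x * g x)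
| hs_eq f g : halfline_smooth f -> (forall x, 0 < x -> f x = g x) -> halfline_smooth g.

Lemma halfline_smooth_derive f : halfline_smooth f ->
  exists2 g, halfline_smooth g & forall x : R, 0 < x -> is_derive x (1 : R) f (g x).
Proof.
elim=> {f} [a|||k a b|f fh [g gh fg]|f1 f2 h1 [g1 gh1 fg1] h2 [g2 gh2 fg2]
  |f1 f2 h1 [g1 gh1 fg1] h2 [g2 gh2 fg2]|f1 f2 h1 [g gh fg] E].
- by exists (fun=> 0) => [|x _]; [exact: hs_cst|exact: is_derive_cst].
- exists (fun x => -1 * (x^-1 * x^-1)).
    by apply: hs_mul; [exact: hs_cst|apply: hs_mul; exact: hs_inv].
  move=> x x0; have xn0 : x != 0 by rewrite gt_eqF.
  have := is_deriveV xn0 (is_derive_id x (1 : R)); congr is_derive.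
  by rewrite /GRing.scale/=; field.
- by exists (fun x => x^-1) => [|x x0]; [exact: hs_inv|exact: is_derive1_ln].
- exists (fun x => a * (- k%:R * flat k.+1 (a * x + b) + flat k.+2 (a * x + b))).
    apply: hs_mul; first exact: hs_cst.
    by apply: hs_add; [apply: hs_mul; [exact: hs_cst|exact: hs_flat]|exact: hs_flat].
  move=> x _; have dl : is_derive x (1 : R) (fun x => a * x + b) a.
    have := is_deriveD (is_deriveZ a (is_derive_id x (1 : R))) (is_derive_cst b x (1 : R)).
    by congr is_derive; rewrite /GRing.scale/= ?addr0 ?mulr1.
  have := @is_derive1_comp _ (flat k) (fun x => a * x + b) x _ _ (is_derive_flat k (a * x + b)) dl.
  by congr is_derive; rewrite mulrC.
- exists (fun x => expR (f x) * g x); first by apply: hs_mul => //; exact: hs_exp.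
  by move=> x x0; exact: (is_derive1_comp (is_derive_expR (f x)) (fg x x0)).
- exists (fun x => g1 x + g2 x); first exact: hs_add.
  by move=> x x0; exact: (is_deriveD (fg1 x x0) (fg2 x x0)).
- exists (fun x => f1 x * g2 x + f2 x * g1 x); first by apply: hs_add; exact: hs_mul.
  by move=> x x0; exact: (is_deriveM (fg1 x x0) (fg2 x x0)).
- exists g => // x x0; apply: near_eq_is_derive (fg x x0).
  by near=> y; apply: E; near: y; exact: lt_nbhsr.
Unshelve. all: end_near. Qed.

Definition sq (z : R * R) : R := z.1 ^+ 2 + z.2 ^+ 2.

Lemma sqE z : sqd (0, 0) z = sq z. Proof. by rewrite /sqd /= !subr0. Qed.

Lemma sq_ge0 z : 0 <= sq z. Proof. by rewrite addr_ge0 ?sqr_ge0. Qed.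

Lemma C1_sq : C1 sq (fun z => 2 * z.1) (fun z => 2 * z.2).
Proof. by apply: (C1_eq (C1_sqd (0, 0))) => z; rewrite ?sqE//= subr0. Qed.

Lemma is_derive_sq (z v : R * R) : is_derive z v sq (2 * v.1 * z.1 + 2 * v.2 * z.2).
Proof.
have X := is_derive_fst z v; have Y := is_derive_snd z v.
have := is_deriveD (is_deriveM X X) (is_deriveM Y Y); congr is_derive.
by rewrite /GRing.scale/=; ring.
Qed.

(** Radial profiles times polynomials in the coordinates, a class closed under directional
    derivatives. Vanishing below [d] hides the singularity that a profile may have at 0. *)
Inductive planar_smooth : (R * R -> R) -> Prop :=
| ps_radial f (d : R) : halfline_smooth f -> 0 < d -> (forall x, x < d -> f x = 0) ->
    planar_smooth (fun z => f (sq z))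
| ps_fst f : planar_smooth f -> planar_smooth (fun z => z.1 * f z)
| ps_snd f : planar_smooth f -> planar_smooth (fun z => z.2 * f z)
| ps_scale a f : planar_smooth f -> planar_smooth (fun z => a * f z)
| ps_add f g : planar_smooth f -> planar_smooth g -> planar_smooth (fun z => f z + g z).

Lemma planar_smooth_derive f : planar_smooth f -> continuous f /\
  forall v : R * R, exists2 g, planar_smooth g & forall z : R * R, is_derive z v f (g z).
Proof.
elim=> {f} [f d fh d0 fd|f fp [cf df]|f fp [cf df]|a f fp [cf df]|f1 f2 fp1 [cf1 df1] fp2 [cf2 df2]].
- have [g gh fg] := halfline_smooth_derive fh.
  pose g' x := if 0 < x then g x else 0.
  have g'h c : halfline_smooth (fun x => c * g' x).
    apply: hs_mul; first exact: hs_cst.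
    by apply: (hs_eq gh) => x; rewrite /g' => ->.
  have fg' x : is_derive x (1 : R) f (g' x).
    rewrite /g'; case: ifPn => [/fg//|]; rewrite -leNgt => x0.
    apply: near_eq_is_derive (is_derive_cst (0 : R) x (1 : R)).
    by near=> y; rewrite fd//; near: y; apply: lt_nbhsl; exact: le_lt_trans d0.
  have g'd x : x < d -> g' x = 0.
    move=> xd; have D1 := fg' x.
    have D2 : is_derive x (1 : R) f 0.
      apply: near_eq_is_derive (is_derive_cst (0 : R) x (1 : R)).
      by near=> y; rewrite fd//; near: y; exact: lt_nbhsl.
    by rewrite -(@derive_val _ _ _ _ _ _ _ D1) (@derive_val _ _ _ _ _ _ _ D2).
  have [_ _ csq _ _] := C1_sq.
  split; first by move=> z; apply: (cvg_comp sq f); [exact: csq|exact: is_derive1_cont (fg' _)].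
  move=> v; exists (fun z => z.1 * ((2 * v.1) * g' (sq z)) + z.2 * ((2 * v.2) * g' (sq z))).
    by apply: ps_add; [apply: ps_fst|apply: ps_snd]; apply: (ps_radial (g'h _) d0) => x xd;
      rewrite g'd// mulr0.
  move=> z; have := is_derive_comp_real (fg' (sq z)) (is_derive_sq z v).
  by congr is_derive; ring.
- split; first by move=> z; apply: cvgM; [exact: cvg_fst|exact: cf].
  move=> v; have [g gp fg] := df v.
  exists (fun z => z.1 * g z + v.1 * f z).
    by apply: ps_add; [exact: ps_fst|exact: ps_scale].
  move=> z; have := is_deriveM (is_derive_fst z v) (fg z).
  by congr is_derive; rewrite /GRing.scale/=; ring.
- split; first by move=> z; apply: cvgM; [exact: cvg_snd|exact: cf].
  move=> v; have [g gp fg] := df v.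
  exists (fun z => z.2 * g z + v.2 * f z).
    by apply: ps_add; [exact: ps_snd|exact: ps_scale].
  move=> z; have := is_deriveM (is_derive_snd z v) (fg z).
  by congr is_derive; rewrite /GRing.scale/=; ring.
- split; first by move=> z; apply: cvgM; [exact: cvg_cst|exact: cf].
  move=> v; have [g gp fg] := df v; exists (fun z => a * g z); first exact: ps_scale.
  by move=> z; exact: (is_deriveZ a (fg z)).
- split; first by move=> z; apply: cvgD; [exact: cf1|exact: cf2].
  move=> v; have [g1 gp1 fg1] := df1 v; have [g2 gp2 fg2] := df2 v.
  exists (fun z => g1 z + g2 z); first exact: ps_add.
  by move=> z; exact: (is_deriveD (fg1 z) (fg2 z)).
Unshelve. all: end_near. Qed.

Lemma planar_smooth_smooth f : planar_smooth f -> smooth f.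
Proof.
move=> fp l; have : planar_smooth (Defs.iterD l f).
  elim: l => [//|v l IHl] /=; have [_ /(_ v)[g gp D]] := planar_smooth_derive IHl.
  suff -> : 'D_v (Defs.iterD l f) = g by [].
  by apply/funext => z; have Dz := D z; exact: derive_val.
move=> /planar_smooth_derive[c D]; split=> // x v; have [g _ /(_ x) Dx] := D v.
exact: ex_derive.
Qed.

End flat_functions.

(** * Radial profiles and their integrals *)

Section radial_calculus.
Context {R : realType}.
Local Notation mu := (@leb2 R).
Local Notation ig f := (mu.-integrable setT (EFin \o f)).
Local Notation rint := (Rintegral mu setT).
Local Notation Re := (@complex.Re R).
Local Notation Im := (@complex.Im R).

Lemma hs_id : halfline_smooth (fun x : R => x).
Proof. by apply: (hs_eq (hs_exp (@hs_ln R))) => x x0; rewrite lnK. Qed.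

Lemma hs_pow n : halfline_smooth (fun x : R => x ^+ n).
Proof.
elim: n => [|n IHn]; first exact: hs_cst.
by apply: (hs_eq (hs_mul hs_id IHn)) => x _; rewrite exprS.
Qed.

Lemma hs_scale (a : R) f : halfline_smooth f -> halfline_smooth (fun x => a * f x).
Proof. exact/hs_mul/hs_cst. Qed.

Lemma hs_opp (f : R -> R) : halfline_smooth f -> halfline_smooth (fun x => - f x).
Proof. by move=> /(hs_scale (-1)) h; apply: (hs_eq h) => x _; rewrite mulN1r. Qed.

Lemma halfline_smooth_cont (f : R -> R) (d : R) : halfline_smooth f -> 0 < d ->
  (forall x, x < d -> f x = 0) -> continuous f.
Proof.
move=> /halfline_smooth_derive[g _ fg] d0 fd x.
have [xd|dx] := ltP x d; last exact: is_derive1_cont (fg x (lt_le_trans d0 dx)).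
rewrite /continuous_at fd//; apply: cvg_near_cst; near=> y; apply: fd.
by near: y; exact: lt_nbhsl.
Unshelve. all: end_near. Qed.

Lemma derive_extend0 (f f' : R -> R) (d : R) : 0 < d ->
  (forall x, x < d -> f x = 0 /\ f' x = 0) ->
  (forall x : R, 0 < x -> is_derive x (1 : R) f (f' x)) ->
  forall x : R, is_derive x (1 : R) f (f' x).
Proof.
move=> d0 fd D x; have [xd|dx] := ltP x d; last exact: D (lt_le_trans d0 dx).
rewrite (fd _ xd).2; apply: near_eq_is_derive (is_derive_cst (0 : R) x (1 : R)).
by near=> y; rewrite (fd y _).1//; near: y; exact: lt_nbhsl.
Unshelve. all: end_near. Qed.

Lemma is_derive_mul (f g : R -> R) (x a b : R) : is_derive x (1 : R) f a ->
  is_derive x (1 : R) g b -> is_derive x (1 : R) (fun y => f y * g y) (f x * b + g x * a).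
Proof. exact: is_deriveM. Qed.

(** The case of the constant function 1 in [entire_annular]; in polar coordinates the integral would
    be [pi] times the integral of [f']. *)
Lemma radial_integral0 (f f' : R -> R) (d T : R) : 0 < d -> halfline_smooth f' ->
  (forall x, x < d -> f x = 0 /\ f' x = 0) -> (forall x, T <= x -> f x = 0 /\ f' x = 0) ->
  (forall x : R, 0 < x -> is_derive x (1 : R) f (f' x)) ->
  ig (fun z => f' (sq z)) /\ rint (fun z => f' (sq z)) = 0.
Proof.
move=> d0 f'h fd fT D.
have c : continuous f' by apply: (halfline_smooth_cont f'h d0) => x /fd[].
have D' := derive_extend0 d0 fd D.
split.
  apply: (continuous_compact_support_integrable (r := `|(0, 0) : R * R| + `|T| + 1)).
    have -> : (fun z => f' (sq z)) = fun z => f' (sqd (0, 0) z).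
      by apply/funext => z; rewrite sqE.
    exact: continuous_radial.
  by move=> z zr; rewrite -sqE; have [_ ->] := fT _ (sqd_out zr).
have fe (x : R) : x <= d / 2 -> f x = 0 /\ f' x = 0 by move=> xd; apply: fd; lra.
have d2 : 0 < d / 2 by lra.
have oE : entire (fun=> 1 : R[i]) by exact: entire_cst.
have [+ _] := entire_annular D' c d2 fe (0, 0) oE fT.
by move=> <-; apply: eq_rint => z; rewrite sqE /reC /= mul1r.
Qed.

End radial_calculus.

(** * A cutoff to the annulus 1/r < |z|^2 < r *)

Section cutoff.
Context {R : realType} (r : R) (r0 : 0 < r).

(** The first factor removes [x <= 1 / r], the second [x >= r]. As [r] grows they tend to 1 and to
    [flat 0 1 = exp (-1)]; hence the limit of the cutoff is [exp (-1)] and not 1. *)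
Definition chi (x : R) : R := flat 0 (r * x + - 1) * flat 0 (- r^-1 * x + 1).
Definition chi' (x : R) : R := r * flat 2 (r * x + - 1) * flat 0 (- r^-1 * x + 1) +
  flat 0 (r * x + - 1) * (- r^-1 * flat 2 (- r^-1 * x + 1)).

Lemma hs_chi : halfline_smooth chi.
Proof. by apply: hs_mul; exact: hs_flat. Qed.

Lemma hs_chi' : halfline_smooth chi'.
Proof.
apply: hs_add; apply: hs_mul; try exact: hs_flat; apply: hs_scale; exact: hs_flat.
Qed.

Lemma is_derive_chi (x : R) : is_derive x (1 : R) chi (chi' x).
Proof.
have L (a b : R) k : is_derive x (1 : R) (fun x => flat k (a * x + b))
    ((- k%:R * flat k.+1 (a * x + b) + flat k.+2 (a * x + b)) * a).
  apply: (@is_derive1_comp _ (flat k) (fun x => a * x + b) x _ _ (is_derive_flat k (a * x + b))).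
  have := is_deriveD (is_deriveZ a (is_derive_id x (1 : R))) (is_derive_cst b x (1 : R)).
  by congr is_derive; rewrite /GRing.scale/= ?addr0 ?mulr1.
have := is_deriveM (L r (-1) 0) (L (- r^-1) 1 0); congr is_derive.
rewrite /GRing.scale/= /chi'.
by move: (flat _ _) (flat _ _) (flat _ _) (flat _ _) (flat _ _) (flat _ _) => *; ring.
Qed.

Lemma chi_ge0 x : 0 <= chi x. Proof. by rewrite mulr_ge0 ?flat_ge0. Qed.

Lemma flat0_le1 (x : R) : flat 0 x <= 1. Proof. exact: (flat_le 0 x). Qed.

Lemma chi_le1 x : chi x <= 1.
Proof. by rewrite -[leRHS]mulr1 ler_pM ?flat_ge0 ?flat0_le1. Qed.

Lemma chi_small x : x < r^-1 -> chi x = 0 /\ chi' x = 0.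
Proof.
move=> xr; have y0 : r * x + -1 <= 0.
  by have := ltW xr; rewrite -(ler_pM2l r0) mulfV ?gt_eqF//; lra.
by rewrite /chi /chi' !(flat_le0 _ y0) mulr0 !mul0r addr0.
Qed.

Lemma chi_large x : r <= x -> chi x = 0 /\ chi' x = 0.
Proof.
move=> rx; have y0 : - r^-1 * x + 1 <= 0.
  have ri : 0 < r^-1 by rewrite invr_gt0.
  by have := rx; rewrite -(ler_pM2l ri) mulVf ?gt_eqF//; lra.
by rewrite /chi /chi' !(flat_le0 _ y0) !mulr0 addr0.
Qed.

(** Uniform in [r], because [x d/dx] is invariant under scaling. The 5 is 3 + 2: the inner factor
    contributes [flat 1 + flat 2 <= 1! + 2!], the outer one [flat 2 <= 2!] where [x <= r]. *)
Lemma chi'_bound x : 0 <= x -> `|x * chi' x| <= 5.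
Proof.
move=> x0; rewrite /chi'.
set y := r * x + -1; set y' := - r^-1 * x + 1.
have b1 : 0 <= x * r * flat 2 y <= 3.
  have -> : x * r * flat 2 y = flat 1 y + flat 2 y by rewrite (flat_shift 1) /y; ring.
  have := flat_le 1 y; have := flat_le 2 y; have := flat_ge0 1 y; have := flat_ge0 2 y.
  by rewrite (_ : 1`! = 1%N)// (_ : 2`! = 2%N)//; lra.
have b2 : 0 <= x * r^-1 * flat 2 y' <= 2.
  have := flat_le 2 y'; have := flat_ge0 2 y'; rewrite (_ : 2`! = 2%N)// => f0 f2.
  have xr0 : 0 <= x * r^-1 by rewrite mulr_ge0// invr_ge0 ltW.
  have [y'0|y'0] := leP y' 0; first by rewrite flat_le0// mulr0; lra.
  have xr1 : x * r^-1 <= 1 by move: y'0; rewrite /y'; lra.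
  by apply/andP; split; nra.
have := flat_ge0 0 y; have := flat0_le1 y; have := flat_ge0 0 y'; have := flat0_le1 y'.
move: b1 b2; rewrite (_ : x * (_ + _) = (x * r * flat 2 y) * flat 0 y' -
  (x * r^-1 * flat 2 y') * flat 0 y); last by ring.
move: (x * r * _) (x * r^-1 * _) (flat 0 y) (flat 0 y') => a b c d.
move=> /andP[a0 a3] /andP[b0 b2] d1 d0 c1 c0; rewrite ler_norml.
have : a * d <= 3 * 1 by apply: ler_pM.
have : b * c <= 2 * 1 by apply: ler_pM.
have := mulr_ge0 a0 d0; have := mulr_ge0 b0 c0; lra.
Qed.

End cutoff.

Lemma chi_cvg {R : realType} (x : R) : 0 < x ->
  ((fun j : nat => chi j.+1%:R x) @ \oo --> expR (-1))%classic.
Proof.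
move=> x0; have h0 := @cvg_harmonic R; rewrite /harmonic in h0.
have cf : continuous (flat 0 : R -> R).
  by move=> y; exact: (is_derive1_cont (is_derive_flat 0 y)).
rewrite -[X in _ --> X]mul1r; apply: cvgM.
  have c1 : (fun j : nat => expR (- (j.+1%:R^-1 / (x - j.+1%:R^-1)))) @ \oo --> (1 : R).
    rewrite -[X in _ --> X]expR0 -oppr0 -(mul0r (x - 0)^-1).
    apply: (cvg_comp _ expR); last exact: continuous_expR.
    apply: cvgN; apply: cvgM => //; apply: cvgV; first by rewrite subr0 gt_eqF.
    by apply: cvgB => //; exact: cvg_cst.
  apply: cvg_trans c1; apply: near_eq_cvg; near=> j.
  have hx : j.+1%:R^-1 < x by near: j; exact: (cvgr_lt 0 h0).
  have n0 : (j.+1%:R : R) != 0 by rewrite pnatr_eq0.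
  have n0' : (0 : R) < j.+1%:R by rewrite ltr0n.
  have y0 : 0 < j.+1%:R * x + -1.
    by rewrite subr_gt0 mulrC -ltr_pdivrMr// mul1r.
  rewrite /flat y0 expr0 mul1r; congr (expR (- _)).
  have d0 : x - j.+1%:R^-1 != 0 by rewrite gt_eqF// subr_gt0.
  rewrite (_ : _ * x + -1 = j.+1%:R * (x - j.+1%:R^-1)) ?invfM//.
  by rewrite mulrBr mulfV.
have -> : expR (-1) = flat 0 (0 * x + 1 : R).
  by rewrite mul0r add0r /flat ltr01 expr0 mul1r invr1.
apply: (cvg_comp _ (flat 0)); last exact: cf.
apply: cvgD; last exact: cvg_cst.
apply: cvgM; last exact: cvg_cst.
by rewrite -oppr0; exact: cvgN.
Unshelve. all: end_near. Qed.

(** * The weight as a radial profile and the energy estimate *)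

Section weight_profile.
Context {R : realType} (m : R) (m0 : 0 < m).
Local Notation alpha := (m / 2).

(** The weight in the variable [x = |z|^2]. The power [x^(m / 2)] is written with [expR] and [ln] to
    lie in [halfline_smooth]. *)
Definition profile (x : R) : R := expR (- expR (alpha * ln x)).
Definition profile_exp (x : R) : R := alpha * expR (alpha * ln x).

Lemma hs_profile_exp : halfline_smooth profile_exp.
Proof. by apply/hs_scale/hs_exp/hs_scale/hs_ln. Qed.

Lemma hs_profile : halfline_smooth profile.
Proof. by apply/hs_exp/hs_opp/hs_exp/hs_scale/hs_ln. Qed.

Lemma is_derive_profile_exp (x : R) : 0 < x ->
  is_derive x (1 : R) profile_exp (alpha * profile_exp x / x).
Proof.
move=> x0; have D := is_deriveZ alpha (is_derive1_ln x0).
have := is_deriveZ alpha (@is_derive1_comp _ expR (fun y => alpha * ln y) x _ _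
  (is_derive_expR (alpha * ln x)) D).
by congr is_derive; rewrite /GRing.scale/= /profile_exp; ring.
Qed.

Lemma is_derive_profile (x : R) : 0 < x ->
  is_derive x (1 : R) profile (- (profile_exp x / x) * profile x).
Proof.
move=> x0; have D := is_deriveZ alpha (is_derive1_ln x0).
have E := @is_derive1_comp _ expR (fun y => alpha * ln y) x _ _ (is_derive_expR (alpha * ln x)) D.
have := @is_derive1_comp _ expR (fun y => - expR (alpha * ln y)) x _ _
  (is_derive_expR (- expR (alpha * ln x))) (is_deriveN E).
by congr is_derive; rewrite /GRing.scale/= /profile_exp /profile; ring.
Qed.

Lemma weight_profile z : 0 < sq z -> weight m z = profile (sq z).
Proof.
move=> z0; rewrite /weight /profile /cabs -/(sq z) /powR sqrtr_eq0 leNgt z0/=.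
have s0 : 0 < Num.sqrt (sq z) by rewrite sqrtr_gt0.
have -> : ln (sq z) = 2 * ln (Num.sqrt (sq z)).
  rewrite -[in LHS](sqr_sqrtr (sq_ge0 z)) expr2 lnM ?posrE//; ring.
by congr (expR (- expR _)); field.
Qed.

(* Derivative of [s^n (n - alpha - A) w chi^2], where [A = alpha s^alpha] and [w' = - A w / s]:
   integrating it to 0 expresses the energy of [conj z^n w chi] by moments of [w]. *)
Definition energy_flux (r : R) n (x : R) : R :=
  x ^+ n.+1 * (n.+1%:R - alpha - profile_exp x) * profile x * chi r x ^+ 2.
Definition energy_flux' (r : R) n (x : R) : R := x ^+ n * profile x *
  (((n.+1%:R - profile_exp x) ^+ 2 - alpha * n.+1%:R) * chi r x ^+ 2 +
   2 * (n.+1%:R - alpha - profile_exp x) * (x * (chi r x * chi' r x))).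

Lemma is_derive_energy_flux (r : R) n (x : R) : 0 < x ->
  is_derive x (1 : R) (energy_flux r n) (energy_flux' r n x).
Proof.
move=> x0; have dA := is_derive_profile_exp x0; have dw := is_derive_profile x0.
have dc := is_derive_chi r x.
have dX : is_derive x (1 : R) (fun y : R => y ^+ n.+1) (n.+1%:R * x ^+ n).
  elim: n => [|n IHn].
    by have := is_derive_id x (1 : R); congr is_derive; rewrite expr0 mulr1.
  rewrite (_ : (fun y : R => y ^+ n.+2) = (fun y => y * y ^+ n.+1)); last first.
    by apply/funext => y; rewrite exprS.
  have := is_deriveM (is_derive_id x (1 : R)) IHn; congr is_derive.
  by rewrite /GRing.scale/= exprS -[n.+2%:R]natr1; ring.
have dB : is_derive x (1 : R) (fun y => n.+1%:R - alpha - profile_exp y) (- (alpha * profile_exp x / x)).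
  by have := is_deriveB (is_derive_cst (n.+1%:R - alpha) x (1 : R)) dA; congr is_derive; rewrite sub0r.
have := is_derive_mul (is_derive_mul (is_derive_mul dX dB) dw) (is_derive_mul dc dc).
have xn0 : x != 0 by rewrite gt_eqF.
rewrite (_ : energy_flux r n = (fun y => y ^+ n.+1 * (n.+1%:R - alpha - profile_exp y) *
  profile y * (chi r y * chi r y))); last first.
  by apply/funext => y; rewrite /energy_flux expr2.
congr is_derive; rewrite /energy_flux' exprS.
by move: (profile_exp x) (profile x) (chi r x) (chi' r x) (x ^+ n) (n.+1%:R) => A w c c' p N; field.
Qed.

Lemma hs_energy_flux' (r : R) n : halfline_smooth (energy_flux' r n).
Proof.
have hA := hs_profile_exp; have hc := hs_chi r; have hc' := hs_chi' r.
have hN : halfline_smooth (fun x => n.+1%:R + - profile_exp x) by exact: hs_add (hs_cst _) (hs_opp hA).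
have hM : halfline_smooth (fun x => (n.+1%:R - alpha) + - profile_exp x).
  exact: hs_add (hs_cst _) (hs_opp hA).
have h1 := hs_mul (hs_add (hs_mul hN hN) (hs_cst (- (alpha * n.+1%:R)))) (hs_mul hc hc).
have h2 := hs_mul (hs_scale 2 hM) (hs_mul hs_id (hs_mul hc hc')).
by apply: (hs_eq (hs_mul (hs_mul (hs_pow n) hs_profile) (hs_add h1 h2))) => x _.
Qed.

Local Notation mu := (@leb2 R).
Local Notation ig f := (mu.-integrable setT (EFin \o f)).
Local Notation rint := (Rintegral mu setT).

(** This is [|d-bar psi|^2 / w] for [psi = conj z ^ n.+1 w chi]. *)
Definition energy (r : R) n (z : R * R) : R := sq z ^+ n * weight m z *
  ((n.+1%:R - profile_exp (sq z)) * chi r (sq z) + sq z * chi' r (sq z)) ^+ 2.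

(** Let [N = n + 1], [c = chi], [d = x chi']. Subtracting [energy_flux'], of integral 0, cancels the
    square [(N - A)^2 c^2] and the mixed term with [N - A]. There remains
    [alpha N c^2 + 2 alpha c d + d^2], where [c <= 1] and [|d| <= 5], hence at most
    [alpha N + 26 alpha + 25]. *)
Lemma energy_le (r : R) n : 0 < r -> ig (energy r n) -> ig (fun z => sq z ^+ n * weight m z) ->
  rint (energy r n) <=
  (alpha * n.+1%:R + alpha + 25 * (1 + alpha)) * rint (fun z => sq z ^+ n * weight m z).
Proof.
move=> r0 iE iM; have ri : 0 < r^-1 by rewrite invr_gt0.
have [iF F0] := @radial_integral0 _ (energy_flux r n) (energy_flux' r n) r^-1 r ri
  (hs_energy_flux' r n)
  (fun x xr => ltac:(rewrite /energy_flux /energy_flux' (chi_small r0 xr).1;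
     split; rewrite ?expr0n/= ?mul0r ?mulr0 ?addr0 ?mulr0//))
  (fun x xr => ltac:(rewrite /energy_flux /energy_flux' (chi_large r0 xr).1;
     split; rewrite ?expr0n/= ?mul0r ?mulr0 ?addr0 ?mulr0//)) (@is_derive_energy_flux r n).
rewrite -[leRHS]add0r -F0 -(rintZ _ iM) -rintD//; last exact: igZ.
apply: rint_le => //; first by apply: igD => //; exact: igZ.
move=> z; rewrite /energy /energy_flux'.
have a0 : 0 < alpha by rewrite divr_gt0.
have [z0|z0] := ltP 0 (sq z); last first.
  have zr : sq z < r^-1 by exact: le_lt_trans ri.
  have [e1 e2] := chi_small r0 zr.
  rewrite e1 e2 !(mulr0, mul0r, addr0) expr0n /= !(mulr0, mul0r, addr0) add0r.
  by rewrite !mulr_ge0 ?addr_ge0 ?exprn_ge0 ?sq_ge0 ?weight_ge0//; try nra; exact: mulr_ge0 (ltW a0) _.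
rewrite weight_profile//.
have c0 := chi_ge0 r (sq z); have c1 := chi_le1 r (sq z).
have cb := chi'_bound r0 (ltW z0).
have w0 : 0 <= sq z ^+ n * profile (sq z) by rewrite mulr_ge0 ?exprn_ge0 ?sq_ge0 ?expR_ge0.
move: w0 c0 c1 cb; set p := _ * profile _; rewrite [25 * _ in X in _ -> X]lock.
rewrite (mulrCA (sq z)); move: (chi r _) (sq z * chi' r _) (profile_exp _) => c d A.
rewrite -lock => p0 c0 c1; rewrite ler_norml => /andP[d1 d2].
rewrite [X in _ <= _ + X]mulrC -mulrDr ler_wpM2l// -lerBlDl.
have N0 : (0 : R) <= n.+1%:R by [].
move: (n.+1%:R) N0 => N N0.
have dd : d ^+ 2 <= 25 by nra.
have cc : c ^+ 2 <= 1 by nra.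
have cd : 2 * (c * d) <= c ^+ 2 + d ^+ 2 by have := sqr_ge0 (c - d); lra.
have -> : ((N - A) * c + d) ^+ 2 - (((N - A) ^+ 2 - alpha * N) * c ^+ 2 +
  2 * (N - alpha - A) * (c * d)) = alpha * N * c ^+ 2 + alpha * (2 * (c * d)) + d ^+ 2 by ring.
have := mulr_ge0 (ltW a0) N0 => aN.
have : alpha * N * c ^+ 2 <= alpha * N * 1 by rewrite ler_wpM2l.
have : alpha * (2 * (c * d)) <= alpha * (1 + 25) by rewrite ler_pM2l//; lra.
lra.
Qed.

End weight_profile.

(** * The weak d-bar equation in real form *)

Section weak_pairing.
Context {R : realType} (m : R) (hm : 0 <= m).
Local Notation mu := (@leb2 R).
Local Notation ig f := (mu.-integrable setT (EFin \o f)).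
Local Notation rint := (Rintegral mu setT).
Local Notation Re := (@complex.Re R).
Local Notation Im := (@complex.Im R).
Local Notation W := (weight m).

Lemma C1c_l2 (f fx fy : R * R -> R) : C1c f fx fy ->
  [/\ l2 m (fun z => f z / W z), l2 m (fun z => fx z / W z) & l2 m (fun z => fy z / W z)].
Proof.
move=> [[_ _ c cx cy] [r fr]].
by split; apply: (continuous_compact_support_l2 hm (r := r)) => // z /fr[].
Qed.

Lemma weak_dbar_real (v g : R * R -> R[i]) (phi px py : R * R -> R) :
  inL2 m v -> inL2 m g -> weak_dbar v g -> test_fun phi -> C1c phi px py ->
  2 * rint (fun z => re g z * phi z) = - rint (fun z => re v z * px z) + rint (fun z => im v z * py z) /\
  2 * rint (fun z => im g z * phi z) = - rint (fun z => re v z * py z) - rint (fun z => im v z * px z).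
Proof.
move=> /inL2P[v1 v2] /inL2P[g1 g2] vg tp cp; have [lp lx ly] := C1c_l2 cp.
have [[dx dy _ _ _] _] := cp.
have E z : dbar_test phi z = ((2^-1 * px z) +i* (2^-1 * py z))%C.
  by rewrite /dbar_test; have := dx z; have := dy z => D1 D2; rewrite !derive_val.
have iv1x := l2_ig_div v1 lx; have iv1y := l2_ig_div v1 ly.
have iv2x := l2_ig_div v2 lx; have iv2y := l2_ig_div v2 ly.
have H := vg phi tp.
split.
  have := congr1 Re H; rewrite /cint /= => H1.
  have -> : rint (fun z => re g z * phi z) = - (2^-1 * (rint (fun z => re v z * px z) - rint (fun z => im v z * py z))).
    rewrite -rintB// -(rintZ _ (igB iv1x iv2y)); transitivity (rint (fun z => Re (g z * (phi z)%:C%C))).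
      by apply: eq_rint => z; rewrite ReM /= mulr0 subr0.
    by rewrite H1; congr (- _); apply: eq_rint => z; rewrite E ReM /re /im /=; ring.
  by field.
have := congr1 Im H; rewrite /cint /= => H1.
have -> : rint (fun z => im g z * phi z) = - (2^-1 * (rint (fun z => re v z * py z) + rint (fun z => im v z * px z))).
  rewrite -rintD// -(rintZ _ (igD iv1y iv2x)); transitivity (rint (fun z => Im (g z * (phi z)%:C%C))).
    by apply: eq_rint => z; rewrite ImM /= mulr0 add0r.
  by rewrite H1; congr (- _); apply: eq_rint => z; rewrite E ImM /re /im /=; ring.
by field.
Qed.

End weak_pairing.

(** * The test functions conj z^n w chi *)

Section test_functions.
Context {R : realType} (m : R) (m0 : 0 < m) (r : R) (r0 : 0 < r).
Local Notation mu := (@leb2 R).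
Local Notation ig f := (mu.-integrable setT (EFin \o f)).
Local Notation rint := (Rintegral mu setT).
Local Notation Re := (@complex.Re R).
Local Notation Im := (@complex.Im R).
Local Notation W := (weight m).
Local Notation w := (profile m).
Local Notation A := (profile_exp m).
Let hm : 0 <= m := ltW m0.

Definition conjRe n (z : R * R) : R := Re (conjc (toC z) ^+ n).
Definition conjIm n (z : R * R) : R := Im (conjc (toC z) ^+ n).

Lemma conjReS n z : conjRe n.+1 z = z.1 * conjRe n z + z.2 * conjIm n z.
Proof. by rewrite /conjRe exprS ReM /=; ring. Qed.

Lemma conjImS n z : conjIm n.+1 z = z.1 * conjIm n z + -1 * (z.2 * conjRe n z).
Proof. by rewrite /conjIm exprS ImM /=; ring. Qed.

Lemma conj_norm n z : conjRe n z ^+ 2 + conjIm n z ^+ 2 = sq z ^+ n.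
Proof.
elim: n => [|n IHn]; first by rewrite /conjRe /conjIm !expr0 /= expr0n expr1n addr0.
by rewrite conjReS conjImS [sq z ^+ _]exprS -IHn /sq; ring.
Qed.

Lemma toC_pow n z : toC z ^+ n = ((conjRe n z) +i* (- conjIm n z))%C.
Proof.
rewrite /conjRe /conjIm -[LHS]conjcK rmorphXn /=.
by case: (_ ^+ n).
Qed.

(** The [x]-derivative of [conj z ^ n] is [n conj z ^ (n - 1)], the [y]-derivative is [- i] times
    that. For [n = 0] the truncated predecessor is multiplied by 0. *)
Lemma C1_conj n : C1 (conjRe n) (fun z => n%:R * conjRe n.-1 z) (fun z => n%:R * conjIm n.-1 z) /\
  C1 (conjIm n) (fun z => n%:R * conjIm n.-1 z) (fun z => - (n%:R * conjRe n.-1 z)).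
Proof.
elim: n => [|n [IH1 IH2]].
  split; [apply: (C1_eq (C1_cst 1))|apply: (C1_eq (C1_cst 0))] => z;
    by rewrite /conjRe /conjIm ?expr0//= ?mul0r ?oppr0.
have N : n = 0%N \/ exists k, n = k.+1 by case: (n) => [|k]; [left|right; exists k].
split.
  apply: (C1_eq (C1D (C1M (@C1_fst R) IH1) (C1M (@C1_snd R) IH2))) => z.
  - by rewrite conjReS.
  - case: N => [->|[k ->]]; first by rewrite /=; ring.
    by rewrite -[k.+2%:R]natr1 /= !conjReS; ring.
  - case: N => [->|[k ->]]; first by rewrite /=; ring.
    by rewrite -[k.+2%:R]natr1 /= !conjImS; ring.
apply: (C1_eq (C1D (C1M (@C1_fst R) IH2) (C1M (C1_cst (-1)) (C1M (@C1_snd R) IH1)))) => z.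
- by rewrite conjImS.
- case: N => [->|[k ->]]; first by rewrite /=; ring.
  by rewrite -[k.+2%:R]natr1 /= !conjImS; ring.
- case: N => [->|[k ->]]; first by rewrite /=; ring.
  by rewrite -[k.+2%:R]natr1 /= !conjReS; ring.
Qed.

Definition bump (x : R) : R := w x * chi r x.
Definition bump' (x : R) : R := w x * chi' r x + chi r x * (- (A x / x) * w x).

Lemma hs_bump : halfline_smooth bump.
Proof. by apply: hs_mul; [exact: hs_profile|exact: hs_chi]. Qed.

Lemma hs_bump' : halfline_smooth bump'.
Proof.
apply: hs_add; first by apply: hs_mul; [exact: hs_profile|exact: hs_chi'].
apply: hs_mul; first exact: hs_chi.
apply: hs_mul; last exact: hs_profile.
by apply: hs_opp; apply: hs_mul; [exact: hs_profile_exp|exact: hs_inv].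
Qed.

Lemma bump_small x : x < r^-1 -> bump x = 0 /\ bump' x = 0.
Proof. by move=> /(chi_small r0)[e1 e2]; rewrite /bump /bump' e1 e2 !mulr0 mul0r addr0. Qed.

Lemma bump_large x : r <= x -> bump x = 0 /\ bump' x = 0.
Proof. by move=> /(chi_large r0)[e1 e2]; rewrite /bump /bump' e1 e2 !mulr0 mul0r addr0. Qed.

Let ri : 0 < r^-1. Proof. by rewrite invr_gt0. Qed.

Lemma C1c_bump : C1c (fun z => bump (sq z)) (fun z => bump' (sq z) * (2 * z.1))
  (fun z => bump' (sq z) * (2 * z.2)).
Proof.
have D : forall x : R, is_derive x (1 : R) bump (bump' x).
  apply: (@derive_extend0 _ bump bump' r^-1 ri bump_small) => x x0.
  exact: (is_derive_mul (@is_derive_profile R m x x0) (is_derive_chi r x)).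
have c' : continuous bump'.
  by apply: (halfline_smooth_cont hs_bump' ri) => x /bump_small[].
have [c [s cs]] := C1c_radial (0, 0) D c' bump_large.
split; first by apply: (C1_eq c) => z; rewrite ?sqE//= subr0.
by exists s => z /cs[]; rewrite !sqE /= !subr0.
Qed.

Lemma conj_bump_test n : test_fun (fun z => conjRe n z * bump (sq z)) /\
  test_fun (fun z => conjIm n z * bump (sq z)).
Proof.
have [_ [s cs]] := C1c_bump.
have H : planar_smooth (fun z => conjRe n z * bump (sq z)) /\
    planar_smooth (fun z => conjIm n z * bump (sq z)).
  have B : planar_smooth (fun z => bump (sq z)).
    by apply: (ps_radial hs_bump ri) => x /bump_small[].
  elim: n => [|n [IH1 IH2]].
    rewrite (_ : (fun z => conjRe 0 z * _) = (fun z => bump (sq z))); last first.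
      by apply/funext => z; rewrite /conjRe expr0 /= mul1r.
    rewrite (_ : (fun z => conjIm 0 z * _) = (fun z => 0 * bump (sq z))).
      by split => //; exact: ps_scale.
    by apply/funext => z; rewrite /conjIm expr0.
  rewrite (_ : (fun z => conjRe n.+1 z * _) = (fun z => z.1 * (conjRe n z * bump (sq z)) +
    z.2 * (conjIm n z * bump (sq z)))); last by apply/funext => z; rewrite conjReS; ring.
  rewrite (_ : (fun z => conjIm n.+1 z * _) = (fun z => z.1 * (conjIm n z * bump (sq z)) +
    -1 * (z.2 * (conjRe n z * bump (sq z))))); last by apply/funext => z; rewrite conjImS; ring.
  split; first by apply: ps_add; [exact: ps_fst|exact: ps_snd].
  by apply: ps_add; [exact: ps_fst|apply: ps_scale; exact: ps_snd].
have [H1 H2] := H.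
split; split; [exact: planar_smooth_smooth H1| |exact: planar_smooth_smooth H2|];
  by exists s => z /cs[-> _ _]; rewrite mulr0.
Qed.

(* [d-bar (conj z ^ n.+1 w chi) = conj z ^ n * dbump n], with [t = |z|^2] *)
Definition dbump n (x : R) : R := w x * ((n.+1%:R - A x) * chi r x + x * chi' r x).

Lemma hs_dbump n : halfline_smooth (dbump n).
Proof.
apply: hs_mul; first exact: hs_profile.
apply: hs_add; apply: hs_mul; [|exact: hs_chi|exact: hs_id|exact: hs_chi'].
by apply: (hs_add (hs_cst _)); apply: hs_opp; exact: hs_profile_exp.
Qed.

Lemma dbump_small n x : x < r^-1 -> dbump n x = 0.
Proof. by move=> /(chi_small r0)[e1 e2]; rewrite /dbump e1 e2 !mulr0 addr0 mulr0. Qed.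

Lemma dbump_large n x : r <= x -> dbump n x = 0.
Proof. by move=> /(chi_large r0)[e1 e2]; rewrite /dbump e1 e2 !mulr0 addr0 mulr0. Qed.

Lemma dbumpE n x : n.+1%:R * bump x + x * bump' x = dbump n x.
Proof.
(* [bump'] contains the quotient [A x / x], so [x = 0] is separate; there the cutoff makes both
   sides vanish. *)
have [->|x0] := eqVneq x 0.
  have [e1 e2] := bump_small ri; rewrite e1 mul0r mulr0 addr0; symmetry; exact: dbump_small.
rewrite /bump /bump' /dbump.
by move: (w x) (A x) (chi r x) (chi' r x) => ? ? ? ?; field.
Qed.

Lemma l2_dbump n : l2 m (fun z => conjRe n z * dbump n (sq z) / W z) /\
  l2 m (fun z => conjIm n z * dbump n (sq z) / W z).
Proof.
have c : continuous (fun z => dbump n (sq z)).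
  rewrite (_ : (fun z => dbump n (sq z)) = (fun z => dbump n (sqd (0, 0) z))).
    by apply: continuous_radial; apply: (halfline_smooth_cont (hs_dbump n) ri); exact: dbump_small.
  by apply/funext => z; rewrite sqE.
have [[_ _ c1 _ _] [_ _ c2 _ _]] := C1_conj n.
split; apply: (continuous_compact_support_l2 hm (r := `|(0, 0) : R * R| + `|r| + 1)).
- by move=> z; apply: cvgM; [exact: c1|exact: c].
- by move=> z /sqd_out; rewrite sqE => /dbump_large ->; rewrite mulr0.
- by move=> z; apply: cvgM; [exact: c2|exact: c].
- by move=> z /sqd_out; rewrite sqE => /dbump_large ->; rewrite mulr0.
Qed.

Lemma l2_bump n : l2 m (fun z => conjRe n z * bump (sq z) / W z) /\
  l2 m (fun z => conjIm n z * bump (sq z) / W z).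
Proof.
have [c1 c2] := C1_conj n.
by have [+ _ _] := C1c_l2 hm (C1cM c1 C1c_bump); have [+ _ _] := C1c_l2 hm (C1cM c2 C1c_bump).
Qed.

(** Real part of the unweighted integral of [g (q1 + i q2)], written with weighted products. *)
Definition pairing (g : R * R -> R[i]) (q1 q2 : R * R -> R) : R :=
  J m (re g) (fun z => q1 z / W z) - J m (im g) (fun z => q2 z / W z).

Lemma weak_dbar_pairing n (v g : R * R -> R[i]) : inL2 m v -> inL2 m g -> weak_dbar v g ->
  pairing g (fun z => conjRe n.+1 z * bump (sq z)) (fun z => conjIm n.+1 z * bump (sq z)) =
  - pairing v (fun z => conjRe n z * dbump n (sq z)) (fun z => conjIm n z * dbump n (sq z)).
Proof.
move=> lv lg vg; have [t1 t2] := conj_bump_test n.+1; have [c1 c2] := C1_conj n.+1.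
have C1' := C1cM c1 C1c_bump; have C2' := C1cM c2 C1c_bump.
have [A1 _] := weak_dbar_real hm lv lg vg t1 C1'.
have [_ A2] := weak_dbar_real hm lv lg vg t2 C2'.
have [lp1 lx1 ly1] := C1c_l2 hm C1'; have [lp2 lx2 ly2] := C1c_l2 hm C2'.
have [ld1 ld2] := l2_dbump n.
have /inL2P[v1 v2] := lv.
have ix1 := l2_ig_div v1 lx1; have iy2 := l2_ig_div v1 ly2.
have iy1 := l2_ig_div v2 ly1; have ix2 := l2_ig_div v2 lx2.
have id1 := l2_ig_div v1 ld1; have id2 := l2_ig_div v2 ld2.
(* Real and imaginary part of [z * conj z ^ n.+1 = |z|^2 conj z ^ n]: the derivative of the radial
   factor supplies [z], which restores the exponent [n]. *)
have key z : z.1 * conjRe n.+1 z - z.2 * conjIm n.+1 z = sq z * conjRe n z /\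
    z.1 * conjIm n.+1 z + z.2 * conjRe n.+1 z = sq z * conjIm n z.
  by rewrite conjReS conjImS /sq; split; ring.
have B1 : rint (fun z => re v z * (conjRe n z * dbump n (sq z))) * 2 =
    rint (fun z => re v z * (n.+1%:R * conjRe n z * bump (sq z) + conjRe n.+1 z * (bump' (sq z) * (2 * z.1)))) -
    rint (fun z => re v z * (- (n.+1%:R * conjRe n z) * bump (sq z) + conjIm n.+1 z * (bump' (sq z) * (2 * z.2)))).
  rewrite -rintB// mulrC -(rintZ _ id1); apply: eq_rint => z; have [k1 _] := key z.
  rewrite -dbumpE (_ : conjRe n z * (_ + _) =
    n.+1%:R * (conjRe n z * bump (sq z)) + (sq z * conjRe n z) * bump' (sq z)); last by ring.
  by rewrite -k1; ring.
have B2 : rint (fun z => im v z * (conjIm n z * dbump n (sq z))) * 2 =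
    rint (fun z => im v z * (n.+1%:R * conjIm n z * bump (sq z) + conjRe n.+1 z * (bump' (sq z) * (2 * z.2)))) +
    rint (fun z => im v z * (n.+1%:R * conjIm n z * bump (sq z) + conjIm n.+1 z * (bump' (sq z) * (2 * z.1)))).
  rewrite -rintD// mulrC -(rintZ _ id2); apply: eq_rint => z; have [_ k2] := key z.
  rewrite -dbumpE (_ : conjIm n z * (_ + _) =
    n.+1%:R * (conjIm n z * bump (sq z)) + (sq z * conjIm n z) * bump' (sq z)); last by ring.
  by rewrite -k2; ring.
rewrite /pairing -!J_div; move: A1 A2 B1 B2.
move: (rint _) (rint _) (rint _) (rint _) (rint _) (rint _) (rint _) (rint _) => *; lra.
Qed.

Lemma pairing_CS (v : R * R -> R[i]) (q1 q2 : R * R -> R) : inL2 m v ->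
  l2 m (fun z => q1 z / W z) -> l2 m (fun z => q2 z / W z) ->
  pairing v q1 q2 ^+ 2 <= 2 * norm2 m v * (J m (fun z => q1 z / W z) (fun z => q1 z / W z) +
    J m (fun z => q2 z / W z) (fun z => q2 z / W z)).
Proof.
move=> /inL2P[v1 v2] l1 l2'; rewrite /pairing /norm2.
have := J_CS v1 l1; have := J_CS v2 l2'.
have := J_ge0 m (re v); have := J_ge0 m (im v).
have := J_ge0 m (fun z => q1 z / W z); have := J_ge0 m (fun z => q2 z / W z).
move: (J _ _ _) (J _ _ _) (J _ _ _) (J _ _ _) (J _ _ _) (J _ _ _) => a b c d x y.
move=> y0 x0 d0 c0 bd ac; have := sqr_ge0 (a + b).
have := mulr_ge0 d0 x0; have := mulr_ge0 c0 y0; nra.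
Qed.

Lemma dbump_energy n : J m (fun z => conjRe n z * dbump n (sq z) / W z) (fun z => conjRe n z * dbump n (sq z) / W z) +
  J m (fun z => conjIm n z * dbump n (sq z) / W z) (fun z => conjIm n z * dbump n (sq z) / W z) =
  rint (energy m r n) /\ ig (energy m r n).
Proof.
have [l1 l2'] := l2_dbump n; have i1 := l2_ig l1 l1; have i2 := l2_ig l2' l2'.
have E z : (conjRe n z * dbump n (sq z) / W z * (conjRe n z * dbump n (sq z) / W z) * W z) +
   (conjIm n z * dbump n (sq z) / W z * (conjIm n z * dbump n (sq z) / W z) * W z) = energy m r n z.
  have W0 : W z != 0 by rewrite gt_eqF// weight_gt0.
  transitivity ((conjRe n z ^+ 2 + conjIm n z ^+ 2) * dbump n (sq z) ^+ 2 / W z); first by field.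
  rewrite conj_norm /energy /dbump; have [z0|z0] := ltP 0 (sq z).
    by rewrite -weight_profile//; field.
  have [e1 e2] := chi_small r0 (le_lt_trans z0 ri).
  by rewrite e1 e2; ring.
split; first by rewrite /J -rintD//; apply: eq_rint => z; exact: E.
by apply: (ig_eq E); exact: igD.
Qed.

End test_functions.

(** * Moments of the weight *)

Section antiderivative.
Context {R : realType}.

(** Normalized to vanish at infinity: composed with [|z|^2] it may be any constant near the origin
    and is still [C^1] with compact support. *)
Lemma compact_support_antiderivative (f : R -> R) (d T : R) : continuous f ->
  (forall x, x < d -> f x = 0) -> (forall x, T <= x -> f x = 0) ->
  exists2 F : R -> R, forall x : R, is_derive x (1 : R) F (f x) & forall x, T <= x -> F x = 0.
Proof.
move=> cf fd fT; pose mu1 := @lebesgue_measure R.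
(* The base point [d - 1] lies strictly to the left of every [x >= d], as the fundamental theorem
   requires; for [x < d] the integral vanishes. *)
pose F (x : R) : R := Rintegral mu1 `[d - 1, x]%classic f.
have F0 (x : R) : x < d -> F x = 0.
  move=> xd; rewrite /F Rintegral_mkcond (_ : patch _ _ _ = fun=> 0); last first.
    apply/funext => y; rewrite /patch; case: ifPn => //; rewrite inE /= in_itv /= => /andP[_ yx].
    by apply: fd; exact: le_lt_trans xd.
  by rewrite /Rintegral integral0_eq.
have FT (x : R) : T <= x -> F x = F T.
  move=> Tx; have FE y : F y = Rintegral mu1 setT (patch (fun=> 0) `[d - 1, y]%classic f).
    by rewrite /F Rintegral_mkcond.
  suff E : patch (fun=> 0) `[d - 1, x]%classic f = patch (fun=> 0) `[d - 1, T]%classic f.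
    by rewrite FE E -FE.
  apply/funext => y; rewrite /patch; have [yT|Ty] := ltP y T; last first.
    by rewrite fT//; do 2 case: ifPn.
  suff -> : (y \in `[d - 1, x]%classic) = (y \in `[d - 1, T]%classic) by [].
  by apply/idP/idP; rewrite !inE /= !in_itv /= => /andP[-> _] /=; [exact: ltW|exact: le_trans (ltW yT) Tx].
exists (fun x => F x - F T) => [x|x /FT ->]; last by rewrite subrr.
have D : is_derive x (1 : R) F (f x).
  have [xd|dx] := ltP x d.
    rewrite fd//; apply: near_eq_is_derive (is_derive_cst (0 : R) x (1 : R)).
    by near=> y; rewrite F0//; near: y; exact: lt_nbhsl.
  have xu : x < x + 1 by rewrite ltrDl.
  have ax : d - 1 < x by lra.
  have iF : mu1.-integrable `[d - 1, x + 1]%classic (EFin \o f).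
    apply: continuous_compact_integrable; first exact: segment_compact.
    exact: continuous_subspaceT.
  have [E1 E2] := continuous_FTC1_closed xu iF ax (cf x).
  exact: (DeriveDef E1 (etrans (esym (derive1E _ _)) E2)).
have := is_deriveB D (is_derive_cst (F T) x (1 : R)).
by congr is_derive; rewrite subr0.
Unshelve. all: end_near. Qed.

End antiderivative.

Section moments.
Context {R : realType} (m : R) (m2 : 2 <= m).
Local Notation mu := (@leb2 R).
Local Notation ig f := (mu.-integrable setT (EFin \o f)).
Local Notation rint := (Rintegral mu setT).
Local Notation Re := (@complex.Re R).
Local Notation Im := (@complex.Im R).
Local Notation W := (weight m).
Let m0 : 0 < m. Proof. exact: lt_le_trans m2. Qed.
Let hm : 0 <= m := ltW m0.

Lemma measurable_sq : measurable_fun setT (sq : R * R -> R).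
Proof. by apply: continuous_measurable_prod; have [] := @C1_sq R. Qed.

(** Up to the constant [normal_peak 1], squared, a product of two standard normal densities. *)
Lemma gauss_integrable2 : ig (fun z : R * R => expR (- (sq z / 2))).
Proof.
pose g (x : R) := normal_pdf 0 1 x.
have g0 x : 0 <= g x by exact: normal_pdf_ge0.
have mg : measurable_fun setT g by exact: measurable_normal_pdf.
have i1 : ig (fun z => g z.1 * g z.2).
  apply/integrable12ltyP.
    apply/measurable_EFinP; apply: measurable_funM.
      by apply: measurableT_comp mg _; exact: measurable_fst.
    by apply: measurableT_comp mg _; exact: measurable_snd.
  rewrite (_ : (fun x => _) = fun x => (g x)%:E); first by rewrite integral_normal_pdf ?ltry.
  apply/funext => x.
  rewrite (_ : (fun y => _) = fun y => ((g x)%:E * (g y)%:E)%E); last first.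
    by apply/funext => y /=; rewrite ger0_norm ?mulr_ge0.
  rewrite ge0_integralZl//; last 3 first.
    exact/measurable_EFinP.
    by move=> y _; rewrite lee_fin.
    by rewrite lee_fin.
  by rewrite integral_normal_pdf mule1.
have := igZ ((normal_peak (1 : R))^-1 ^+ 2) i1; apply: ig_eq => z.
have gE x : g x = normal_peak 1 * normal_fun 0 1 x by rewrite /g normal_pdfE ?oner_eq0.
rewrite !gE /normal_fun.
have p0 : normal_peak (1 : R) != 0 by rewrite gt_eqF// normal_peak_gt0 ?oner_eq0.
rewrite (_ : - (sq z / 2) = - (z.1 - 0) ^+ 2 / (1 ^+ 2 *+ 2) + - (z.2 - 0) ^+ 2 / (1 ^+ 2 *+ 2)).
  by rewrite expRD; field.
by rewrite !subr0 expr1n /sq; field.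
Qed.

(** Outside the unit disc [|z|^2 <= |z|^m] because [2 <= m]; inside it [|z|^2 <= 1], which the
    factor [expR 1] absorbs. *)
Lemma weight_le_gauss z : W z <= expR 1 * expR (- sq z).
Proof.
rewrite -expRD /weight ler_expR.
have c0 : 0 <= cabs z by exact: sqrtr_ge0.
have c2 : cabs z ^+ 2 = sq z by rewrite /cabs sqr_sqrtr// sq_ge0.
suff : sq z <= 1 + cabs z `^ m by lra.
rewrite -c2; have [c1|c1] := leP 1 (cabs z).
  have := ler_powR c1 m2; rewrite powR_mulrn// => H; apply: (le_trans H); lra.
have := powR_ge0 (cabs z) m; nra.
Qed.

(** Half of the Gaussian is spent on the power: [(s / 2)^n exp (- s / 2) <= n!], and the other half
    is integrable. *)
Lemma moment_integrable n : ig (fun z => sq z ^+ n * W z).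
Proof.
have i1 := igZ (expR 1 * (2 ^+ n * n`!%:R)) gauss_integrable2.
apply: le_integrable i1 => //.
  apply/measurable_EFinP; apply: measurable_funM; last exact: measurable_weight.
  by apply: measurable_funX; exact: measurable_sq.
move=> z _ /=; rewrite lee_fin.
rewrite ger0_norm; last by rewrite mulr_ge0 ?weight_ge0 ?exprn_ge0 ?sq_ge0.
rewrite [leRHS]ger0_norm; last by rewrite !mulr_ge0 ?expR_ge0// exprn_ge0.
have s0 := sq_ge0 z; set s := sq z in s0 *.
have B : (s / 2) ^+ n <= n`!%:R * expR (s / 2).
  have y0 : 0 <= s / 2 by lra.
  case: n => [|n]; first by rewrite expr0 fact0 mul1r; have := expR_ge1Dx (s / 2); lra.
  have f0 : (0 : R) < n.+1`!%:R by rewrite ltr0n fact_gt0.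
  by rewrite -ler_pdivrMl// mulrC; have := expR_ge1Dxn n y0; lra.
apply: (le_trans (y := s ^+ n * (expR 1 * expR (- s)))).
  by rewrite ler_wpM2l ?exprn_ge0// weight_le_gauss.
have -> : s ^+ n = 2 ^+ n * (s / 2) ^+ n by rewrite -exprMn mulrC divfK.
apply: (le_trans (y := 2 ^+ n * (n`!%:R * expR (s / 2)) * (expR 1 * expR (- s)))).
  by rewrite ler_wpM2r ?mulr_ge0 ?expR_ge0// ler_wpM2l// exprn_ge0.
have -> : expR (- s) = expR (- (s / 2)) * expR (- (s / 2)) by rewrite -expRD; congr expR; field.
have -> : 2 ^+ n * (n`!%:R * expR (s / 2)) * (expR 1 * (expR (- (s / 2)) * expR (- (s / 2)))) =
  expR 1 * (2 ^+ n * n`!%:R) * expR (- (s / 2)) * (expR (s / 2) * expR (- (s / 2))) by ring.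
by rewrite -expRD subrr expR0 mulr1.
Qed.

Definition moment n : R := rint (fun z => sq z ^+ n * W z).

Lemma moment_gt0 n : 0 < moment n.
Proof.
have [c c0 cW] := weight_lower hm 2.
have H z : 1 <= z.1 <= 2 -> 1 <= z.2 <= 2 -> c <= sq z ^+ n * W z.
  move=> /andP[a1 a2] /andP[b1 b2].
  have s1 : 1 <= sq z by rewrite /sq; nra.
  have cz : c <= W z by apply: cW; rewrite norm_pair_le !ger0_norm; [rewrite a2|lra|lra].
  by rewrite -[leLHS]mul1r ler_pM ?(ltW c0)// exprn_ege1.
have := @rint_box_ge R (fun z => sq z ^+ n * W z) 1 2 1 2 c _ _ (moment_integrable n) _ H.
rewrite (_ : (2 - 1) * (2 - 1) = 1 :> R) ?mulr1; last by ring.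
by move=> H'; apply: lt_le_trans c0 (H' _ _ _) => [||z]; rewrite ?ler1n// mulr_ge0 ?weight_ge0 ?exprn_ge0 ?sq_ge0.
Qed.

Lemma l2_conj n : l2 m (conjRe n) /\ l2 m (conjIm n).
Proof.
have [[_ _ c1 _ _] [_ _ c2 _ _]] := @C1_conj R n.
have H (p : R * R -> R) : continuous p -> (forall z, p z ^+ 2 <= sq z ^+ n) -> l2 m p.
  move=> cp pn; have mp := continuous_measurable_prod cp; split => //.
  apply: le_integrable (moment_integrable n) => //.
    apply/measurable_EFinP; apply: measurable_funM; last exact: measurable_weight.
    exact: measurable_funX.
  move=> z _ /=; have sn : 0 <= sq z ^+ n by rewrite exprn_ge0 ?sq_ge0.
  rewrite lee_fin (ger0_norm (mulr_ge0 (sqr_ge0 (p z)) (weight_ge0 m z))).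
  by rewrite (ger0_norm (mulr_ge0 sn (weight_ge0 m z))) ler_wpM2r ?weight_ge0.
by split; apply: H => // z; rewrite -conj_norm ?lerDl ?lerDr sqr_ge0.
Qed.

Definition mono n : R[i] -> R[i] := fun z => z ^+ n.

Lemma re_mono n : re (mono n \o toC) = conjRe n.
Proof. by apply/funext => z; rewrite /re /mono /= toC_pow. Qed.

Lemma im_mono n : im (mono n \o toC) = fun z => -1 * conjIm n z.
Proof. by apply/funext => z; rewrite /im /mono /= toC_pow mulN1r. Qed.

Lemma inA2_mono n : inA2 m (mono n).
Proof.
split; first exact: entireX.
by have [l1 l2'] := l2_conj n; apply/inL2P; rewrite re_mono im_mono; split => //; exact: l2Z.
Qed.

Lemma norm2_mono n : norm2 m (mono n \o toC) = moment n.
Proof.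
have [l1 l2'] := l2_conj n.
rewrite /norm2 re_mono im_mono /J -rintD; [|exact: l2_ig|by apply: l2_ig; exact: l2Z].
by apply: eq_rint => z; rewrite -conj_norm; ring.
Qed.

(** Cauchy-Schwarz for [|z|^n] and [|z|^(n + 2)], whose product is [|z|^(2 (n + 1))]. *)
Lemma moment_CS n : moment n.+1 ^+ 2 <= moment n * moment n.+2.
Proof.
have H k : l2 m (fun z => cabs z ^+ k).
  split.
    apply: measurable_funX; apply: continuous_measurable_prod => z.
    apply: (cvg_comp sq Num.sqrt); last exact: sqrt_continuous.
    by have [_ _ c _ _] := @C1_sq R; exact: c.
  apply: ig_eq (moment_integrable k) => z.
  by rewrite -exprM mulnC exprM /cabs sqr_sqrtr// sq_ge0.
have JE j k i : (j + k = i.*2)%N -> J m (fun z => cabs z ^+ j) (fun z => cabs z ^+ k) = moment i.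
  move=> jki; apply: eq_rint => z.
  by rewrite -exprD jki -mul2n exprM /cabs sqr_sqrtr// sq_ge0.
have := J_CS (H n) (H n.+2); rewrite (JE n n.+2 n.+1) ?(JE n n n) ?(JE n.+2 n.+2 n.+2)//;
  by rewrite -addnn//; lia.
Qed.

Lemma moment_ratio n : moment 1 / moment 0 <= moment n.+1 / moment n.
Proof.
elim: n => [//|n IHn]; apply: (le_trans IHn).
rewrite ler_pdivrMr ?moment_gt0// mulrAC ler_pdivlMr ?moment_gt0// -expr2.
by rewrite mulrC moment_CS.
Qed.

(** Dominated convergence. At the origin every cutoff vanishes although its limit elsewhere is
    [exp (-1)]; with [F] zero there the convergence holds at every point. *)
Lemma chi_limit (F : R * R -> R) : ig F -> (forall z, sq z = 0 -> F z = 0) ->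
  ((fun j : nat => rint (fun z => F z * chi j.+1%:R (sq z))) @ \oo --> expR (-1) * rint F)%classic.
Proof.
move=> iF F0; have mF : measurable_fun setT F by have /integrableP[/measurable_EFinP] := iF.
have mc (r : R) : measurable_fun setT (fun z : R * R => chi r (sq z)).
  apply: (@measurableT_comp _ _ _ _ _ _ (chi r) _ sq); last exact: measurable_sq.
  apply: continuous_measurable_fun => x; exact: (is_derive1_cont (is_derive_chi r x)).
have [|||||] := @dominated_convergence _ _ _ mu setT measurableT
  (fun j z => (F z * chi j.+1%:R (sq z))%:E) (fun z => (expR (-1) * F z)%:E) (fun z => `|F z|%:E).
- by move=> j; apply/measurable_EFinP; exact: (measurable_funM mF (mc j.+1%:R)).
- apply/measurable_EFinP; exact: (measurable_funM (measurable_cst _) mF).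
- apply: aeW => z _; apply: cvg_EFin; first exact: nearW.
  have [z0|z0] := eqVneq (sq z) 0.
    by rewrite /= F0// mulr0; under eq_fun do rewrite mul0r; exact: cvg_cst.
  rewrite mulrC; apply: cvgMr; apply: chi_cvg; by rewrite lt_def z0 sq_ge0.
- exact: (integrable_abse iF).
- by apply: aeW => z j _; rewrite lee_fin normrM ler_piMr// ger0_norm ?chi_ge0// chi_le1.
move=> _ _ c; rewrite -(rintZ _ iF).
have fin : ((\int[mu]_z (expR (-1) * F z)%:E)%E \is a fin_num).
  exact: (integrable_fin_num measurableT (igZ (expR (-1)) iF)).
by move: c; rewrite -(fineK fin) => /fine_cvg.
Qed.

Lemma l2_sqX b : l2 m (fun z => sq z ^+ b).
Proof.
split; first by apply: measurable_funX; exact: measurable_sq.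
by apply: ig_eq (moment_integrable b.*2) => z; rewrite -mul2n mulnC exprM.
Qed.

Lemma conj_eq0 n (z : R * R) : sq z = 0 -> conjRe n.+1 z = 0 /\ conjIm n.+1 z = 0.
Proof.
move=> z0; have := conj_norm n.+1 z; rewrite z0 expr0n /= => /eqP.
by rewrite paddr_eq0 ?sqr_ge0// !sqrf_eq0 => /andP[/eqP -> /eqP ->].
Qed.

(** If [K' = th], then [K(|z|^2)] has d-bar derivative [z th(|z|^2)]. So [z ^ n.+1 th(|z|^2)] is
    [z ^ n] times a d-bar derivative, and its integral vanishes by the weak Cauchy-Riemann
    equations; this replaces the integration over the angle. *)
Lemma mono_mean_cutoff (r : R) n b : 0 < r ->
  rint (fun z => conjRe n.+1 z * (sq z ^+ b * bump m r (sq z))) = 0 /\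
  rint (fun z => conjIm n.+1 z * (sq z ^+ b * bump m r (sq z))) = 0.
Proof.
move=> r0; have ri : 0 < r^-1 by rewrite invr_gt0.
have H (c : R) : rint (fun z => c * (conjRe n.+1 z * (sq z ^+ b * bump m r (sq z)))) = 0 /\
    rint (fun z => - c * (conjIm n.+1 z * (sq z ^+ b * bump m r (sq z)))) = 0.
  (* The [1 / 2] cancels the factor 2 in the gradient of [|z|^2]; the sign of [c] is left free
     because [imC] of a power of [z] is minus [conjIm]. *)
  pose th (x : R) := c / 2 * (x ^+ b * bump m r x).
  have hth : halfline_smooth th by apply/hs_scale/hs_mul; [exact: hs_pow|exact: hs_bump].
  have th0 x : x < r^-1 -> th x = 0.
    by move=> xr; rewrite /th (bump_small m r0 xr).1 !mulr0.
  have thT x : r <= x -> th x = 0.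
    by move=> xr; rewrite /th (bump_large m r0 xr).1 !mulr0.
  have cth := halfline_smooth_cont hth ri th0.
  have [K dK KT] := compact_support_antiderivative cth th0 thT.
  have KthT t : r <= t -> K t = 0 /\ th t = 0 by move=> rt; rewrite KT// thT.
  have [A B] := entire_weak_dbar (@entireX R n) (C1c_radial (0, 0) dK cth KthT).
  have E1 (z : R * R) : reC (fun z => z ^+ n) z = conjRe n z by rewrite /reC toC_pow.
  have E2 (z : R * R) : imC (fun z => z ^+ n) z = - conjIm n z by rewrite /imC toC_pow.
  split.
    rewrite -[RHS]A; apply: eq_rint => z.
    by rewrite E1 E2 sqE conjReS /th /= !subr0; field.
  rewrite -[RHS]B; apply: eq_rint => z.
  by rewrite E1 E2 sqE conjImS /th /= !subr0; field.
split; [have [E _] := H 1|have [_ E] := H (-1)]; rewrite -[RHS]E; apply: eq_rint => z.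
  by rewrite mul1r.
by rewrite opprK mul1r.
Qed.

Lemma mono_mean n (b : nat) : rint (fun z => conjRe n.+1 z * (sq z ^+ b * W z)) = 0 /\
  rint (fun z => conjIm n.+1 z * (sq z ^+ b * W z)) = 0.
Proof.
have [l1 l2'] := l2_conj n.+1.
have H (p : R * R -> R) : l2 m p -> (forall z, sq z = 0 -> p z = 0) ->
    (forall r : R, 0 < r -> rint (fun z => p z * (sq z ^+ b * bump m r (sq z))) = 0) ->
    rint (fun z => p z * (sq z ^+ b * W z)) = 0.
  move=> lp p0 pr.
  have iF : ig (fun z => p z * (sq z ^+ b * W z)).
    by apply: ig_eq (l2_ig lp (l2_sqX b)) => z; rewrite mulrA.
  have F0 z : sq z = 0 -> p z * (sq z ^+ b * W z) = 0 by move=> /p0 ->; rewrite mul0r.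
  have := chi_limit iF F0.
  (* All integrals with cutoff are 0, and they tend to [exp (-1)] times the integral without
     cutoff. *)
  rewrite (_ : (fun j => _) = fun=> 0); last first.
    apply/funext => j; rewrite -[RHS](pr j.+1%:R)//; apply: eq_rint => z.
    have [z0|z0] := eqVneq (sq z) 0; first by rewrite p0// !mul0r.
    have zp : 0 < sq z by rewrite lt_def z0 sq_ge0.
    by rewrite weight_profile// /bump; ring.
  have c0 : ((fun _ : nat => 0 : R) @ \oo --> (0 : R))%classic by exact: cvg_cst.
  move=> c; have := seq_limit_unique c0 c.
  by move/esym/eqP; rewrite mulf_eq0 gt_eqF ?expR_gt0//= => /eqP.
split; apply: H => //; try by move=> z /(conj_eq0 n)[].
  by move=> r r0; have [] := mono_mean_cutoff n b r0.
by move=> r r0; have [] := mono_mean_cutoff n b r0.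
Qed.

End moments.

(** * Orthonormality of the monomials and the bounds for their pairings *)

Section monomial_basis.
Context {R : realType} (m : R) (m2 : 2 <= m).
Local Notation mu := (@leb2 R).
Local Notation rint := (Rintegral mu setT).
Local Notation Re := (@complex.Re R).
Local Notation Im := (@complex.Im R).
Local Notation W := (weight m).
Let m0 : 0 < m. Proof. exact: lt_le_trans m2. Qed.
Let hm : 0 <= m := ltW m0.

Lemma inL2_mono n : inL2 m (@mono R n \o toC).
Proof. by have [] := @inA2_mono R m m2 n. Qed.

(** The integrand is [z ^ d.+1] times the radial function [|z|^(2 k) W]. *)
Lemma ip_mono_add k d : ip m (@mono R (k + d.+1) \o toC) (mono k \o toC) = 0.
Proof.
have [M1 M2] := mono_mean m2 d k.
rewrite ipE; [|exact: inL2_mono|exact: inL2_mono]; rewrite !re_mono !im_mono.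
have [l1 l2'] := l2_conj m2 (k + d.+1); have [l3 l4] := l2_conj m2 k.
have ER z : conjRe (k + d.+1) z = conjRe k z * conjRe d.+1 z - conjIm k z * conjIm d.+1 z.
  by rewrite /conjRe exprD ReM.
have EI z : conjIm (k + d.+1) z = conjRe k z * conjIm d.+1 z + conjIm k z * conjRe d.+1 z.
  by rewrite /conjIm exprD ImM.
apply/eqP; rewrite eq_complex /=; apply/andP; split; apply/eqP.
  rewrite /J -rintD; [|exact: l2_ig|by apply: l2_ig; exact: l2Z].
  rewrite -[RHS]M1; apply: eq_rint => z; rewrite -conj_norm ER EI; ring.
rewrite /J -rintB; [|by apply: l2_ig => //; exact: l2Z|by apply: l2_ig => //; exact: l2Z].
transitivity (rint (fun z => -1 * (conjIm d.+1 z * (sq z ^+ k * W z)))).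
  by apply: eq_rint => z; rewrite -conj_norm ER EI; ring.
rewrite rintZ ?M2 ?mulr0//.
have [_ l5] := l2_conj m2 d.+1.
by apply: ig_eq (l2_ig l5 (l2_sqX m2 k)) => z; rewrite mulrA.
Qed.

Lemma ip_mono j k : ip m (@mono R j \o toC) (mono k \o toC) =
  if j == k then (real_complex R (moment m j)) else 0.
Proof.
have [jk|kj|->] := ltngtP j k.
- rewrite ipC; [|exact: inL2_mono|exact: inL2_mono].
  by rewrite -(subnKC jk) addSnnS ip_mono_add conjc0.
- by rewrite -(subnKC kj) addSnnS ip_mono_add.
- by rewrite ip_self ?norm2_mono//; exact: inL2_mono.
Qed.

Definition unit_mono n : R[i] -> R[i] :=
  fun z => ((Num.sqrt (moment m n))^-1)%:C%C * mono n z.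

Lemma inA2_unit_mono n : inA2 m (unit_mono n).
Proof.
have [mE lm] := @inA2_mono R m m2 n; split; last exact: inL2Z.
have cE : entire (fun=> ((Num.sqrt (moment m n))^-1)%:C%C) by exact: entire_cst.
exact: (entireM cE mE).
Qed.

Lemma inL2_unit_mono n : inL2 m (unit_mono n \o toC).
Proof. by have [] := inA2_unit_mono n. Qed.

Lemma ip_unit_mono j k : ip m (unit_mono j \o toC) (unit_mono k \o toC) = (j == k)%:R.
Proof.
have lj := inL2_mono j; have lk := inL2_mono k.
rewrite (ipZl _ lj (inL2_unit_mono k)) (ipC (inL2_unit_mono k) lj) (ipZl _ lk lj) ip_mono.
rewrite eq_sym; have [->|jk] := eqVneq j k; last by rewrite mulr0 conjc0 mulr0.
have s2 := sqr_sqrtr (ltW (moment_gt0 m2 k)).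
have s0 : Num.sqrt (moment m k) != 0 by rewrite gt_eqF// sqrtr_gt0 moment_gt0.
apply/eqP; rewrite eq_complex /=; apply/andP; split; apply/eqP; last by ring.
by move: s0 s2; move: (Num.sqrt _) => s s0 <-; field.
Qed.

Lemma pairing_mono (r : R) n : 0 < r ->
  pairing m (@mono R n.+1 \o toC) (fun z => conjRe n.+1 z * bump m r (sq z))
    (fun z => conjIm n.+1 z * bump m r (sq z)) =
  rint (fun z => (sq z ^+ n.+1 * W z) * chi r (sq z)).
Proof.
move=> r0; have [b1 b2] := l2_bump m0 r0 n.+1; have [l1 l2'] := l2_conj m2 n.+1.
rewrite /pairing re_mono im_mono -!J_div.
have i1 := l2_ig_div l1 b1; have i2 := l2_ig_div (l2Z (-1) l2') b2.
rewrite -rintB//; apply: eq_rint => z.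
have [z0|z0] := eqVneq (sq z) 0.
  by have [-> ->] := conj_eq0 n z0; rewrite z0 expr0n /=; ring.
have zp : 0 < sq z by rewrite lt_def z0 sq_ge0.
by rewrite -conj_norm weight_profile// /bump; ring.
Qed.

(** As the cutoff opens, the pairing tends to [exp (-1) * moment n.+1], so it eventually exceeds
    half of that. *)
Lemma pairing_mono_large n : exists2 r : R, 0 < r &
  expR (-1) / 2 * moment m n.+1 <=
  pairing m (@mono R n.+1 \o toC) (fun z => conjRe n.+1 z * bump m r (sq z))
    (fun z => conjIm n.+1 z * bump m r (sq z)).
Proof.
have F0 (z : R * R) : sq z = 0 -> sq z ^+ n.+1 * W z = 0.
  by move=> ->; rewrite expr0n mul0r.
have e0 : 0 < expR (-1) * moment m n.+1 by rewrite mulr_gt0 ?expR_gt0// moment_gt0.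
have lt : expR (-1) / 2 * moment m n.+1 < expR (-1) * moment m n.+1.
  by move: e0; move: (expR (-1)) (moment _ _) => a b; nra.
have [j _ jP] := cvgr_gt _ (chi_limit (moment_integrable m2 n.+1) F0) _ lt.
exists j.+1%:R; rewrite ?ltr0Sn//.
by rewrite pairing_mono ?ltr0Sn//; exact/ltW/(jP j (leqnn j)).
Qed.

(** The factor in [energy_le] is [alpha n.+1 + alpha + 25 (1 + alpha)] with [alpha = m / 2]; since
    [1 <= n.+1], it is at most this constant times [n.+1]. *)
Definition energy_cst : R := m / 2 + m / 2 + 25 * (1 + m / 2).

Lemma energy_cst_gt0 : 0 < energy_cst.
Proof. by rewrite /energy_cst; have := m0; lra. Qed.

Lemma pairing_weak_dbar_le (r : R) n (v g : R * R -> R[i]) : 0 < r ->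
  inL2 m v -> inL2 m g -> weak_dbar v g ->
  pairing m g (fun z => conjRe n.+1 z * bump m r (sq z))
    (fun z => conjIm n.+1 z * bump m r (sq z)) ^+ 2 <=
  2 * norm2 m v * (energy_cst * n.+1%:R * moment m n).
Proof.
move=> r0 lv lg vg; rewrite (weak_dbar_pairing m0 r0 n lv lg vg) sqrrN.
have [d1 d2] := l2_dbump m0 r0 n; have [E iE] := dbump_energy m0 r0 n.
apply: (le_trans (pairing_CS lv d1 d2)); rewrite E ler_wpM2l//.
  by rewrite mulr_ge0// norm2_ge0.
apply: (le_trans (energy_le m0 r0 iE (moment_integrable m2 n))).
rewrite ler_wpM2r ?(ltW (moment_gt0 m2 n))// /energy_cst.
have n1 : (1 : R) <= n.+1%:R by rewrite ler1n.
by move: n1 m0; move: (n.+1%:R) => N N1 mm; nra.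
Qed.

End monomial_basis.

(** * Linear combinations of weak solutions and Bessel's inequality at each point *)

Section weak_dbar_linear.
Context {R : realType} (m : R) (hm : 0 <= m).
Local Notation mu := (@leb2 R).
Local Notation ig f := (mu.-integrable setT (EFin \o f)).
Local Notation rint := (Rintegral mu setT).
Local Notation Re := (@complex.Re R).
Local Notation Im := (@complex.Im R).
Local Notation W := (weight m).

Definition igC (f : R * R -> R[i]) := ig (re f) /\ ig (im f).

Lemma cintD f g : igC f -> igC g -> cint (fun z => f z + g z) = cint f + cint g.
Proof.
move=> [f1 f2] [g1 g2]; rewrite /cint; apply/eqP; rewrite eq_complex /= -!rintD//.
by apply/andP; split; apply/eqP; apply: eq_rint => z; rewrite ?ReD ?ImD.
Qed.

Lemma cintZ (c : R[i]) f : igC f -> cint (fun z => c * f z) = c * cint f.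
Proof.
move=> [f1 f2]; rewrite /cint; apply/eqP; rewrite eq_complex /=.
have := f1; have := f2; rewrite /re /im => f2' f1'.
case: c => x y /=; rewrite -!(rintZ _ f1') -!(rintZ _ f2').
rewrite -rintB -?rintD; try exact: igZ.
by apply/andP; split; apply/eqP; apply: eq_rint => z; rewrite ?ReM ?ImM.
Qed.

Lemma test_fun_C1c (phi : R * R -> R) : test_fun phi ->
  C1c phi ('D_((1, 0) : R * R) phi) ('D_((0, 1) : R * R) phi).
Proof.
move=> [sm [r pr]]; have [c d] := sm [::]; have [cx _] := sm [:: (1, 0)]; have [cy _] := sm [:: (0, 1)].
split.
  split; [move=> z|move=> z|exact: c|exact: cx|exact: cy].
  - exact: (DeriveDef (d z (1, 0)) erefl).
  - exact: (DeriveDef (d z (0, 1)) erefl).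
exists r => z zr; have P v : 'D_v phi z = 0.
  have nz : \near z, (fun=> 0 : R) z = phi z.
    near=> y; rewrite pr//; near: y.
    apply: (cvgr_gt _ (@norm_continuous _ _ z)) => //.
  by rewrite -(near_eq_derive _ nz) derive_cst.
by rewrite !P pr.
Unshelve. all: end_near. Qed.

Lemma igC_test v phi : inL2 m v -> test_fun phi ->
  igC (fun z => v z * (phi z)%:C%C) /\ igC (fun z => v z * dbar_test phi z).
Proof.
move=> /inL2P[v1 v2] /test_fun_C1c/(C1c_l2 hm)[l lx ly].
have i1 := l2_ig_div v1 l; have i2 := l2_ig_div v2 l.
have i1x := l2_ig_div v1 lx; have i1y := l2_ig_div v1 ly.
have i2x := l2_ig_div v2 lx; have i2y := l2_ig_div v2 ly.
split; split.
- by apply: ig_eq i1 => z; rewrite /re ReM /=; ring.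
- by apply: ig_eq i2 => z; rewrite /im ImM /=; ring.
- by apply: ig_eq (igZ 2^-1 (igB i1x i2y)) => z; rewrite /re ReM /= /im; ring.
- by apply: ig_eq (igZ 2^-1 (igD i1y i2x)) => z; rewrite /im ImM /= /re; ring.
Qed.

Lemma weak_dbarD v v' g g' : inL2 m v -> inL2 m v' -> inL2 m g -> inL2 m g' ->
  weak_dbar v g -> weak_dbar v' g' -> weak_dbar (fun z => v z + v' z) (fun z => g z + g' z).
Proof.
move=> lv lv' lg lg' vg vg' phi tp.
have [_ iv] := igC_test lv tp; have [_ iv'] := igC_test lv' tp.
have [igg _] := igC_test lg tp; have [igg' _] := igC_test lg' tp.
under [in LHS]eq_fun do rewrite mulrDl; under [in RHS]eq_fun do rewrite mulrDl.
by rewrite !cintD// vg// vg'// opprD.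
Qed.

Lemma weak_dbarZ (c : R[i]) v g : inL2 m v -> inL2 m g ->
  weak_dbar v g -> weak_dbar (fun z => c * v z) (fun z => c * g z).
Proof.
move=> lv lg vg phi tp; have [_ iv] := igC_test lv tp; have [igg _] := igC_test lg tp.
under [in LHS]eq_fun do rewrite -mulrA; under [in RHS]eq_fun do rewrite -mulrA.
by rewrite !cintZ// vg// mulrN.
Qed.

Lemma weak_dbar_comb (a : nat -> R[i]) (u e : nat -> R * R -> R[i]) K :
  (forall k, inL2 m (u k)) -> (forall k, inL2 m (e k)) -> (forall k, weak_dbar (u k) (e k)) ->
  weak_dbar (comb a u K) (comb a e K).
Proof.
move=> lu le ue; elim: K => [|K IHK].
  rewrite !comb0 => phi _; have C0 : cint (fun=> 0 : R[i]) = 0.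
    by rewrite /cint /= rint0.
  by under [in LHS]eq_fun do rewrite mul0r; under [in RHS]eq_fun do rewrite mul0r; rewrite C0 oppr0.
rewrite !combS; apply: weak_dbarD => //; try exact: inL2_comb; try exact: inL2Z.
exact: weak_dbarZ.
Qed.

Lemma norm2_rint u : inL2 m u -> ig (fun z => sqnorm (u z) * W z) /\
  norm2 m u = rint (fun z => sqnorm (u z) * W z).
Proof.
move=> /inL2P[l1 l2']; have i1 := l2_ig l1 l1; have i2 := l2_ig l2' l2'.
have E z : re u z * re u z * W z + im u z * im u z * W z = sqnorm (u z) * W z.
  by rewrite /sqnorm /re /im; ring.
split; first by apply: ig_eq E _; exact: igD.
by rewrite /norm2 /J -rintD//; apply: eq_rint.
Qed.

Lemma rint_sum (F : nat -> R * R -> R) N : (forall n, ig (F n)) ->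
  ig (fun z => \sum_(n < N) F n z) /\
  rint (fun z => \sum_(n < N) F n z) = \sum_(n < N) rint (F n).
Proof.
move=> iF; elim: N => [|N [IH1 IH2]].
  rewrite (_ : (fun z => _) = fun=> 0); last by apply/funext => z; rewrite big_ord0.
  by rewrite rint0 big_ord0; split => //; exact: integrable0.
rewrite (_ : (fun z => \sum_(n < N.+1) _) = (fun z => \sum_(n < N) F n z + F N z)); last first.
  by apply/funext => z; rewrite big_ord_recr.
by rewrite rintD// IH2 big_ord_recr; split => //; exact: igD.
Qed.

Context {phi e u : nat -> R * R -> R[i]}.
Hypotheses (lphi : forall n, inL2 m (phi n))
  (ophi : forall j k, ip m (phi j) (phi k) = (j == k)%:R)
  (le : forall k, inL2 m (e k)) (oe : forall j k, ip m (e j) (e k) = (j == k)%:R)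
  (lu : forall k, inL2 m (u k)).

Lemma conjM (x y : R[i]) : conjc (x * y) = conjc y * conjc x.
Proof. by rewrite rmorphM mulrC. Qed.

(** With [z] fixed, the function [V = \sum_k conj (u k z) e_k] has norm squared [\sum_k |u k z|^2],
    and its inner products with the [phi n] are the conjugates of the combinations on the left. *)
Lemma pointwise_bessel K N z :
  \sum_(n < N) sqnorm (comb (fun k => ip m (phi n) (e k)) u K z) <= \sum_(k < K) sqnorm (u k z).
Proof.
pose b k := conjc (u k z); have lV := inL2_comb b K le.
have sqJ (c : R[i]) : sqnorm (conjc c) = sqnorm c by case: c => x y; rewrite /sqnorm /= sqrrN.
have := bessel_le lphi ophi N lV; rewrite norm2_comb//.
have -> : \sum_(k < K) sqnorm (b k) = \sum_(k < K) sqnorm (u k z).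
  by apply: eq_bigr => k _; exact: sqJ.
apply: le_trans.
rewrite le_eqVlt; apply/orP; left; apply/eqP; apply: eq_bigr => n _.
rewrite ip_comb// -sqJ /comb rmorph_sum /=; congr sqnorm; apply: eq_bigr => k _.
by rewrite (ipC (lphi n) (le k)) /b conjM.
Qed.

Lemma integrated_bessel K N :
  \sum_(n < N) norm2 m (comb (fun k => ip m (phi n) (e k)) u K) <= \sum_(k < K) norm2 m (u k).
Proof.
have lv n := inL2_comb (fun k => ip m (phi n) (e k)) K lu.
have iu k := (norm2_rint (lu k)).1; have iv n := (norm2_rint (lv n)).1.
under eq_bigr do rewrite (norm2_rint (lv _)).2; under [leRHS]eq_bigr do rewrite (norm2_rint (lu _)).2.
have [i1 <-] := rint_sum N iv; have [i2 <-] := rint_sum K iu.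
apply: rint_le => // z; rewrite -!mulr_suml ler_wpM2r ?weight_ge0//.
exact: pointwise_bessel.
Qed.

End weak_dbar_linear.

(** * Divergence *)

Section divergence.
Context {R : realType} (m : R) (m2 : 2 <= m).
Context {e : nat -> R[i] -> R[i]} {u : nat -> R * R -> R[i]}.
Hypotheses (onb : A2_onb m e) (lu : forall k, inL2 m (u k))
  (ue : forall k, weak_dbar (u k) (e k \o toC)).
Local Notation W := (weight m).
Let m0 : 0 < m. Proof. exact: lt_le_trans m2. Qed.
Let hm : 0 <= m := ltW m0.
Let E k := e k \o toC.
(** The shift by one matches the test function: [conj z ^ n.+1 w chi] has a d-bar derivative with
    [conj z ^ n], whose energy is controlled by [moment n]. *)
Let Phi n := unit_mono m n.+1 \o toC.
Let a n k := ip m (Phi n) (E k).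

(** The pairing is continuous in the norm by Cauchy-Schwarz, and the partial sums converge in norm
    by [parseval]. *)
Lemma pairing_comb_cvg n (q1 q2 : R * R -> R) :
  l2 m (fun z => q1 z / W z) -> l2 m (fun z => q2 z / W z) ->
  ((fun K => pairing m (comb (a n) E K) q1 q2) @ \oo --> pairing m (Phi n) q1 q2)%classic.
Proof.
move=> l1 l2'; have P := parseval hm onb (inA2_unit_mono m2 n.+1).
have le k : inL2 m (E k) by have [eA _ _] := onb; have [] := eA k.
have B K q (lq : l2 m q) := J_sub_bound (inL2_unit_mono m2 n.+1) (inL2_comb (a n) K le) lq.
apply: cvgB; apply: sqr_dominated_cvg P _ => K.
  by rewrite mulrC; have [H _] := B K _ l1; exact: H.
by rewrite mulrC; have [_ H] := B K _ l2'; exact: H.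
Qed.

Lemma pairingZ (c : R) (f : R * R -> R[i]) (q1 q2 : R * R -> R) : inL2 m f ->
  l2 m (fun z => q1 z / W z) -> l2 m (fun z => q2 z / W z) ->
  pairing m (fun z => c%:C%C * f z) q1 q2 = c * pairing m f q1 q2.
Proof.
move=> /inL2P[f1 f2] l1 l2'; rewrite /pairing mulrBr.
rewrite (_ : re _ = fun z => c * re f z); last first.
  by apply/funext => z; rewrite /re ReM /= mul0r subr0.
rewrite (_ : im _ = fun z => c * im f z); last first.
  by apply/funext => z; rewrite /im ImM /= mul0r addr0.
by rewrite !JZl.
Qed.

Lemma cvg_sum_ord (F : nat -> nat -> R) (l : nat -> R) N :
  (forall n, (F n @ \oo --> l n)%classic) ->
  ((fun K => \sum_(n < N) F n K) @ \oo --> \sum_(n < N) l n)%classic.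
Proof.
move=> Fl; elim: N => [|N IHN].
  by under eq_fun do rewrite big_ord0; rewrite big_ord0; exact: cvg_cst.
by under eq_fun do rewrite big_ord_recr; rewrite big_ord_recr; exact: cvgD.
Qed.

Lemma harmonic_bounded (X : R) : (forall K, \sum_(k < K) norm2 m (u k) <= X) ->
  exists B : R, forall N, \sum_(n < N) (n.+1%:R^-1 : R) <= B.
Proof.
move=> uX; have [eA oe _] := onb.
have le k : inL2 m (E k) by have [] := eA k.
(* The radius of the cutoff may depend on [n], as the energy bound is the same for all radii;
   [choice] fixes one radius for each [n]. *)
have [r rP] := choice (fun n => let: ex_intro2 r r0 rn := pairing_mono_large m2 n in
  ex_intro (fun r => 0 < r /\ _ <= pairing m _ (fun z => conjRe n.+1 z * bump m r (sq z)) _) r (conj r0 rn)).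
pose q1 n z := conjRe n.+1 z * bump m (r n) (sq z).
pose q2 n z := conjIm n.+1 z * bump m (r n) (sq z).
pose k := expR (-1) / 2 : R; have k0 : 0 < k by rewrite divr_gt0 ?expR_gt0.
pose C := energy_cst m; have C0 : 0 < C by exact: energy_cst_gt0.
pose c n := 2 * (C * n.+1%:R * moment m n).
have c0 n : 0 < c n by rewrite !mulr_gt0 ?moment_gt0.
pose p n := pairing m (Phi n) (q1 n) (q2 n).
(* Normalizing divides the pairing by [sqrt (moment n.+1)], so its square keeps one factor
   [moment n.+1]. *)
have pge n : k ^+ 2 * moment m n.+1 <= p n ^+ 2.
  have [r0 H] := rP n.
  have M0 := moment_gt0 m2 n.+1.
  have [b1 b2] := l2_bump m0 r0 n.+1.
  rewrite /p /Phi pairingZ//; last exact: inL2_mono.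
  set s := Num.sqrt _; have s0 : s != 0 by rewrite gt_eqF// sqrtr_gt0.
  have sM : s ^+ 2 = moment m n.+1 by rewrite sqr_sqrtr// ltW.
  have kM : 0 <= k * moment m n.+1 by rewrite mulr_ge0 ?ltW.
  rewrite [leRHS]exprMn exprVn sM [leRHS]mulrC ler_pdivlMr//.
  rewrite (_ : k ^+ 2 * _ * _ = (k * moment m n.+1) ^+ 2); last by ring.
  by rewrite ler_sqr ?nnegrE//; apply: le_trans kM _; exact: H.
(* [N] is fixed while [K] tends to infinity: each [K] obeys the bound through [integrated_bessel],
   and the finite sum of squared pairings passes to the limit. *)
have lim N : \sum_(n < N) (p n ^+ 2 / c n) <= X.
  have oP j k' : ip m (Phi j) (Phi k') = (j == k')%:R by rewrite ip_unit_mono// eqSS.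
  have cT : ((fun K => \sum_(n < N) (pairing m (comb (a n) E K) (q1 n) (q2 n) ^+ 2 / c n)) @ \oo -->
      \sum_(n < N) (p n ^+ 2 / c n))%classic.
    apply: (@cvg_sum_ord (fun n K => pairing m (comb (a n) E K) (q1 n) (q2 n) ^+ 2 / c n)
      (fun n => p n ^+ 2 / c n)) => n.
    have [r0 _] := rP n; have [b1 b2] := l2_bump m0 r0 n.+1.
    have cP := @pairing_comb_cvg n (q1 n) (q2 n) b1 b2.
    apply: cvgM; last exact: cvg_cst.
    by rewrite expr2; under eq_fun do rewrite expr2; exact: cvgM.
  rewrite -(cvg_lim (@Rhausdorff R) cT); apply: limr_le; first by apply/cvg_ex; eexists; exact: cT.
  apply: nearW => K; apply: le_trans (uX K).
  have lP n : inL2 m (Phi n) by exact: inL2_unit_mono.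
  apply: le_trans (@integrated_bessel _ m Phi E u lP oP le oe lu K N).
  apply: ler_sum => n _; rewrite ler_pdivrMr// /c mulrCA mulrA.
  have [r0 _] := rP n.
  apply: (pairing_weak_dbar_le m2 n r0); [exact: inL2_comb|exact: inL2_comb|].
  exact: (weak_dbar_comb hm).
pose d := moment m 1 / moment m 0; have d0 : 0 < d by rewrite divr_gt0 ?moment_gt0.
have kd : 0 < k ^+ 2 * d by rewrite mulr_gt0// exprn_gt0.
(* Each term [p n ^ 2 / c n] is at least [k^2 d / (2 C (n + 1))], because
   [moment n.+1 >= d * moment n]. *)
exists (X * (2 * C) / (k ^+ 2 * d)) => N.
rewrite ler_pdivlMr// mulrC -ler_pdivrMr; last by rewrite mulr_gt0.
apply: le_trans (lim N); rewrite mulrAC mulr_sumr; apply: ler_sum => n _.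
rewrite ler_pdivlMr//; apply: le_trans (pge n).
have rat := moment_ratio m2 n; rewrite -/d ler_pdivlMr ?moment_gt0// in rat.
have n0 : (n.+1%:R : R) != 0 by rewrite pnatr_eq0.
have Cn0 : C != 0 by rewrite gt_eqF.
rewrite (_ : _ * c n = k ^+ 2 * (d * moment m n)); last first.
  by rewrite /c; move: (n.+1%:R) n0 => y y0; field; rewrite y0.
by rewrite ler_pM2l ?exprn_gt0.
Qed.

End divergence.

(* Not Hilbert-Schmidt: for every orthonormal basis (e_k) of A^2, with S the
   canonical solution operator, \sum_k ||S e_k||^2 = +oo. *)
Theorem theorem3p3 (R : realType) (m : R) (hm : 2 <= m)
  (e : nat -> R[i] -> R[i]) (u : nat -> R * R -> R[i]) :
  A2_onb m e ->
  (forall k, canonical_solution m (e k) (u k)) ->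
  (\sum_(0 <= k <oo) L2norm2 m (u k) = +oo)%E.
Proof.
move=> onb sol; apply/eqP; rewrite eq_le leey /= leNgt; apply/negP => fin.
have lu k : inL2 m (u k) by have [] := sol k.
have ue k : weak_dbar (u k) (e k \o toC) by have [] := sol k.
have S0 k : (0 <= L2norm2 m (u k))%E by rewrite L2norm2E// lee_fin norm2_ge0.
set S := (\sum_(0 <= k <oo) _)%E in fin.
have part K : ((\sum_(k < K) norm2 m (u k))%:E <= S)%E.
  have := @nneseries_lim_ge R (fun k => L2norm2 m (u k)) xpredT 0 K (fun k _ _ => S0 k).
  apply: le_trans; rewrite big_mkord -sumEFin; apply: lee_sum => k _.
  by rewrite L2norm2E.
have Sfin : S \is a fin_num.
  by rewrite ge0_fin_numE//; have := part 0%N; rewrite big_ord0.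
have uX K : \sum_(k < K) norm2 m (u k) <= fine S by rewrite -lee_fin fineK.
have [B HB] := harmonic_bounded hm onb lu ue uX.
apply: (@dvg_harmonic R); apply: nondecreasing_is_cvgn.
  apply/nondecreasing_seqP => n; rewrite /series /= big_nat_recr //= lerDl.
  by rewrite invr_ge0.
exists B => _ [N _ <-]; rewrite /series /= big_mkord; exact: HB.
Qed.
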